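(* Let $q\in L_2(0,1)$ be complex-valued, $a\in[0,1]$, $\gamma\in\mathbb C\setminus\{0\}$, and let $\alpha=\alpha(\gamma)$ be the number defined in the context. Then the spectrum $\{\lambda_n\}_{n\ge0}$ of the boundary value problem $\mathcal L(q(x),a,\gamma)$ has the form $$ \lambda_{2k}=(2k+\alpha)^2\pi^2+\varkappa_{2k},\quad k\ge0,\qquad \lambda_{2k-1}=(2k-\alpha)^2\pi^2+\varkappa_{2k-1},\quad k\ge1,\qquad \{\varkappa_n\}_{n\ge0}\in l_2 . $$ Moreover, if $\gamma=\pm1$ (i.e. if $\alpha\in\{0,1\}$), then $\varkappa_{2k-1}=0$ for all $k\ge1$.
   Context: For a complex-valued $q\in L_2(0,1)$, $a\in[0,1]$ and $\gamma\in\mathbb C\setminus\{0\}$, $\mathcal L(q(x),a,\gamma)$ denotes the boundary value problem $$-y''(x)+q(x)y(a)=\lambda y(x),\quad 0<x<1,\qquad y^{(\nu)}(0)=\gamma y^{(\nu)}(1),\quad \nu=0,1,$$ for $y\in W_2^2[0,1]$, with spectral parameter $\lambda\in\mathbb C$. Let $C(x,\lambda)$, $S(x,\lambda)$ be the solutions of the equation with $C(a,\lambda)=S'(a,\lambda)=1$, $S(a,\lambda)=C'(a,\lambda)=0$; with $\rho^2=\lambda$, $$C(x,\lambda)=\cos\rho(x-a)+\int_a^x\frac{\sin\rho(x-t)}{\rho}q(t)\,dt,\qquad S(x,\lambda)=\frac{\sin\rho(x-a)}{\rho}.$$ The eigenvalues of the problem are the zeros of its characteristic function, the entire function $$\Delta(\lambda)=\begin{vmatrix}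 C(0,\lambda)-\gamma C(1,\lambda) & S(0,\lambda)-\gamma S(1,\lambda)\\ C'(0,\lambda)-\gamma C'(1,\lambda) & S'(0,\lambda)-\gamma S'(1,\lambda)\end{vmatrix}.$$ The spectrum $\{\lambda_n\}_{n\ge0}$ is the collection of zeros of $\Delta$ counted with multiplicity; ''has the form'' means that it can be numbered so that the stated relations hold. For $\gamma\ne0$ put $\alpha:=\frac1\pi\arccos\frac{1+\gamma^2}{2\gamma}$, where the branch is chosen so that $\alpha\in\{z:\mathrm{Re}\,z\in[0,1],\ \mathrm{Im}\,z\ge0\}\cup\{z:\mathrm{Re}\,z\in(0,1),\ \mathrm{Im}\,z<0\}$, i.e. $\alpha$ is the unique number in this set with $\cos\pi\alpha=\frac{1+\gamma^2}{2\gamma}$. In particular $\alpha=0$ for $\gamma=1$ and $\alpha=1$ for $\gamma=-1$. *)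

(* Defs.v *)
From HB Require Import structures.
From mathcomp Require Import all_boot all_order all_algebra.
From mathcomp Require Import all_classical all_reals all_analysis.
From mathcomp Require Import complex.

Set Implicit Arguments.
Unset Strict Implicit.
Unset Printing Implicit Defensive.

Import Order.TTheory GRing.Theory Num.Theory.
Import numFieldNormedType.Exports.

Local Open Scope classical_set_scope.
Local Open Scope card_scope.
Local Open Scope ring_scope.
Local Open Scope complex_scope.

Section Complex.
Context {R : realType}.
Implicit Types (D : set R) (f : R -> R[i]) (z : R[i]).

Definition absc z : R := ComplexField.Normc.normc z.

Definition cexp z : R[i] :=
  (expR (complex.Re z))%:C * (cos (complex.Im z) +i* sin (complex.Im z)).

Definition ccos z : R[i] :=
  (cexp ((0 +i* 1) * z) + cexp (- ((0 +i* 1) * z))) / 2%:R.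

Definition cintegral D f : R[i] :=
  (\int[lebesgue_measure]_(x in D) complex.Re (f x))
    +i* (\int[lebesgue_measure]_(x in D) complex.Im (f x)).

(* Representatives of the elements of the complex space L_2(0,1); their values
   outside ]0, 1[ are irrelevant. *)
Definition L2_01 f : Prop :=
  [/\ measurable_fun (`]0, 1[ : set R) (fun x => complex.Re (f x)),
      measurable_fun (`]0, 1[ : set R) (fun x => complex.Im (f x)) &
      (\int[lebesgue_measure]_(x in (`]0%R, 1%R[ : set R))
         ((absc (f x) ^+ 2)%:E) < +oo)%E].

(* y is in W_2^2[0,1], y1 is its derivative on [0,1] (absolutely continuous, so
   the values y1 0 and y1 1 are meaningful) and y2 its generalized second
   derivative. *)
Definition W22 (y y1 y2 : R -> R[i]) : Prop :=
  [/\ L2_01 y2,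
      forall x : R, 0 <= x <= 1 -> y1 x = y1 0 + cintegral `[0, x] y2 &
      forall x : R, 0 <= x <= 1 -> y x = y 0 + cintegral `[0, x] y1].

(* y, with derivative y1, solves -y'' + q(x) y(a) = lambda y on (0,1). *)
Definition is_solution (q : R -> R[i]) (a : R) (lambda : R[i])
    (y y1 : R -> R[i]) : Prop :=
  exists2 y2 : R -> R[i], W22 y y1 y2 &
    {ae lebesgue_measure, forall x : R, 0 < x < 1 ->
       - y2 x + q x * y a = lambda * y x}.

(* The solutions C(-,lambda), S(-,lambda), which exist and are uniquely
   determined on [0,1] by these conditions; C1 and S1 are their derivatives in x. *)
Definition fundamental_solutions (q : R -> R[i]) (a : R)
    (C C1 S S1 : R[i] -> R -> R[i]) : Prop :=
  forall lambda,
    [/\ is_solution q a lambda (C lambda) (C1 lambda),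
        C lambda a = 1, C1 lambda a = 0,
        is_solution q a lambda (S lambda) (S1 lambda) &
        S lambda a = 0 /\ S1 lambda a = 1].

Definition char_fun (gamma : R[i]) (C C1 S S1 : R[i] -> R -> R[i])
    (lambda : R[i]) : R[i] :=
  (C lambda 0 - gamma * C lambda 1) * (S1 lambda 0 - gamma * S1 lambda 1)
  - (S lambda 0 - gamma * S lambda 1) * (C1 lambda 0 - gamma * C1 lambda 1).

(* Multiplicity m of z as a zero of an entire function F (m = 0 when F z is
   nonzero), in terms of the complex derivatives of F; R[i]^o is R[i] as a
   normed module over itself. *)
Definition zero_multiplicity (F : R[i] -> R[i]) (z : R[i]) (m : nat) : Prop :=
  (forall k, (k < m)%N -> derive1n k (F : R[i] -> R[i]^o) z = 0) /\
  derive1n m (F : R[i] -> R[i]^o) z != 0.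

(* lam lists exactly the zeros of F, each as often as its multiplicity. *)
Definition enumerates_zeros (F : R[i] -> R[i]) (lam : nat -> R[i]) : Prop :=
  forall z, exists2 m : nat, zero_multiplicity F z m &
    [set n : nat | lam n = z] #= `I_m.

(* alpha = arccos((1 + gamma^2) / (2 gamma)) / pi; the branch set contains
   exactly one such number. *)
Definition is_alpha (gamma alpha : R[i]) : Prop :=
  (0 <= complex.Re alpha <= 1 /\ 0 <= complex.Im alpha \/
   0 < complex.Re alpha < 1 /\ complex.Im alpha < 0) /\
  ccos ((pi : R)%:C * alpha) = (1 + gamma ^+ 2) / (2%:R * gamma).

Definition in_l2 (u : nat -> R[i]) : Prop :=
  (\sum_(0 <= n <oo) ((absc (u n) ^+ 2)%:E) < +oo)%E.

End Complex.

(* Main.v *)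
(** Write [lambda = rho ^ 2]. Integrating the equation against [cos] and [sin]
    expresses the characteristic function through integrals of [q] against
    [sin (rho (c + t)) / rho] and [cos (rho (c + t))]. It is a perturbation of
    [2 gamma (cos (pi alpha) - cos rho)], whose zeros are
    [(2k + alpha)^2 pi^2], [k] in [Z]. If [gamma = 1] it factors as
    [2 sin (rho / 2) / rho] times a perturbation of [2 rho sin (rho / 2)], and if
    [gamma = -1] as [2 cos (rho / 2)] times a perturbation of [2 cos (rho / 2)];
    the first factors account for the zeros without remainder.

    The perturbation is smaller than the model function by a factor of order
    [1 / |rho|] away from the model zeros, so Rouche's theorem on large circles
    and on small circles around each model zero puts exactly one zero near each
    of them. At a model zero the perturbation is moreover of size
    [b_n / |rho|], where [b_n] consists of Fourier coefficients of an [L_2]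
    function, so Bessel's inequality makes the displacements square summable. *)

Require Import Defs.
From HB Require Import structures.
From mathcomp Require Import all_boot all_order all_algebra.
From mathcomp Require Import all_classical all_reals all_analysis.
From mathcomp Require Import complex.
From mathcomp Require Import measurable_realfun finmap ring lra.
Import Order.TTheory GRing.Theory Num.Theory.
Import numFieldNormedType.Exports.
Local Open Scope ring_scope.
Local Open Scope complex_scope.

Set Implicit Arguments.
Unset Strict Implicit.
Unset Printing Implicit Defensive.

(** For gamma = 1 and gamma = -1 the model zeros (2k + alpha)^2 pi^2 and (2k - alpha)^2 pi^2
    coincide in pairs, apart from lambda = 0. A perturbation of relative size eps may move a double
    zero by sqrt eps, too much for square summability; the factorization makes the zeros of each
    factor simple and well separated again. Otherwise alpha is not an integer and the model zeros
    are simple. Lengths in the lambda-plane are measured in units of 1 + |rho|: since d lambda = 2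
    rho d rho, unit gaps in rho become gaps of this size. The displacement d of a zero satisfies c d
    <= b_n + K d / (1 + |rho|). A crude bound d = O(1), fed back into the right-hand side, leaves
    b_n + O(1/n), which is square summable. The complex analysis rests on polynomials: entire
    functions are limits in coefficient norms, zeros are split off by divided differences, and
    Rouche's theorem is proved for products of linear factors by continuous arguments and carried
    over by approximation. *)

Section ComplexModulus.
Context {R : realType}.
Implicit Types (z w : R[i]) (x : R).

Lemma real_complex_eq0 x : (x%:C == 0 :> R[i]) = (x == 0).
Proof. by rewrite eq_complex /= eqxx andbT. Qed.

Lemma abscE z : `|z| = (absc z)%:C.
Proof. by case: z => a b; rewrite normc_def. Qed.

Lemma absc_ge0 z : 0 <= absc z.
Proof. by case: z => a b; apply: sqrtr_ge0. Qed.

Lemma absc0 : absc (0 : R[i]) = 0.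
Proof. exact: ComplexField.Normc.normc0. Qed.

Lemma absc1 : absc (1 : R[i]) = 1.
Proof. exact: ComplexField.Normc.normc1. Qed.

Lemma abscM z w : absc (z * w) = absc z * absc w.
Proof. exact: ComplexField.Normc.normcM. Qed.

Lemma abscV z : absc z^-1 = (absc z)^-1.
Proof. exact: ComplexField.Normc.normcV. Qed.

Lemma abscN z : absc (- z) = absc z.
Proof. by apply: complexI; rewrite -!abscE normrN. Qed.

Lemma absc_subC z w : absc (z - w) = absc (w - z).
Proof. by rewrite -abscN opprB. Qed.

Lemma abscD z w : absc (z + w) <= absc z + absc w.
Proof. by rewrite -lecR rmorphD /= -!abscE ler_normD. Qed.

Lemma abscB z w : absc (z - w) <= absc z + absc w.
Proof. by rewrite -(abscN w) abscD. Qed.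

Lemma absc_lerB z w : absc z - absc w <= absc (z - w).
Proof. by rewrite lerBlDr; apply: le_trans (abscD _ _); rewrite subrK. Qed.

Lemma absc_tri z w u : absc (z - w) <= absc (z - u) + absc (u - w).
Proof. by apply: le_trans (abscD _ _); rewrite addrA subrK. Qed.

Lemma absc_eq0 z : (absc z == 0) = (z == 0).
Proof. by rewrite -(inj_eq (@complexI R)) -abscE normr_eq0. Qed.

Lemma absc_gt0 z : (0 < absc z) = (z != 0).
Proof. by rewrite lt_def absc_ge0 andbT absc_eq0. Qed.

Lemma abscX z n : absc (z ^+ n) = absc z ^+ n.
Proof. by elim: n => [|n IH]; rewrite ?expr0 ?absc1// !exprS abscM IH. Qed.

Lemma absc_real x : absc x%:C = `|x|.
Proof. by rewrite /absc /= expr0n addr0 sqrtr_sqr. Qed.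

Lemma absc_nat n : absc (n%:R : R[i]) = n%:R.
Proof. by rewrite -(rmorph_nat (real_complex R)) absc_real ger0_norm. Qed.

Lemma absc_sqr z : absc z ^+ 2 = complex.Re z ^+ 2 + complex.Im z ^+ 2.
Proof. by case: z => a b; rewrite /absc /= sqr_sqrtr// addr_ge0 ?sqr_ge0. Qed.

Lemma absc_Re z : `|complex.Re z| <= absc z.
Proof.
rewrite -(@ler_pXn2r _ 2) ?nnegrE ?absc_ge0// absc_sqr real_normK ?num_real//.
by rewrite lerDl sqr_ge0.
Qed.

Lemma absc_Im z : `|complex.Im z| <= absc z.
Proof.
rewrite -(@ler_pXn2r _ 2) ?nnegrE ?absc_ge0// absc_sqr real_normK ?num_real//.
by rewrite lerDr sqr_ge0.
Qed.

Lemma absc_conj z : absc (z^*) = absc z.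
Proof. by case: z => a b; rewrite /absc /= sqrrN. Qed.

Lemma absc_sum (I : Type) (s : seq I) (P : pred I) (F : I -> R[i]) :
  absc (\sum_(i <- s | P i) F i) <= \sum_(i <- s | P i) absc (F i).
Proof.
elim/big_rec2 : _ => [|i x z _ h]; first by rewrite absc0.
by apply: le_trans (abscD _ _) _; rewrite lerD2l.
Qed.

Lemma absc_le_ReIm z : absc z <= `|complex.Re z| + `|complex.Im z|.
Proof.
rewrite -(@ler_pXn2r _ 2) ?nnegrE ?absc_ge0 ?addr_ge0// absc_sqr.
rewrite -(real_normK (num_real (complex.Re z))) -(real_normK (num_real (complex.Im z))).
by rewrite sqrrD lerD2r lerDl mulrn_wge0// mulr_ge0.
Qed.

Lemma ReM z w : complex.Re (z * w) =
  complex.Re z * complex.Re w - complex.Im z * complex.Im w.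
Proof. by case: z w => [a b] [c d]. Qed.

Lemma ImM z w : complex.Im (z * w) =
  complex.Re z * complex.Im w + complex.Im z * complex.Re w.
Proof. by case: z w => [a b] [c d]. Qed.

Lemma ReD z w : complex.Re (z + w) = complex.Re z + complex.Re w.
Proof. by case: z w => [a b] [c d]. Qed.

Lemma ImD z w : complex.Im (z + w) = complex.Im z + complex.Im w.
Proof. by case: z w => [a b] [c d]. Qed.

Lemma ReN z : complex.Re (- z) = - complex.Re z.
Proof. by case: z. Qed.

Lemma ImN z : complex.Im (- z) = - complex.Im z.
Proof. by case: z. Qed.

Lemma ReImP z w : complex.Re z = complex.Re w -> complex.Im z = complex.Im w -> z = w.
Proof. by case: z w => [a b] [c d] /= -> ->. Qed.

Lemma sqr_norm_conj z : z * z^* = ((absc z) ^+ 2)%:C.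
Proof. by rewrite rmorphXn /= -abscE sqr_normc. Qed.

Lemma absc_le_eps z : (forall e, 0 < e -> absc z <= e) -> z = 0.
Proof.
move=> h; apply/eqP; rewrite -absc_eq0 eq_le absc_ge0 andbT.
by apply/ler_addgt0Pl => e e0; rewrite addr0 h.
Qed.

End ComplexModulus.

(** * Coefficient norms of polynomials and divided differences *)

Section CoefficientNorm.
Context {R : realType}.
Implicit Types (p q : {poly R[i]}) (r s : R) (z c : R[i]).

(** A submultiplicative norm that dominates the modulus on the disc of radius [r]. Its recursion
    along [p * 'X + c] makes derivatives and divided differences accessible to induction. *)
Definition pnorm r p : R := \sum_(i < size p) absc p`_i * r ^+ i.

Lemma pnorm_widen n r p : (size p <= n)%N ->
  pnorm r p = \sum_(i < n) absc p`_i * r ^+ i.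
Proof.
move=> le_pn; rewrite /pnorm -!(big_mkord xpredT (fun i => absc p`_i * r ^+ i)).
rewrite [RHS](big_cat_nat (leq0n (size p)) le_pn)//= [X in _ + X]big_nat_cond [X in _ + X]big1 ?addr0//.
by move=> i /andP[/andP[h _] _]; rewrite nth_default// absc0 mul0r.
Qed.

Lemma pnorm_ge0 r p : 0 <= r -> 0 <= pnorm r p.
Proof. by move=> r0; apply: sumr_ge0 => i _; rewrite mulr_ge0 ?absc_ge0 ?exprn_ge0. Qed.

Lemma pnorm0 r : pnorm r 0 = 0.
Proof. by rewrite /pnorm size_poly0 big_ord0. Qed.

Lemma pnormN r p : pnorm r (- p) = pnorm r p.
Proof. by rewrite /pnorm size_polyN; apply: eq_bigr => i _; rewrite coefN abscN. Qed.

Lemma pnorm_subC r p q : pnorm r (p - q) = pnorm r (q - p).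
Proof. by rewrite -pnormN opprB. Qed.

Lemma pnormD r p q : 0 <= r -> pnorm r (p + q) <= pnorm r p + pnorm r q.
Proof.
move=> r0; rewrite (pnorm_widen r (size_polyD p q)).
rewrite (pnorm_widen r (leq_maxl (size p) (size q))).
rewrite (pnorm_widen r (leq_maxr (size p) (size q))) -big_split /=.
apply: ler_sum => i _; rewrite coefD -mulrDl ler_wpM2r ?exprn_ge0//.
exact: abscD.
Qed.

Lemma pnorm_scale r c p : pnorm r (c *: p) = absc c * pnorm r p.
Proof.
have /pnorm_widen -> := size_scale_leq c p; rewrite /pnorm mulr_sumr.
by apply: eq_bigr => i _; rewrite coefZ abscM mulrA.
Qed.

Lemma pnorm_mulXaddC r p c : pnorm r (p * 'X + c%:P) = pnorm r p * r + absc c.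
Proof.
have h : (size (p * 'X + c%:P)%R <= (size p).+1)%N.
  by rewrite size_MXaddC; case: ifP.
rewrite (pnorm_widen r h) big_ord_recl coefD coefMX coefC /= add0r expr0 mulr1 addrC.
rewrite /pnorm mulr_suml; congr (_ + _); apply: eq_bigr => i _.
by rewrite coefD coefMX coefC /= addr0 exprSr mulrA.
Qed.

Lemma pnormMX r p : pnorm r (p * 'X) = pnorm r p * r.
Proof. by rewrite -[p * 'X]addr0 -polyC0 pnorm_mulXaddC absc0 addr0. Qed.

Lemma pnorm_le r s p : 0 <= r <= s -> pnorm r p <= pnorm s p.
Proof.
move=> /andP[r0 rs]; apply: ler_sum => i _; rewrite ler_wpM2l ?absc_ge0//.
by rewrite lerXn2r ?nnegrE// (le_trans r0).
Qed.

Lemma absc_horner_pnorm r p z : absc z <= r -> absc p.[z] <= pnorm r p.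
Proof.
move=> zr; rewrite horner_coef; apply: le_trans (absc_sum _ _ _) _.
apply: ler_sum => i _; rewrite abscM ler_wpM2l ?absc_ge0// abscX.
by rewrite lerXn2r ?nnegrE ?absc_ge0// (le_trans (absc_ge0 z)).
Qed.

Lemma pnormM r p q : 0 <= r -> pnorm r (p * q) <= pnorm r p * pnorm r q.
Proof.
move=> r0; elim/poly_ind: p => [|p c IH]; first by rewrite mul0r pnorm0 mul0r.
rewrite pnorm_mulXaddC mulrDl mulrDl -mulrA ['X * _]mulrC mulrA.
apply: le_trans (pnormD _ _ r0) _; rewrite lerD//.
  by rewrite pnormMX mulrAC ler_wpM2r.
by rewrite mul_polyC pnorm_scale.
Qed.

Lemma pnorm_deriv r p : 0 <= r -> pnorm r p^`() <= pnorm (r + 1) p.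
Proof.
move=> r0; elim/poly_ind: p => [|p c IH]; first by rewrite deriv0 !pnorm0.
rewrite derivD derivC addr0 derivM derivX mulr1 pnorm_mulXaddC.
apply: le_trans (pnormD _ _ r0) _; rewrite pnormMX.
have := @pnorm_le r (r + 1) p; rewrite r0 lerDl ler01 => /(_ isT) h.
have := absc_ge0 c; have := pnorm_ge0 p r0; nra.
Qed.

(** The quotient (p(x) - p(z)) / (x - z). It serves twice: to split off a zero at [z], and, through
    its value at [z], as the derivative. *)
Definition divdiff z p : {poly R[i]} := (p - p.[z]%:P) %/ ('X - z%:P).

Lemma divdiffK z p : divdiff z p * ('X - z%:P) = p - p.[z]%:P.
Proof. by rewrite /divdiff divpK// dvdp_XsubCl rootE !hornerE subrr. Qed.

Lemma divdiffB z p q : divdiff z (p - q) = divdiff z p - divdiff z q.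
Proof.
rewrite /divdiff -divpN -divpD; congr (_ %/ _).
by rewrite !hornerE rmorphB /=; ring.
Qed.

Lemma horner_divdiff z p x : (divdiff z p).[x] * (x - z) = p.[x] - p.[z].
Proof. by have := congr1 (fun p => p.[x]) (divdiffK z p); rewrite !hornerE. Qed.

Lemma divdiff_mulXaddC z p c : divdiff z (p * 'X + c%:P) = p + z *: divdiff z p.
Proof.
apply: (@mulIf _ ('X - z%:P)); first by rewrite polyXsubC_eq0.
rewrite divdiffK mulrDl -scalerAl divdiffK !hornerE -mul_polyC.
rewrite !rmorphD !rmorphM /=; ring.
Qed.

(** By [divdiff_mulXaddC] each Horner step costs at most the factor [1 + absc z], which a radius
    [s >= absc z + 1] supplies. *)
Lemma pnorm_divdiff r s z p : 0 <= r -> r <= s -> absc z + 1 <= s ->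
  pnorm r (divdiff z p) <= pnorm s p.
Proof.
move=> r0 rs zs; elim/poly_ind: p => [|p c IH].
  by rewrite /divdiff horner0 polyC0 subrr div0p !pnorm0.
rewrite divdiff_mulXaddC pnorm_mulXaddC; apply: le_trans (pnormD _ _ r0) _.
rewrite pnorm_scale.
have := @pnorm_le r s p; rewrite r0 rs => /(_ isT) h.
have := absc_ge0 c; have := absc_ge0 z; have := pnorm_ge0 p r0; nra.
Qed.

Lemma horner_divdiff_deriv z p : (divdiff z p).[z] = p^`().[z].
Proof.
have := congr1 (fun p => p^`().[z]) (divdiffK z p).
by rewrite derivM derivXsubC mulr1 derivB derivC subr0 !hornerE subrr mulr0 add0r.
Qed.

End CoefficientNorm.

(** * Entire functions *)

Section EntireFunctions.
Context {R : realType}.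
Implicit Types (F f g : R[i] -> R[i]) (r e : R) (z c x : R[i]).

(* Convergence in all the norms [pnorm r] makes the limit a power series; with
   arbitrary polynomials instead of partial sums, products and divided
   differences of such limits are immediate. *)
Definition entire_by (P : nat -> {poly R[i]}) F :=
  (forall r e, 0 <= r -> 0 < e -> exists N, forall m n,
     (N <= m)%N -> (N <= n)%N -> pnorm r (P m - P n) <= e) /\
  (forall z e, 0 < e -> exists N, forall n, (N <= n)%N -> absc (F z - (P n).[z]) <= e).

Definition entire F := exists P, entire_by P F.

(** The Cauchy property in [pnorm r] is already uniform on the disc. Pointwise convergence enters
    only through an auxiliary index [M] depending on [z], which drops out of the estimate. *)
Lemma entire_by_unif P F r e : entire_by P F -> 0 < e -> exists N, forall n z,
  (N <= n)%N -> absc z <= r -> absc (F z - (P n).[z]) <= e.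
Proof.
move=> [hP hF] e0; have e2 : 0 < e / 2 by rewrite divr_gt0.
have [r0|r0] := leP 0 r; last first.
  by exists 0%N => n z _ h; have := absc_ge0 z; lra.
have [N hN] := hP r _ r0 e2; exists N => n z nN zr.
have [M hM] := hF z _ e2; have := hM (maxn M N) (leq_maxl _ _).
have := hN (maxn M N) n (leq_maxr _ _) nN.
have := absc_horner_pnorm (P (maxn M N) - P n) zr; rewrite hornerD hornerN.
have := absc_tri (F z) (P n).[z] (P (maxn M N)).[z]; lra.
Qed.

Lemma eq_entire f g : f =1 g -> entire f -> entire g.
Proof.
move=> fg [P [hP hf]]; exists P; split=> // z e e0.
by rewrite -fg; apply: hf.
Qed.

Lemma entire_poly (p : {poly R[i]}) : entire (horner p).
Proof.
exists (fun=> p); split=> [r e _ e0|z e e0]; exists 0%N => *.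
  by rewrite subrr pnorm0 ltW.
by rewrite subrr absc0 ltW.
Qed.

Lemma entire_cst c : entire (fun=> c).
Proof. by apply: eq_entire (entire_poly c%:P) => z; rewrite hornerC. Qed.

Lemma entire_id : entire id.
Proof. by apply: eq_entire (entire_poly 'X) => z; rewrite hornerX. Qed.

Lemma entireD f g : entire f -> entire g -> entire (fun z => f z + g z).
Proof.
move=> [P [hP hf]] [Q [hQ hg]]; exists (fun n => P n + Q n); split.
  move=> r e r0 e0; have e2 : 0 < e / 2 by rewrite divr_gt0.
  have [N hN] := hP r _ r0 e2; have [M hM] := hQ r _ r0 e2.
  exists (maxn N M) => m n; rewrite !geq_max => /andP[Nm Mm] /andP[Nn Mn].
  have -> : P m + Q m - (P n + Q n) = (P m - P n) + (Q m - Q n) by ring.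
  by have := pnormD (P m - P n) (Q m - Q n) r0; have := hN _ _ Nm Nn; have := hM _ _ Mm Mn; lra.
move=> z e e0; have e2 : 0 < e / 2 by rewrite divr_gt0.
have [N hN] := hf z _ e2; have [M hM] := hg z _ e2.
exists (maxn N M) => n; rewrite !geq_max => /andP[Nn Mn]; rewrite hornerD.
have -> : f z + g z - ((P n).[z] + (Q n).[z]) =
  (f z - (P n).[z]) + (g z - (Q n).[z]) by ring.
by have := abscD (f z - (P n).[z]) (g z - (Q n).[z]); have := hN _ Nn; have := hM _ Mn; lra.
Qed.

Lemma entireM f g : entire f -> entire g -> entire (fun z => f z * g z).
Proof.
move=> [P hPf] [Q hQg]; exists (fun n => P n * Q n); split.
  move=> r e r0 e0; have [hP _] := hPf; have [hQ _] := hQg.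
  have [N1 hN1] := hP r 1 r0 ltr01; have [M1 hM1] := hQ r 1 r0 ltr01.
  set K := pnorm r (P N1) + 1; set L := pnorm r (Q M1) + 1.
  have hK n : (N1 <= n)%N -> pnorm r (P n) <= K.
    move=> h; have := pnormD (P n - P N1) (P N1) r0; rewrite subrK.
    by have := hN1 n N1 h (leqnn _); rewrite /K; lra.
  have hL n : (M1 <= n)%N -> pnorm r (Q n) <= L.
    move=> h; have := pnormD (Q n - Q M1) (Q M1) r0; rewrite subrK.
    by have := hM1 n M1 h (leqnn _); rewrite /L; lra.
  have K0 : 0 < K by rewrite /K; have := pnorm_ge0 (P N1) r0; lra.
  have L0 : 0 < L by rewrite /L; have := pnorm_ge0 (Q M1) r0; lra.
  have eK : 0 < e / (2 * K) by rewrite divr_gt0// mulr_gt0.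
  have eL : 0 < e / (2 * L) by rewrite divr_gt0// mulr_gt0.
  have [N2 hN2] := hP r _ r0 eL; have [M2 hM2] := hQ r _ r0 eK.
  exists (maxn (maxn N1 M1) (maxn N2 M2)) => m n; rewrite !geq_max.
  move=> /andP[/andP[a1 a2] /andP[a3 a4]] /andP[/andP[b1 b2] /andP[b3 b4]].
  have -> : P m * Q m - P n * Q n = (P m - P n) * Q m + P n * (Q m - Q n) by ring.
  apply: le_trans (pnormD _ _ r0) _.
  have -> : e = e / (2 * L) * L + K * (e / (2 * K)).
    by field; rewrite !gt_eqF.
  by apply: lerD; apply: le_trans (pnormM _ _ r0) _; apply: ler_pM;
    rewrite ?pnorm_ge0//; auto.
move=> z e e0; have [_ hf] := hPf; have [_ hg] := hQg.
have [N1 hN1] := hf z 1 ltr01.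
set K := absc (f z) + 1; set L := absc (g z) + 1.
have K0 : 0 < K by rewrite /K; have := absc_ge0 (f z); lra.
have L0 : 0 < L by rewrite /L; have := absc_ge0 (g z); lra.
have eK : 0 < e / (2 * K) by rewrite divr_gt0// mulr_gt0.
have eL : 0 < e / (2 * L) by rewrite divr_gt0// mulr_gt0.
have [N2 hN2] := hf z _ eL; have [M2 hM2] := hg z _ eK.
exists (maxn N1 (maxn N2 M2)) => n; rewrite !geq_max => /andP[a1 /andP[a2 a3]].
have -> : f z * g z - (P n * Q n).[z] =
  (f z - (P n).[z]) * g z + (P n).[z] * (g z - (Q n).[z]) by rewrite hornerM; ring.
apply: le_trans (abscD _ _) _.
have -> : e = e / (2 * L) * L + K * (e / (2 * K)).
  by field; rewrite !gt_eqF.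
rewrite !abscM; apply: lerD; apply: ler_pM; rewrite ?absc_ge0//; auto.
  by rewrite /L lerDl.
have := abscD ((P n).[z] - f z) (f z); rewrite subrK absc_subC.
by have := hN1 _ a1; rewrite /K; lra.
Qed.

Lemma entireZ c f : entire f -> entire (fun z => c * f z).
Proof. exact: entireM (entire_cst c). Qed.

Lemma entireN f : entire f -> entire (fun z => - f z).
Proof. by move=> /(entireZ (-1)); apply: eq_entire => z; rewrite mulN1r. Qed.

Lemma entireB f g : entire f -> entire g -> entire (fun z => f z - g z).
Proof. by move=> hf /entireN; apply: entireD. Qed.

Lemma entire_prod (l : seq R[i]) : entire (fun z => \prod_(a <- l) (z - a)).
Proof.
elim: l => [|a l IH].
  by apply: eq_entire (entire_cst 1) => z; rewrite big_nil.
apply: eq_entire (entireM (entireB entire_id (entire_cst a)) IH) => z.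
by rewrite big_cons.
Qed.

Lemma entire_exp a n : entire (fun z => (z - a) ^+ n).
Proof.
apply: eq_entire (entire_prod (nseq n a)) => z.
by rewrite big_nseq -Monoid.iteropE.
Qed.

(** The singularity of (f x - f z) / (x - z) is removed at the level of polynomials: by
    [pnorm_divdiff] the divided differences of the approximants are again Cauchy in every norm, at
    the price of a larger radius. *)
Lemma entire_by_divdiff P f z : entire_by P f ->
  exists2 g, entire_by (fun n => divdiff z (P n)) g &
  forall x, f x - f z = (x - z) * g x.
Proof.
move=> hf; pose Q n := divdiff z (P n).
have hQ r e : 0 <= r -> 0 < e -> exists N, forall m n,
     (N <= m)%N -> (N <= n)%N -> pnorm r (Q m - Q n) <= e.
  move=> r0 e0; have s0 : 0 <= r + (absc z + 1).
    by rewrite !addr_ge0 ?absc_ge0.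
  have [N hN] := hf.1 _ _ s0 e0; exists N => m n Nm Nn.
  rewrite /Q -divdiffB; apply: le_trans (hN _ _ Nm Nn).
  by apply: pnorm_divdiff; rewrite ?lerDl ?lerDr ?addr_ge0 ?absc_ge0.
have lim x : {l | forall e, 0 < e -> exists N, forall n, (N <= n)%N ->
    absc (l - (Q n).[x]) <= e}.
  apply: cid.
  (* Real and imaginary part are handled together, as additive maps to the reals bounded by the
     modulus. *)
  have cvgh (h : R[i] -> R) : (forall u v, h (u - v) = h u - h v) ->
      (forall u, `|h u| <= absc u) -> cvgn (fun n => h (Q n).[x]).
    move=> hB hle; apply/cauchy_cvgP/cauchyP => e e0.
    have e2 : 0 < e / 2 by rewrite divr_gt0.
    have [N hN] := hQ (absc x) _ (absc_ge0 x) e2.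
    exists (h (Q N).[x]); exists N => // n /= Nn; rewrite -ball_normE /ball_ /= -hB.
    apply: le_lt_trans (hle _) _; rewrite -hornerN -hornerD.
    apply: le_lt_trans (absc_horner_pnorm _ (lexx _)) _.
    apply: le_lt_trans (_ : e / 2 < e); last by lra.
    exact: hN.
  have hRe := cvgh (@complex.Re R) (fun u v => etrans (ReD _ _) (congr1 _ (ReN _))) (@absc_Re R).
  have hIm := cvgh (@complex.Im R) (fun u v => etrans (ImD _ _) (congr1 _ (ImN _))) (@absc_Im R).
  set a := limn (fun n => complex.Re (Q n).[x]); set b := limn (fun n => complex.Im (Q n).[x]).
  exists (a +i* b) => e e0; have e2 : 0 < e / 2 by rewrite divr_gt0.
  have /cvgrPdist_le/(_ _ e2)[N _ hN] := hRe.
  have /cvgrPdist_le/(_ _ e2)[M _ hM] := hIm.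
  exists (maxn N M) => n; rewrite geq_max => /andP[nN nM].
  apply: le_trans (absc_le_ReIm _) _; rewrite ReD ReN ImD ImN /=.
  by have := hN n nN; have := hM n nM; rewrite /= -/a -/b; lra.
pose g x := sval (lim x); have hg x := svalP (lim x); rewrite -/(g _) in hg.
exists g; first by split.
move=> x; apply/subr0_eq/absc_le_eps => e e0.
set K := absc (x - z) + 1; have K0 : 0 < K by rewrite /K; have := absc_ge0 (x - z); lra.
have e3 : 0 < e / 3 by rewrite divr_gt0.
have eK : 0 < e / (3 * K) by rewrite divr_gt0// mulr_gt0.
have [N1 h1] := hg x _ eK; have [N2 h2] := hf.2 x _ e3; have [N3 h3] := hf.2 z _ e3.
pose n := maxn N1 (maxn N2 N3).
have {}h1 := h1 n (leq_maxl _ _).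
have {}h2 := h2 n (leq_trans (leq_maxl _ _) (leq_maxr _ _)).
have {}h3 := h3 n (leq_trans (leq_maxr _ _) (leq_maxr _ _)).
have -> : f x - f z - (x - z) * g x = (f x - (P n).[x]) + ((P n).[z] - f z)
   - (x - z) * (g x - (Q n).[x]).
  have := horner_divdiff z (P n) x; rewrite -/(Q n) => h.
  by rewrite [in RHS]mulrBr [_ * (Q n).[x]]mulrC h; ring.
apply: le_trans (abscB _ _) _; rewrite abscM.
have := abscD (f x - (P n).[x]) ((P n).[z] - f z); rewrite [absc ((P n).[z] - _)]absc_subC.
have : absc (x - z) * absc (g x - (Q n).[x]) <= K * (e / (3 * K)).
  by apply: ler_pM; rewrite ?absc_ge0// /K lerDl.
have -> : K * (e / (3 * K)) = e / 3 by field; rewrite gt_eqF.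
lra.
Qed.

Lemma entire_divdiff f z : entire f -> exists2 g, entire g &
  forall x, f x - f z = (x - z) * g x.
Proof.
by move=> [P /(entire_by_divdiff z)[g hg ?]]; exists g => //; eexists; apply: hg.
Qed.

Lemma entire_bounded f r : entire f -> exists2 K, 0 < K &
  forall z, absc z <= r -> absc (f z) <= K.
Proof.
move=> [P hf]; have [N hN] := entire_by_unif r hf ltr01.
exists (1 + `|pnorm r (P N)|) => [|z zr]; first by rewrite ltr_pwDl.
have := hN N z (leqnn _) zr; have := absc_horner_pnorm (P N) zr.
have := ler_norm (pnorm r (P N)); have := abscD (f z - (P N).[z]) (P N).[z].
rewrite subrK; lra.
Qed.

Lemma entire_lipschitz f z : entire f -> exists2 K, 0 < K &
  forall x, absc (x - z) <= 1 -> absc (f x - f z) <= K * absc (x - z).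
Proof.
move=> hf; have [g hg fg] := entire_divdiff z hf.
have [K K0 hK] := entire_bounded (absc z + 1) hg; exists K => // x xz.
rewrite fg abscM mulrC ler_wpM2r ?absc_ge0// hK//.
by have := abscD (x - z) z; rewrite subrK; lra.
Qed.

Lemma entire_prod_mul (l : seq R[i]) f : entire f -> entire (fun z => \prod_(a <- l) (z - a) * f z).
Proof. by move=> hf; apply: entireM (entire_prod l) hf. Qed.

End EntireFunctions.

(** * Complex derivatives and multiplicities *)

Section ComplexDerivative.
Context {R : realType}.
Implicit Types (f g h : R[i] -> R[i]) (z x d : R[i]).

(** Differentiability in Caratheodory's form: the difference quotient extends to an entire function.
    The product rule then becomes algebra. *)
Definition has_cderive f z d :=
  exists g, [/\ entire g, forall x, f x - f z = (x - z) * g x & g z = d].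

Lemma has_cderive_derive1 f z d : has_cderive f z d ->
  derive1 (f : R[i] -> R[i]^o) z = d.
Proof.
move=> [g [hg fg <-]]; apply: cvg_lim; first exact: norm_hausdorff.
have [K K0 hK] := entire_lipschitz z hg.
apply/cvgrPdist_le => /= e e0.
(* A positive element of [R[i]] is real, so the estimate can be carried out over [R]. *)
have [e' e'E] : exists e' : R, e = e'%:C.
  by exists (complex.Re e); rewrite RRe_real// gtr0_real.
have {}e0 : 0 < e' by move: e0; rewrite e'E ltcR.
pose t := Num.min 1 (e' / K); have t0 : 0 < t by rewrite lt_min ltr01 divr_gt0.
have tK : K * t <= e'.
  by rewrite mulrC -ler_pdivlMr// /t ge_min lexx orbT.
near=> u.
have u0 : u != 0 by near: u; exists 1 => /=; rewrite ?ltr01.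
have ut : absc u < t.
  by rewrite -ltcR -abscE; near: u; apply: (@dnbhs0_lt _ (R[i]^o)); rewrite ltcR.
have u1 : absc u <= 1 by apply: le_trans (ltW ut) _; rewrite /t ge_min lexx.
rewrite fg addrK /GRing.scale /= mulKf// distrC abscE e'E lecR.
have := hK (u + z); rewrite addrK => /(_ u1) h; apply: le_trans h _.
by apply: le_trans tK; rewrite ler_pM2l// ltW.
Unshelve. all: by end_near. Qed.

Lemma has_cderiveM f1 f2 z d1 d2 : entire f2 -> has_cderive f1 z d1 -> has_cderive f2 z d2 ->
  has_cderive (fun x => f1 x * f2 x) z (d1 * f2 z + f1 z * d2).
Proof.
move=> hf [g1 [h1 e1 <-]] [g2 [h2 e2 <-]].
exists (fun x => g1 x * f2 x + f1 z * g2 x); split=> //.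
  by apply: entireD; [apply: entireM | apply: entireZ].
move=> x; have -> : f1 x * f2 x - f1 z * f2 z =
  (f1 x - f1 z) * f2 x + f1 z * (f2 x - f2 z) by ring.
by rewrite e1 e2; ring.
Qed.

Lemma has_cderive_exp z w m :
  has_cderive (fun x => (x - z) ^+ m.+1) w (m.+1%:R * (w - z) ^+ m).
Proof.
elim: m => [|m IH].
  exists (fun=> 1); split=> [|x|]; rewrite ?expr0 ?mulr1//; first exact: entire_cst.
  by rewrite !expr1; ring.
have h1 : has_cderive (fun x => x - z) w 1.
  by exists (fun=> 1); split=> [|x|//]; [exact: entire_cst | ring].
have := has_cderiveM (entire_exp z m.+1) h1 IH.
have -> : 1 * (w - z) ^+ m.+1 + (w - z) * (m.+1%:R * (w - z) ^+ m) =
  m.+2%:R * (w - z) ^+ m.+1 by rewrite exprS -[m.+2]addn1 natrD; ring.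
by move=> [g [hg e eg]]; exists g; split=> // x; rewrite -e !exprS.
Qed.

(** On the diagonal the divided differences of the approximants are their derivatives, and
    [pnorm_deriv] shows that these are Cauchy; so the derivative is entire as well and can be
    differentiated again. *)
Lemma entire_cderive f : entire f ->
  exists2 f', entire f' & forall z, has_cderive f z (f' z).
Proof.
move=> [P hP].
have D z : {g | entire_by (fun n => divdiff z (P n)) g /\
   forall x, f x - f z = (x - z) * g x}.
  by apply: cid; have [g] := entire_by_divdiff z hP; exists g.
exists (fun z => sval (D z) z); last first.
  move=> z; exists (sval (D z)); have [h1 h2] := svalP (D z); split=> //.
  by eexists; apply: h1.
exists (fun n => (P n)^`()); split=> [r e r0 e0|z e e0].
  have [N hN] := hP.1 (r + 1) e (addr_ge0 r0 ler01) e0.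
  exists N => m n Nm Nn; rewrite -derivB.
  by apply: le_trans (hN _ _ Nm Nn); apply: pnorm_deriv.
have [h1 _] := svalP (D z); have [N hN] := h1.2 z e e0.
by exists N => n /hN; rewrite horner_divdiff_deriv.
Qed.

(** Induction on [m]: the derivative of (x - z)^(m+1) h is (x - z)^m k with k(z) = (m+1) h(z), which
    is nonzero in characteristic 0. *)
Lemma zero_multiplicity_factor f h z m : entire h -> h z != 0 ->
  (forall x, f x = (x - z) ^+ m * h x) -> zero_multiplicity f z m.
Proof.
elim: m f h => [|m IH] f h hh hz fh.
  by split=> //; rewrite derive1n0 fh mul1r.
have [h' eh' hh'] := entire_cderive hh.
pose k x := m.+1%:R * h x + (x - z) * h' x.
have hk : entire k.
  apply: entireD; first exact: entireZ.
  by apply: entireM => //; apply: entireB (@entire_id R) (entire_cst z).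
have f'E : derive1 (f : R[i] -> R[i]^o) = fun x => (x - z) ^+ m * k x.
  apply/funext => w; apply: has_cderive_derive1.
  have := has_cderiveM hh (has_cderive_exp z w m) (hh' w).
  move=> [g [hg e eg]]; exists g; split=> // [x|]; first by rewrite -e !fh.
  by rewrite eg /k exprS; ring.
have kz : k z != 0.
  by rewrite /k subrr mul0r addr0 mulf_neq0// pnatr_eq0.
have [IH1 IH2] := IH _ k hk kz (fun x => erefl).
split; last by rewrite derive1Sn f'E.
case=> [_|j]; last by rewrite ltnS => jm; rewrite derive1Sn f'E; apply: IH1.
by rewrite derive1n0 fh subrr expr0n mul0r.
Qed.

End ComplexDerivative.
(** * Rouche's theorem *)

Section WindingNumber.
Context {R : realType}.
Implicit Types (h p q : R -> R[i]) (A : R -> R) (t x : R) (z c u : R[i]) (n m : int).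
Local Notation "2pi" := ((pi : R) *+ 2).

Definition cis t : R[i] := cos t +i* sin t.

Lemma absc_cis t : absc (cis t) = 1.
Proof. by rewrite /absc /= cos2Dsin2 sqrtr1. Qed.

Lemma cisD s t : cis (s + t) = cis s * cis t.
Proof. by apply: ReImP; rewrite ?ReM ?ImM /= ?cosD ?sinD//; ring. Qed.

Lemma cisN t : cis (- t) = (cis t)^*.
Proof. by apply: ReImP; rewrite /= ?cosN ?sinN. Qed.

Lemma cis_mulV t : cis t * cis (- t) = 1.
Proof. by rewrite -cisD subrr /cis cos0 sin0. Qed.

Lemma cis2pi t : cis (t + 2pi) = cis t.
Proof. by rewrite /cis cosD2pi sinD2pi. Qed.

Lemma polar z : exists t, z = (absc z)%:C * cis t.
Proof.
have [->|z0] := eqVneq z 0; first by exists 0; rewrite absc0 mul0r.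
have r0 : 0 < absc z by rewrite absc_gt0.
set x := complex.Re z / absc z; set y := complex.Im z / absc z.
have xy : x ^+ 2 + y ^+ 2 = 1.
  by rewrite !expr_div_n -mulrDl -absc_sqr divff// expf_neq0// gt_eqF.
have x1 : -1 <= x <= 1.
  rewrite -ler_norml -(@ler_pXn2r _ 2) ?nnegrE// real_normK ?num_real// expr1n.
  by rewrite -xy lerDl sqr_ge0.
have sx : sin (acos x) = `|y|.
  by rewrite sin_acos// -xy addrC addKr sqrtr_sqr.
exists (if 0 <= y then acos x else - acos x).
have e1 : complex.Re z = absc z * x by rewrite mulrC divfK// gt_eqF.
have e2 : complex.Im z = absc z * y by rewrite mulrC divfK// gt_eqF.
have zE : z = (absc z)%:C * (x +i* y).
  by apply: ReImP; rewrite ?ReM ?ImM /= ?mul0r ?subr0 ?addr0.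
rewrite [LHS]zE; congr (_ * _); apply: ReImP => /=; case: (leP 0 y) => y0.
- by rewrite acosK.
- by rewrite cosN acosK.
- by rewrite sx ger0_norm.
- by rewrite sinN sx ltr0_norm// opprK.
Qed.

Definition ccontinuous h :=
  continuous (fun t => complex.Re (h t)) /\ continuous (fun t => complex.Im (h t)).

Lemma ccontinuous_cst c : ccontinuous (fun=> c).
Proof. by split; move=> ?; apply: cvg_cst. Qed.

Lemma ccontinuousD p q : ccontinuous p -> ccontinuous q -> ccontinuous (fun t => p t + q t).
Proof.
move=> [p1 p2] [q1 q2]; rewrite /ccontinuous; split.
  rewrite (_ : (fun t => _) = fun t => complex.Re (p t) + complex.Re (q t)).
    by move=> t; exact: cvgD (p1 t) (q1 t).
  by apply/funext => t; rewrite ReD.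
rewrite (_ : (fun t => _) = fun t => complex.Im (p t) + complex.Im (q t)).
  by move=> t; exact: cvgD (p2 t) (q2 t).
by apply/funext => t; rewrite ImD.
Qed.

Lemma ccontinuousM p q : ccontinuous p -> ccontinuous q -> ccontinuous (fun t => p t * q t).
Proof.
move=> [p1 p2] [q1 q2]; rewrite /ccontinuous; split.
  rewrite (_ : (fun t => _) = fun t => complex.Re (p t) * complex.Re (q t) -
      complex.Im (p t) * complex.Im (q t)).
    by move=> t; apply: cvgB; [exact: cvgM (p1 t) (q1 t)|exact: cvgM (p2 t) (q2 t)].
  by apply/funext => t; rewrite ReM.
rewrite (_ : (fun t => _) = fun t => complex.Re (p t) * complex.Im (q t) +
    complex.Im (p t) * complex.Re (q t)).
  by move=> t; apply: cvgD; [exact: cvgM (p1 t) (q2 t)|exact: cvgM (p2 t) (q1 t)].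
by apply/funext => t; rewrite ImM.
Qed.

Lemma ccontinuous_conj p : ccontinuous p -> ccontinuous (fun t => (p t)^*).
Proof.
move=> [p1 p2]; rewrite /ccontinuous; split.
  rewrite (_ : (fun t => _) = fun t => complex.Re (p t)) //.
  by apply/funext => t; case: (p t).
rewrite (_ : (fun t => _) = fun t => - complex.Im (p t)).
  by move=> t; exact: cvgN (p2 t).
by apply/funext => t; case: (p t).
Qed.

Lemma ccontinuous_cis : ccontinuous cis.
Proof. by split; [exact: continuous_cos | exact: continuous_sin]. Qed.

(** The winding number over one period, defined by a lifted argument [A] instead of an integral.
    Continuity of [A] is asked on the whole line, so no subspace topology enters. *)
Definition winding h n := exists A, [/\ continuous A,
  A 2pi = A 0 + n%:~R * 2pi & forall t, h t = (absc (h t))%:C * cis (A t)].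

Lemma winding_cst c : winding (fun=> c) 0.
Proof.
have [a ha] := polar c; exists (fun=> a); split=> [t||t]; last exact: ha.
  exact: cvg_cst.
by rewrite mul0r addr0.
Qed.

Lemma winding_cis : winding cis 1.
Proof.
exists id; split=> [t||t]; first exact: cvg_id.
  by rewrite add0r mul1r.
by rewrite absc_cis mul1r.
Qed.

Lemma windingM h k n m : winding h n -> winding k m ->
  winding (fun t => h t * k t) (n + m).
Proof.
move=> [A [cA AA hA]] [B [cB BB hB]]; exists (fun t => A t + B t); split.
- by move=> t; apply: cvgD; [exact: cA | exact: cB].
- by rewrite AA BB rmorphD /=; ring.
- by move=> t; rewrite abscM rmorphM /= cisD {1}hA {1}hB; ring.
Qed.

Lemma winding_conj h n : winding h n -> winding (fun t => (h t)^*) (- n).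
Proof.
move=> [A [cA AA hA]]; exists (fun t => - A t); split.
- by move=> t; apply: cvgN; exact: cA.
- by rewrite AA rmorphN /=; ring.
- by move=> t; rewrite absc_conj cisN {1}hA rmorphM /= oppr0.
Qed.

(** In the right half-plane arctan (Im / Re) is a continuous argument, and it returns to its initial
    value with the curve. *)
Lemma winding_right_half h : ccontinuous h -> h 2pi = h 0 ->
  (forall t, 0 < complex.Re (h t)) -> winding h 0.
Proof.
move=> [h1 h2] hp hRe.
exists (fun t => atan (complex.Im (h t) / complex.Re (h t))); split.
- move=> t; apply: (@continuous_comp _ _ _ (fun t => complex.Im (h t) / complex.Re (h t)) atan);
    last exact: continuous_atan.
  apply: cvgM; first exact: h2.
  by apply: cvgV; [rewrite gt_eqF | exact: h1].
- by rewrite hp mul0r addr0.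
- move=> t; set x := complex.Re _; set y := complex.Im _.
  have x0 : 0 < x := hRe t.
  have r0 : 0 < absc (h t).
    by rewrite absc_gt0; apply/eqP => h0; move: x0; rewrite /x h0 ltxx.
  have c0 : 0 < cos (atan (y / x)) by rewrite cos_gt0_pihalf// atan_gtNpi2 atan_ltpi2.
  have tE : sin (atan (y / x)) = y / x * cos (atan (y / x)).
    by rewrite -{2}(atanK (y / x)) /tan divfK// gt_eqF.
  have cE : cos (atan (y / x)) = x / absc (h t).
    have xr : 0 <= x / absc (h t) by rewrite divr_ge0// ltW.
    apply/eqP; rewrite -(@eqrXn2 _ 2) ?(ltW c0)//; apply/eqP.
    have := cos2Dsin2 (atan (y / x)); rewrite tE => e.
    rewrite expr_div_n absc_sqr -/x -/y; apply: (canRL (mulfK _)).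
      by rewrite gt_eqF// ltr_pwDl ?exprn_gt0 ?sqr_ge0.
    have {2}-> : x ^+ 2 = x ^+ 2 * (cos (atan (y / x)) ^+ 2 + (y / x * cos (atan (y / x))) ^+ 2).
      by rewrite e mulr1.
    by field; rewrite gt_eqF.
  apply: ReImP; rewrite ?ReM ?ImM /= ?mul0r ?subr0 ?addr0 ?tE cE.
    by rewrite -/x; field; rewrite gt_eqF.
  by rewrite -/y; field; rewrite !gt_eqF.
Qed.

(** Two arguments of the same curve differ by a continuous function with values in 2 pi Z, which the
    intermediate value theorem forces to agree at both ends. *)
Lemma winding_uniq h n m : (forall t, h t != 0) -> winding h n -> winding h m -> n = m.
Proof.
move=> h0 [A [cA AA hA]] [B [cB BB hB]].
pose D t := A t - B t.
have cD : continuous D by move=> t; apply: cvgB; [exact: cA|exact: cB].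
have D1 t : cis (D t) = 1.
  have e : cis (A t) = cis (B t).
    apply: (@mulfI _ (absc (h t))%:C); last by rewrite -hA -hB.
    by rewrite real_complex_eq0 absc_eq0.
  by rewrite /D cisD e cis_mulV.
have D12 : D 2pi = D 0.
  have pi0 : 0 <= 2pi by rewrite mulrn_wge0// pi_ge0.
  apply/eqP/negPn/negP => ne.
  have key s : s = 1 \/ s = -1 -> 0 < s * (D 2pi - D 0) -> False.
    (* The cap at 1 keeps [d] below pi. Thus [sin d] is positive, against [cis (D t) = 1] at the
       point where [D] takes the value [D 0 + s * d]. *)
    move=> hs dpos; pose d := Num.min 1 (s * (D 2pi - D 0)).
    have d0 : 0 < d by rewrite lt_min ltr01.
    have d1 : d <= 1 by rewrite ge_min lexx.
    have d2 : d <= s * (D 2pi - D 0) by rewrite ge_min lexx orbT.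
    have := @IVT R D 0 2pi (D 0 + s * d) pi0 (continuous_subspaceT cD).
    rewrite ge_min le_max => /(_ _)[].
      by case: hs dpos d2 => ->; rewrite !(mul1r, mulN1r) => a b;
        apply/andP; split; apply/orP; [left|right|right|left]; lra.
    move=> t _ /(congr1 cis); rewrite D1 cisD D1 mul1r => /(congr1 (@complex.Im R)) /=.
    have s1 : 0 < sin d.
      by apply: sin_gt0_pi; rewrite d0 (le_lt_trans d1)// (lt_le_trans _ (pi_ge2 R))// ltr1n.
    by case: hs => ->; rewrite ?mul1r ?mulN1r ?sinN; lra.
  have [g|l|e] := ltgtP (D 2pi) (D 0).
  - by apply: (key (-1)); [right|lra].
  - by apply: (key 1); [left|lra].
  - by rewrite e eqxx in ne.
have : (n%:~R - m%:~R) * 2pi = 0 by move: D12; rewrite /D AA BB; lra.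
move/eqP; rewrite mulf_eq0 => /orP[|].
  by rewrite subr_eq0 eqr_int => /eqP.
by rewrite gt_eqF// mulrn_wgt0// pi_gt0.
Qed.

Definition circ c x t : R[i] := c + x%:C * cis t.

Lemma ccontinuous_circ c x : ccontinuous (circ c x).
Proof.
apply: ccontinuousD; first exact: ccontinuous_cst.
apply: ccontinuousM; [exact: ccontinuous_cst | exact: ccontinuous_cis].
Qed.

Lemma circ2pi c x : circ c x 2pi = circ c x 0.
Proof. by rewrite /circ -[2pi]add0r cis2pi. Qed.

Lemma absc_circ c x t : 0 <= x -> absc (circ c x t - c) = x.
Proof. by move=> x0; rewrite /circ addrC addKr abscM absc_cis mulr1 absc_real ger0_norm. Qed.

Lemma ltr_absc_Re1 u : absc u < 1 -> 0 < complex.Re (1 - u).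
Proof. by rewrite ReD ReN /=; have := absc_Re u; have := ler_norm (complex.Re u); lra. Qed.

(** For [z] inside the circle the factor x e^(it) is pulled out, for [z] outside the constant c - z;
    the remaining factor has the form 1 - u with |u| < 1 and stays in the right half-plane. *)
Lemma winding_linear c x z : 0 < x -> absc (z - c) != x ->
  winding (fun t => circ c x t - z) (if absc (z - c) < x then 1 else 0).
Proof.
move=> x0 zx; have xC : x%:C != 0 :> R[i].
  by rewrite real_complex_eq0 gt_eqF.
case: ltP => [zlt|zge].
  have := @windingM (fun t => x%:C * cis t) (fun t => 1 - (z - c) / x%:C * cis (- t)) 1 0.
  rewrite addr0 => /(_ _ _)[].
  - by rewrite -[1]add0r; apply: windingM winding_cis; exact: winding_cst.
  - apply: winding_right_half.
    + apply: ccontinuousD; first exact: ccontinuous_cst.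
      have -> : (fun t => - ((z - c) / x%:C * cis (- t))) =
         (fun t => (- (z - c) / x%:C) * (cis t)^*).
        by apply/funext => t; rewrite cisN; ring.
      apply: ccontinuousM; first exact: ccontinuous_cst.
      exact/ccontinuous_conj/ccontinuous_cis.
    + by rewrite !cisN -[in LHS](add0r 2pi) cis2pi.
    + move=> t; apply: ltr_absc_Re1; rewrite !abscM absc_cis mulr1 abscV absc_real.
      by rewrite gtr0_norm// ltr_pdivrMr// mul1r.
  move=> A [a1 a2 a3]; exists A; split=> // t.
  have e : circ c x t - z = x%:C * cis t * (1 - (z - c) / x%:C * cis (- t)).
    transitivity (x%:C * cis t - (z - c) * (cis t * cis (- t))).
      by rewrite cis_mulV /circ; ring.
    by field.
  by rewrite e; exact: a3.
have zgt : x < absc (z - c) by rewrite lt_def eq_sym eq_sym zx.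
have zc0 : z - c != 0 by rewrite -absc_gt0 (lt_trans x0).
have := @windingM (fun t => - (z - c)) (fun t => 1 - x%:C / (z - c) * cis t) 0 0.
rewrite addr0 => /(_ _ _)[].
- exact: winding_cst.
- apply: winding_right_half.
  + apply: ccontinuousD; first exact: ccontinuous_cst.
    have -> : (fun t => - (x%:C / (z - c) * cis t)) =
       (fun t => (- x%:C / (z - c)) * (cis t)).
      by apply/funext => t; rewrite -mulNr -mulNr.
    apply: ccontinuousM; first exact: ccontinuous_cst.
    exact: ccontinuous_cis.
  + by rewrite -[in LHS](add0r 2pi) cis2pi.
  + move=> t; apply: ltr_absc_Re1; rewrite !abscM absc_cis mulr1 abscV absc_real.
    by rewrite gtr0_norm// ltr_pdivrMr ?mul1r// (lt_trans x0).
move=> A [a1 a2 a3]; exists A; split=> // t.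
have e : circ c x t - z = - (z - c) * (1 - x%:C / (z - c) * cis t).
  by rewrite /circ; field.
by rewrite e; exact: a3.
Qed.

Lemma winding_prod c x (l : seq R[i]) : 0 < x -> all (fun z => absc (z - c) != x) l ->
  winding (fun t => \prod_(z <- l) (circ c x t - z))
    (count (fun z => absc (z - c) < x) l)%:Z.
Proof.
move=> x0; elim: l => [_|z l IH /= /andP[zx lx]].
  by under eq_fun do rewrite big_nil; exact: winding_cst.
under eq_fun do rewrite big_cons.
by rewrite PoszD; apply: windingM (IH lx); have := winding_linear x0 zx; case: ifP.
Qed.

Lemma ccontinuous_prod c x (l : seq R[i]) :
  ccontinuous (fun t => \prod_(z <- l) (circ c x t - z)).
Proof.
elim: l => [|z l IH].
  by under eq_fun do rewrite big_nil; exact: ccontinuous_cst.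
under eq_fun do rewrite big_cons.
apply: ccontinuousM IH; apply: ccontinuousD; first exact: ccontinuous_circ.
exact: ccontinuous_cst.
Qed.

(** The product of [h] with the conjugate of [k] equals |k|^2 - (k - h) k^*, whose real part is
    positive. Its winding number is therefore 0, and it is also n - m. *)
Lemma winding_rouche h k n m : ccontinuous h -> ccontinuous k -> h 2pi = h 0 -> k 2pi = k 0 ->
  winding h n -> winding k m ->
  (forall t, absc (h t - k t) < absc (k t)) -> n = m.
Proof.
move=> ch ck h2 k2 wh wk hk.
have Re0 t : 0 < complex.Re (h t * (k t)^*).
  have k0 : 0 < absc (k t) by apply: le_lt_trans (hk t); exact: absc_ge0.
  have -> : h t * (k t)^* = (absc (k t) ^+ 2)%:C - (k t - h t) * (k t)^*.
    by rewrite -sqr_norm_conj; ring.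
  rewrite ReD ReN subr_gt0; apply: le_lt_trans (ler_norm _) _.
  apply: le_lt_trans (absc_Re _) _; rewrite abscM absc_conj expr2 ltr_pM2r//.
  by rewrite absc_subC.
apply/eqP; rewrite -subr_eq0; apply/eqP.
apply: (@winding_uniq (fun t => h t * (k t)^*)).
- by move=> t; apply/eqP => e; have := Re0 t; rewrite e ltxx.
- by apply: windingM wh _; exact: winding_conj.
- apply: winding_right_half => //; last by rewrite h2 k2.
  by apply: ccontinuousM => //; exact: ccontinuous_conj.
Qed.

(* Along the circle a factor [z - u] has winding number 1 or 0 according to
   whether [u] is inside, and the quotient of the two products has winding
   number 0. *)
Lemma rouche_prod c x (a b : R[i]) (l k : seq R[i]) : 0 < x ->
  (forall z, absc (z - c) = x -> absc (a * \prod_(u <- l) (z - u) - b * \prod_(u <- k) (z - u))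
     < absc (b * \prod_(u <- k) (z - u))) ->
  count (fun z => absc (z - c) < x) l = count (fun z => absc (z - c) < x) k.
Proof.
move=> x0 H.
have root_prod (s : seq R[i]) z : z \in s -> \prod_(u <- s) (z - u) = 0.
  move=> zs; apply/eqP; rewrite prodf_seq_eq0; apply/hasP; exists z => //=.
  by rewrite subrr.
have lx : all (fun z => absc (z - c) != x) l.
  apply/allP => z zl; apply/eqP => /[dup] zx /H.
  by rewrite root_prod// mulr0 sub0r abscN ltxx.
have kx : all (fun z => absc (z - c) != x) k.
  apply/allP => z zk; apply/eqP => /[dup] zx /H.
  by rewrite (root_prod k)// mulr0 absc0 ltNge absc_ge0.
have := @winding_rouche (fun t => a * \prod_(u <- l) (circ c x t - u))
   (fun t => b * \prod_(u <- k) (circ c x t - u))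
   (count (fun z => absc (z - c) < x) l)%:Z (count (fun z => absc (z - c) < x) k)%:Z.
have cc d s : ccontinuous (fun t => d * \prod_(u <- s) (circ c x t - u)).
  by apply: ccontinuousM; [exact: ccontinuous_cst | exact: ccontinuous_prod].
move/(_ (cc _ _) (cc _ _)); rewrite !circ2pi => /(_ erefl erefl) h.
suff: (count (fun z => absc (z - c) < x) l)%:Z = (count (fun z => absc (z - c) < x) k)%:Z by case.
apply: h.
- by rewrite -[Posz _]add0r; apply: windingM (winding_prod x0 lx); exact: winding_cst.
- by rewrite -[Posz _]add0r; apply: windingM (winding_prod x0 kx); exact: winding_cst.
- by move=> t; apply: H; rewrite absc_circ// ltW.
Qed.

End WindingNumber.

(** * From products of linear factors to entire functions *)

Section RoucheEntire.
Context {R : realType}.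
Implicit Types (f g F G : R[i] -> R[i]) (x e : R) (z c u : R[i]) (l k : seq R[i]).

Lemma poly_factor (p : {poly R[i]}) : exists a l, forall z, p.[z] = a * \prod_(u <- l) (z - u).
Proof.
have [l pE] := closed_field_poly_normal p; exists (lead_coef p), l => z.
by rewrite {1}pE hornerZ horner_prod; congr (_ * _); apply: eq_bigr => u _; rewrite !hornerE.
Qed.

Lemma entire_lower_bound f c x : entire f -> 0 <= x ->
  (forall z, absc (z - c) <= x -> f z != 0) ->
  exists2 e, 0 < e & forall z, absc (z - c) <= x -> e <= absc (f z).
Proof.
move=> hf x0 fn0.
pose pt (p : R * R) : R[i] := c + (p.1 +i* p.2).
pose s (p : R * R) : R := p.1 * p.1 + p.2 * p.2 - x ^+ 2.
(* The penalty [|s| + s] vanishes on the disc and is positive outside it. So [phi] is positive on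
   the whole plane, and its minimum over a square, compact as a product of segments, bounds [f] from
   below on the disc. *)
pose phi (p : R * R) : R := absc (f (pt p)) + (`|s p| + s p).
have cphi : continuous phi.
  move=> p; apply: cvgD.
    have [K K0 hK] := entire_lipschitz (pt p) hf.
    apply/cvgrPdist_le => e e0.
    pose t := Num.min 1 (e / K); have t0 : 0 < t by rewrite lt_min ltr01 divr_gt0.
    have tK : K * t <= e by rewrite mulrC -ler_pdivlMr// /t ge_min lexx orbT.
    have t2 : 0 < t / 2 by rewrite divr_gt0.
    have c1 : (fst q @[q --> p] --> p.1)%classic by exact: cvg_fst.
    have c2 : (snd q @[q --> p] --> p.2)%classic by exact: cvg_snd.
    move/cvgrPdist_lt : c1 => /(_ _ t2) c1; move/cvgrPdist_lt : c2 => /(_ _ t2) c2.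
    near=> q.
    have q1 : `|p.1 - q.1| < t / 2 by near: q.
    have q2 : `|p.2 - q.2| < t / 2 by near: q.
    have d : absc (pt q - pt p) <= t.
      apply: le_trans (absc_le_ReIm _) _.
      have -> : pt q - pt p = (q.1 - p.1) +i* (q.2 - p.2).
        by apply: ReImP; rewrite ?(ReD, ReN, ImD, ImN)/=; ring.
      by rewrite /= (distrC q.1) (distrC q.2); lra.
    have := hK (pt q); have : absc (pt q - pt p) <= 1.
      by apply: le_trans d _; rewrite /t ge_min lexx.
    move=> /[swap] /[apply] h.
    rewrite ler_norml.
    have := absc_lerB (f (pt q)) (f (pt p)).
    have := absc_lerB (f (pt p)) (f (pt q)); rewrite [absc (f (pt p) - _)]absc_subC.
    have : K * absc (pt q - pt p) <= e by apply: le_trans tK; rewrite ler_pM2l.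
    by move: h => /= h a b d'; apply/andP; split; lra.
  have cs : (s q @[q --> p] --> s p)%classic.
    apply: cvgB; last exact: cvg_cst.
    by apply: cvgD; apply: cvgM; solve [exact: cvg_fst | exact: cvg_snd].
  exact: cvgD (cvg_norm cs) cs.
have phi0 p : 0 < phi p.
  have [h|h] := leP (absc (pt p - c)) x.
    by rewrite ltr_pwDl ?absc_gt0 ?fn0// -lerBlDr sub0r -normrN ler_norm.
  suff s0 : 0 < s p by rewrite ltr_wpDl ?absc_ge0// gtr0_norm// addr_gt0.
  rewrite subr_gt0.
  have <- : absc (pt p - c) ^+ 2 = p.1 * p.1 + p.2 * p.2.
    by rewrite /pt addrC addKr absc_sqr -!expr2.
  by rewrite ltrXn2r// nnegrE ?absc_ge0.
have K0 : compact (`[- x, x] `*` `[- x, x] : set (R * R))%classic.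
  by apply: compact_setX; exact: segment_compact.
have n0 : ((`[- x, x] `*` `[- x, x] : set (R * R)) !=set0)%classic.
  by exists (0, 0); split; rewrite /= in_itv /= x0 oppr_le0 x0.
have [q _ hq] := compact_EVT_min n0 K0 (continuous_subspaceT cphi).
exists (phi q) => // z zx.
have zE : pt (complex.Re (z - c), complex.Im (z - c)) = z.
  rewrite /pt /=; have -> : complex.Re (z - c) +i* complex.Im (z - c) = z - c by case: (z - c).
  by rewrite addrC subrK.
move: zE (absc_sqr (z - c)) (absc_Re (z - c)) (absc_Im (z - c)) (absc_ge0 (z - c)).
set a := complex.Re (z - c); set b := complex.Im (z - c) => zE zab za zb z0.
have sab : `|s (a, b)| + s (a, b) = 0.
  by rewrite ler0_norm ?addNr// /s /= -!expr2 -zab; nra.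
have := hq (a, b); rewrite {2}/phi zE sab addr0; apply; rewrite in_setE.
split; rewrite /= in_itv /= -ler_norml.
  exact: le_trans za zx.
exact: le_trans zb zx.
Unshelve. all: by end_near. Qed.

Variables (c : R[i]) (x : R).
Hypothesis x0 : 0 < x.
Local Notation inside := (fun z => absc (z - c) < x).

(** Within the margin [e] both cofactors may be replaced by polynomials. The one for [g] has no
    zeros inside, so the model side has exactly [size k]; the one for [f] can only add zeros to [l],
    and it adds none if [f] does not vanish. *)
Lemma count_entire_le f g l k e : entire f -> entire g -> 0 < e ->
  all inside l -> all inside k -> (forall z, absc (z - c) <= x -> g z != 0) ->
  (forall z, absc (z - c) = x ->
     absc (\prod_(u <- l) (z - u) * f z - \prod_(u <- k) (z - u) * g z) + e
       <= absc (\prod_(u <- k) (z - u) * g z)) ->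
  (size l <= size k)%N /\
  ((forall z, absc (z - c) <= x -> f z != 0) -> size l = size k).
Proof.
move=> hf hg e0 il ik gn0 H.
have il' : count inside l = size l by apply/eqP; rewrite -all_count.
have ik' : count inside k = size k by apply/eqP; rewrite -all_count.
have zr z : absc (z - c) <= x -> absc z <= absc c + x.
  by have := abscD (z - c) c; rewrite subrK; lra.
have [A A0 hA] := entire_bounded (absc c + x) (entire_prod l).
have [B B0 hB] := entire_bounded (absc c + x) (entire_prod k).
have [eg eg0 heg] := entire_lower_bound hg (ltW x0) gn0.
have M0 : 0 < A + 2 * B by lra.
have main d : 0 < d -> exists2 s, (size l + count inside s = size k)%N &
    exists a, forall z, absc (z - c) <= x -> absc (f z - a * \prod_(u <- s) (z - u)) <= d.
  move=> d0.
  (* [eg / 2] keeps the polynomial near [g] free of zeros. The last bound pays for the errors: A d'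
     + B d' in the difference and B d' in the lower bound, together at most e / 2. *)
  pose d' := Num.min d (Num.min (eg / 2) (e / (2 * (A + 2 * B)))).
  have d'0 : 0 < d' by rewrite !lt_min d0 !divr_gt0//= mulr_gt0.
  have d'd : d' <= d by rewrite ge_min lexx.
  have d'g : d' <= eg / 2 by rewrite !ge_min lexx orbT.
  have d'e : (A + 2 * B) * d' <= e / 2.
    have -> : e / 2 = (A + 2 * B) * (e / (2 * (A + 2 * B))) by field; rewrite gt_eqF.
    by rewrite ler_pM2l// !ge_min lexx !orbT.
  have [P hP] := hf; have [Q hQ] := hg.
  have [N hN] := entire_by_unif (absc c + x) hP d'0.
  have [M hM] := entire_by_unif (absc c + x) hQ d'0.
  have [a [s hs]] := poly_factor (P N); have [b [t ht]] := poly_factor (Q M).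
  have fs z : absc (z - c) <= x -> absc (f z - a * \prod_(u <- s) (z - u)) <= d'.
    by move=> /zr zx; rewrite -hs hN.
  have gt' z : absc (z - c) <= x -> absc (g z - b * \prod_(u <- t) (z - u)) <= d'.
    by move=> /zr zx; rewrite -ht hM.
  exists s; last by exists a => z /fs; lra.
  have t0 : count inside t = 0%N.
    apply/eqP; rewrite -leqn0 leqNgt -has_count; apply/hasP => -[z zt zi].
    have := gt' z (ltW zi); have -> : \prod_(u <- t) (z - u) = 0.
      by apply/eqP; rewrite prodf_seq_eq0; apply/hasP; exists z; rewrite //= subrr.
    by rewrite mulr0 subr0; have := heg z (ltW zi); lra.
  have := @rouche_prod _ c x a b (l ++ s) (k ++ t) x0.
  rewrite !count_cat il' ik' t0 addn0; apply => z zx.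
  have zx' : absc (z - c) <= x by rewrite zx.
  rewrite !big_cat /=.
  set Pl := \prod_(u <- l) _; set Pk := \prod_(u <- k) _.
  set ps := \prod_(u <- s) _; set pt := \prod_(u <- t) _.
  have hl : absc Pl <= A by apply: hA; apply: zr.
  have hk : absc Pk <= B by apply: hB; apply: zr.
  have := H z zx; rewrite -/Pl -/Pk => HH.
  have h1 : absc (Pl * (f z - a * ps)) <= A * d'.
    by rewrite abscM ler_pM ?absc_ge0// fs.
  have h2 : absc (Pk * (g z - b * pt)) <= B * d'.
    by rewrite abscM ler_pM ?absc_ge0// gt'.
  have e1 : a * (Pl * ps) - b * (Pk * pt) =
    (Pl * f z - Pk * g z) - Pl * (f z - a * ps) + Pk * (g z - b * pt) by ring.
  have e2 : b * (Pk * pt) = Pk * g z - Pk * (g z - b * pt) by ring.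
  have h3 : absc (a * (Pl * ps) - b * (Pk * pt)) <=
      absc (Pl * f z - Pk * g z) + A * d' + B * d'.
    rewrite e1; apply: le_trans (abscD _ _) _; rewrite lerD//.
    by apply: le_trans (abscB _ _) _; rewrite lerD.
  have h4 : absc (Pk * g z) - B * d' <= absc (b * (Pk * pt)).
    have := absc_lerB (Pk * g z) (Pk * (g z - b * pt)).
    by rewrite -e2; lra.
  have dd : (A + 2 * B) * d' = A * d' + B * d' + B * d' by ring.
  by rewrite dd in d'e; lra.
split; first by have [s <- _] := main 1 ltr01; rewrite leq_addr.
move=> fn0; have [ef ef0 hef] := entire_lower_bound hf (ltW x0) fn0.
have [|s <- [a hs]] := main (ef / 2); first by rewrite divr_gt0.
suff -> : count inside s = 0%N by rewrite addn0.
apply/eqP; rewrite -leqn0 leqNgt -has_count; apply/hasP => -[z zs zi].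
have := hs z (ltW zi); have -> : \prod_(u <- s) (z - u) = 0.
  by apply/eqP; rewrite prodf_seq_eq0; apply/hasP; exists z; rewrite //= subrr.
by rewrite mulr0 subr0; have := hef z (ltW zi); lra.
Qed.

(** While the cofactor vanishes somewhere inside, that zero is moved into the list;
    [count_entire_le] caps the length by [size k], so this stops, and then the lengths agree. The
    initial list [l] allows zeros that were located before to be retained. *)
Lemma rouche F f g l k e : entire f -> entire g -> 0 < e -> all inside l -> all inside k ->
  (forall z, F z = \prod_(u <- l) (z - u) * f z) ->
  (forall z, absc (z - c) <= x -> g z != 0) ->
  (forall z, absc (z - c) = x ->
     absc (F z - \prod_(u <- k) (z - u) * g z) + e <= absc (\prod_(u <- k) (z - u) * g z)) ->
  exists l' f', [/\ entire f', all inside (l ++ l'), size (l ++ l') = size k,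
    forall z, F z = \prod_(u <- l ++ l') (z - u) * f' z &
    forall z, absc (z - c) <= x -> f' z != 0].
Proof.
move=> hf hg e0 il ik fE gn0 H.
have [n] := ubnP (size k - size l); elim: n => // n IH in l f hf fE il *.
move=> szn.
have [le_lk eq_lk] : (size l <= size k)%N /\
  ((forall z, absc (z - c) <= x -> f z != 0) -> size l = size k).
  by apply: (count_entire_le hf hg e0) => // z zx; rewrite -fE; apply: H.
have [fn0|] := pselect (forall z, absc (z - c) <= x -> f z != 0).
  by exists [::], f; rewrite cats0; split=> //; apply: eq_lk.
move=> /existsNP[z /not_implyP[zx /negP]]; rewrite negbK => /eqP fz0.
have zi : absc (z - c) < x.
  rewrite lt_neqAle zx andbT; apply/eqP => /H.
  by rewrite fE fz0 mulr0 sub0r abscN gerDl leNgt e0.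
have [f1 hf1 f1E] := entire_divdiff z hf.
have f1E' w : F w = \prod_(u <- rcons l z) (w - u) * f1 w.
  by rewrite -cats1 big_cat /= big_seq1 fE -mulrA -f1E fz0 subr0.
have il' : all inside (rcons l z) by rewrite all_rcons /= zi.
have [le_lk' _] : (size (rcons l z) <= size k)%N /\
  ((forall z, absc (z - c) <= x -> f1 z != 0) -> size (rcons l z) = size k).
  by apply: (count_entire_le hf1 hg e0) => // w wx; rewrite -f1E'; apply: H.
have [|l' [f' [h1 h2 h3 h4 h5]]] := IH (rcons l z) f1 hf1 f1E' il'.
  rewrite size_rcons in le_lk' *; rewrite -ltnS; apply: leq_trans szn.
  by rewrite ltnS ltn_sub2l.
by exists (z :: l'), f'; rewrite -cat_rcons.
Qed.

End RoucheEntire.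
(** * Localization of zeros *)

Section SquareSummable.
Context {R : realType}.
Implicit Types (u v : nat -> R) (k : R).

(** Square summability by bounded partial sums, so that all estimates are about finite real sums;
    the series of [in_l2] appears only at the end. *)
Definition l2_bounded u := exists M, forall n, \sum_(i < n) u i ^+ 2 <= M.

Lemma l2_boundedD u v : l2_bounded u -> l2_bounded v -> l2_bounded (fun n => u n + v n).
Proof.
move=> [M hM] [N hN]; exists (2 * M + 2 * N) => n.
apply: le_trans (_ : \sum_(i < n) (2 * u i ^+ 2 + 2 * v i ^+ 2) <= _).
  by apply: ler_sum => i _; have := sqr_ge0 (u i - v i); nra.
by rewrite big_split /= -!mulr_sumr; have := hM n; have := hN n; lra.
Qed.

Lemma l2_boundedZ k u : l2_bounded u -> l2_bounded (fun n => k * u n).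
Proof.
move=> [M hM]; exists (k ^+ 2 * M) => n.
under eq_bigr do rewrite exprMn.
by rewrite -mulr_sumr ler_wpM2l ?sqr_ge0.
Qed.

Lemma l2_bounded_le u v N : (forall n, (N <= n)%N -> `|u n| <= v n) ->
  l2_bounded v -> l2_bounded u.
Proof.
move=> uv [M hM]; exists (\sum_(i < N) u i ^+ 2 + M) => n.
have M0 : 0 <= M by have := hM 0%N; rewrite big_ord0.
apply: le_trans (_ : \sum_(i < n) ((if (i < N)%N then u i ^+ 2 else 0) + v i ^+ 2) <= _).
  apply: ler_sum => i _; case: ltnP => [_|/uv h]; first by rewrite lerDl sqr_ge0.
  rewrite add0r -(real_normK (num_real (u i))) lerXn2r ?nnegrE//.
  by apply: le_trans h.
rewrite big_split /=; apply: lerD (hM n).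
pose f i := if (i < N)%N then u i ^+ 2 else 0.
have f0 i : 0 <= f i by rewrite /f; case: ifP; rewrite ?sqr_ge0.
have -> : \sum_(i < N) u i ^+ 2 = \sum_(0 <= i < N) f i.
  by rewrite big_mkord; apply: eq_bigr => i _; rewrite /f ltn_ord.
rewrite -(big_mkord xpredT f).
have [nN|Nn] := leqP n N.
  by rewrite (big_cat_nat (leq0n n) nN) /= lerDl sumr_ge0.
rewrite (big_cat_nat (leq0n N) (ltnW Nn)) /= gerDl big_nat_cond big1//.
by move=> i /andP[/andP[Ni _] _]; rewrite /f ltnNge Ni.
Qed.

(** The telescoping majorant 2 - 1/(n+1) of the partial sums is what makes the induction close. *)
Lemma l2_bounded_inv : l2_bounded (fun n => (n.+1%:R)^-1 : R).
Proof.
have h n : \sum_(i < n.+1) ((i.+1%:R)^-1 : R) ^+ 2 <= 2 - (n.+1%:R)^-1.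
  elim: n => [|n IH]; first by rewrite big_ord_recl big_ord0 invr1 expr1n addr0; lra.
  rewrite big_ord_recr /=; apply: le_trans (lerD IH (lexx _)) _.
  set a : R := n.+1%:R; have a0 : 0 < a by rewrite ltr0n.
  have -> : n.+2%:R = a + 1 :> R by rewrite -[n.+2]addn1 natrD.
  rewrite -subr_ge0.
  have -> : 2 - (a + 1)^-1 - (2 - a^-1 + (a + 1)^-1 ^+ 2) = (a * (a + 1) ^+ 2)^-1.
    by field; rewrite !gt_eqF//; lra.
  by rewrite invr_ge0 mulr_ge0 ?sqr_ge0// ltW.
exists 2; case=> [|n]; first by rewrite big_ord0.
by apply: le_trans (h n) _; rewrite gerBl invr_ge0.
Qed.

Lemma l2_bounded_in_l2 (u : nat -> R[i]) : l2_bounded (fun n => absc (u n)) -> in_l2 u.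
Proof.
move=> [M hM]; rewrite /in_l2.
apply: (@le_lt_trans _ _ M%:E); last exact: ltry.
apply: lime_le.
  by apply: is_cvg_nneseries => n _ _; rewrite lee_fin sqr_ge0.
near=> n; rewrite sumEFin lee_fin big_mkord; exact: hM.
Unshelve. all: by end_near. Qed.

End SquareSummable.

Section ZeroEnumeration.
Context {R : realType}.
Implicit Types (F G : R[i] -> R[i]) (lam : nat -> R[i]).

(* The number of indices [n] with [lam n = z] is the order of vanishing at [z]. *)
Definition zeros_listed F lam := forall z, exists2 s : seq nat,
  uniq s /\ (forall n, lam n = z <-> n \in s) &
  exists2 f, entire f & f z != 0 /\ forall x, F x = (x - z) ^+ size s * f x.

Lemma zeros_listed_enumerates F lam : zeros_listed F lam -> enumerates_zeros F lam.
Proof.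
move=> h z; have [s [us hs] [f hf [fz fE]]] := h z.
exists (size s); first exact: zero_multiplicity_factor hf fz fE.
have -> : [set n | lam n = z]%classic = [set` s]%classic.
  by apply/seteqP; split=> n /=; rewrite hs.
have -> : [set` s]%classic = [set` [fset x in s]%fset]%classic.
  by apply/seteqP; split=> n /=; rewrite inE.
by apply/card_eq_fsetP; rewrite card_fseq undup_id.
Qed.

Definition interleave lam lam' n := if odd n then lam' n./2 else lam n./2.

Lemma zeros_listedM F G lam lam' : zeros_listed F lam -> zeros_listed G lam' ->
  zeros_listed (fun x => F x * G x) (interleave lam lam').
Proof.
move=> hF hG z; have [s [us hs] [f hf [fz fE]]] := hF z.
have [t [ut ht] [g hg [gz gE]]] := hG z.
exists (map double s ++ map (fun n => n.*2.+1) t); last first.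
  exists (fun x => f x * g x); first exact: entireM.
  split=> [|x]; first by rewrite mulf_neq0.
  by rewrite fE gE size_cat !size_map exprD; ring.
split.
  rewrite cat_uniq !map_inj_uniq ?us ?ut ?andbT; last 2 first.
  - by move=> a b /(congr1 half) /=; rewrite !uphalf_double.
  - by move=> a b /(congr1 half); rewrite !doubleK.
  by apply/hasPn => _ /mapP[a _ ->]; apply/negP => /mapP[b _] /(congr1 odd) /=;
    rewrite !odd_double.
move=> n; rewrite mem_cat /interleave; case: ifP => on; split.
- move=> /ht nt; apply/orP; right; apply/mapP; exists n./2 => //.
  by rewrite -[LHS]odd_double_half on.
- case/orP => /mapP[a ha na]; first by rewrite na odd_double in on.
  by apply/ht; rewrite na /= uphalf_double.
- move=> /hs ns; apply/orP; left; apply/mapP; exists n./2 => //.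
  by rewrite -[LHS]odd_double_half on.
- case/orP => /mapP[a ha na]; last by rewrite na /= odd_double in on.
  by apply/hs; rewrite na doubleK.
Qed.

End ZeroEnumeration.

(** * Zeros of a perturbation of a function with well separated simple zeros *)

Section Localization.
Context {R : realType}.
Implicit Types (z x u : R[i]) (n m : nat) (X : R).

(* [1 + |rho|]: neighbouring zeros of the model functions are this far apart. *)
Definition weight z : R := 1 + Num.sqrt (absc z).

Lemma weight_ge1 z : 1 <= weight z.
Proof. by rewrite lerDl sqrtr_ge0. Qed.

Lemma weight_gt0 z : 0 < weight z.
Proof. exact: lt_le_trans ltr01 (weight_ge1 z). Qed.

Lemma sqrtrD_le (a b : R) : 0 <= a -> 0 <= b ->
  Num.sqrt (a + b) <= Num.sqrt a + Num.sqrt b.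
Proof.
move=> a0 b0; rewrite -(@ler_pXn2r _ 2) ?nnegrE ?addr_ge0 ?sqrtr_ge0//.
rewrite sqrrD !sqr_sqrtr ?addr_ge0// lerD2r lerDl mulrn_wge0// mulr_ge0 ?sqrtr_ge0//.
Qed.

(** The square root is subadditive, and sqrt |z - u| <= weight u / 2 because weight u <= (weight
    u)^2. *)
Lemma weight_comp z u : absc (z - u) <= weight u / 4 ->
  weight z <= 2 * weight u /\ weight u <= 2 * weight z.
Proof.
move=> zu; have w1 := weight_ge1 u.
have q : Num.sqrt (absc (z - u)) <= weight u / 2.
  have w2 : 0 <= weight u / 2 by rewrite divr_ge0// (le_trans ler01).
  rewrite -(@ler_pXn2r _ 2) ?nnegrE ?sqrtr_ge0// sqr_sqrtr ?absc_ge0//; nra.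
have tri (a b : R[i]) : Num.sqrt (absc a) <= Num.sqrt (absc b) + Num.sqrt (absc (a - b)).
  apply: le_trans (sqrtrD_le (absc_ge0 _) (absc_ge0 _)).
  by rewrite ler_wsqrtr//; have := abscD b (a - b); rewrite addrC subrK.
have := tri z u; have := tri u z; rewrite (absc_subC u z); rewrite /weight in q w1 *; lra.
Qed.

Variables (F G : R[i] -> R[i]) (mu : nat -> R[i]) (E : R[i] -> R).
Variables (s L c : R).
Hypotheses (entG : entire G) (s0 : 0 < s) (L0 : 0 < L) (c0 : 0 < c).
Hypothesis mu_sep : forall n m, n != m -> s * weight (mu n) <= absc (mu n - mu m).
Hypothesis G_mu : forall n, G (mu n) = 0.
Hypothesis E_lb : forall z, 1 <= E z * weight z.
Hypothesis G_lb : forall z, exists n,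
  c * Num.min 1 (absc (z - mu n) / weight z) * E z <= absc (G z).

Lemma mu_inj : injective mu.
Proof.
move=> n m e; apply/eqP; apply: contraT => /mu_sep.
by rewrite e subrr absc0 leNgt mulr_gt0// weight_gt0.
Qed.

Lemma E_gt0 z : 0 < E z.
Proof. by rewrite -(pmulr_lgt0 _ (weight_gt0 z)); apply: lt_le_trans (E_lb z). Qed.

Lemma G_zero z : G z = 0 -> exists n, z = mu n.
Proof.
move=> Gz; have [n] := G_lb z; rewrite Gz absc0 => h; exists n.
apply/eqP; rewrite -subr_eq0 -absc_eq0 eq_le absc_ge0 andbT leNgt.
apply: contraL h => h; rewrite -ltNge !mulr_gt0 ?E_gt0// lt_min ltr01 /=.
by rewrite divr_gt0// weight_gt0.
Qed.

(** At distance t from [mu n] a multiple zero would make [G] of order t^2, while [G_lb] together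
    with the separation of the [mu n] forces at least order t. *)
Lemma G_simple n k : entire k -> ~ (forall x, G x = (x - mu n) ^+ 2 * k x).
Proof.
move=> ek GE; have [K K0 hK] := entire_bounded (absc (mu n) + 1) ek.
pose W : R := 2 * weight (mu n) ; have W0 : 0 < W by rewrite mulr_gt0// weight_gt0.
have W1 : 1 <= W by have := weight_ge1 (mu n); rewrite /W; lra.
(* 1/4 makes the weights at [z] and [mu n] comparable, s/2 keeps every other model zero at distance
   at least t, and the last bound produces the contradiction. *)
pose t := Num.min (1 / 4) (Num.min (s / 2) (c / (2 * K * W ^+ 2))).
have KW : 0 < 2 * K * W ^+ 2 by apply: mulr_gt0; [rewrite mulr_gt0 | rewrite exprn_gt0].
have t0 : 0 < t by rewrite !lt_min !divr_gt0.
have t1 : t <= 1 / 4 by rewrite ge_min lexx.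
have t2 : t <= s / 2 by rewrite !ge_min lexx !orbT.
have t3 : t * (2 * K * W ^+ 2) <= c.
  by rewrite -ler_pdivlMr// !ge_min lexx !orbT.
pose z := mu n + t%:C; have zt : absc (z - mu n) = t.
  by rewrite /z addrC addKr absc_real gtr0_norm.
have wz : weight z <= W.
  by apply: (proj1 (@weight_comp z (mu n) _)); rewrite zt; have := weight_ge1 (mu n); lra.
have [m hm] := G_lb z.
have tm : t <= absc (z - mu m).
  have [->|nm] := eqVneq m n; first by rewrite zt.
  have := mu_sep nm; rewrite absc_subC.
  have := weight_ge1 (mu m).
  by have := absc_tri (mu n) (mu m) z; rewrite (absc_subC (mu n) z) zt => a b d; nra.
have hz : absc (k z) <= K.
  by apply: hK; have := abscD (z - mu n) (mu n); rewrite subrK zt; lra.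
have lb : t / W <= Num.min 1 (absc (z - mu m) / weight z).
  rewrite le_min; apply/andP; split; first by rewrite ler_pdivrMr// mul1r; lra.
  by apply: ler_pM; rewrite ?invr_ge0 ?(ltW t0) ?(ltW W0)// lef_pV2// posrE weight_gt0.
have Ez : W^-1 <= E z.
  rewrite -[W^-1]mul1r ler_pdivrMr//; apply: le_trans (E_lb z) _.
  by rewrite ler_pM2l ?E_gt0.
have : c * (t / W) * W^-1 <= t ^+ 2 * K.
  apply: le_trans (_ : absc (G z) <= _).
    apply: le_trans hm; apply: ler_pM => //; rewrite ?invr_ge0 ?(ltW W0)//.
      by rewrite !mulr_ge0// ?invr_ge0 ltW.
    by rewrite ler_pM2l.
  by rewrite GE abscM abscX zt ler_pM2l// exprn_gt0.
have -> : c * (t / W) * W^-1 = t * (c / W ^+ 2) by field; rewrite gt_eqF.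
rewrite (_ : t ^+ 2 * K = t * (t * K)); last by ring.
rewrite ler_pM2l// ler_pdivrMr ?exprn_gt0// => h.
have : 0 < t * (2 * K * W ^+ 2) by rewrite mulr_gt0.
lra.
Qed.

(** A zero of the cofactor [g] must be some [mu n]; with [n] in [A] it would be a double zero of
    [G], excluded by [G_simple]. *)
Lemma G_factor (A : seq nat) : uniq A -> exists2 g, entire g &
  (forall x, G x = \prod_(u <- map mu A) (x - u) * g x) /\
  (forall z, g z = 0 -> exists2 n, n \notin A & z = mu n).
Proof.
move=> uA; suff [g eg Gg] : exists2 g, entire g &
    forall x, G x = \prod_(u <- map mu A) (x - u) * g x.
  exists g => //; split=> // z gz.
  have [|n zE] := G_zero (z := z); first by rewrite Gg gz mulr0.
  exists n => //; apply/negP => nA.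
  have [g1 eg1 g1E] := entire_divdiff z eg.
  apply: (@G_simple n (fun x => \prod_(u <- rem (mu n) (map mu A)) (x - u) * g1 x)).
    exact: entire_prod_mul.
  move=> x; rewrite Gg (perm_big _ (perm_to_rem (map_f mu nA))) big_cons /=.
  by rewrite -[g x]subr0 -gz g1E zE; ring.
elim: A uA => [_|n A IH /= /andP[nA uA]].
  by exists G => // x; rewrite big_nil mul1r.
have [g eg Gg] := IH uA; have gn : g (mu n) = 0.
  apply/eqP; have /eqP := G_mu n; rewrite Gg mulf_eq0 => /orP[|//].
  rewrite prodf_seq_eq0 => /hasP[u /mapP[m mA ->]] /=.
  rewrite subr_eq0 => /eqP /mu_inj e; by rewrite e mA in nA.
have [g1 eg1 g1E] := entire_divdiff (mu n) eg; exists g1 => // x.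
by rewrite big_cons Gg -[g x]subr0 -gn g1E; ring.
Qed.

Lemma zeros_listed_simple : zeros_listed G mu.
Proof.
move=> z; have [[n zE]|nz] := pselect (exists n, z = mu n).
  have [g eg [Gg gz]] := @G_factor [:: n] isT; exists [:: n].
    by split=> // m; rewrite inE zE; split=> [/mu_inj ->|/eqP ->].
  exists g => //; split=> [|x]; last by rewrite Gg /= big_seq1 zE.
  by apply/eqP => /gz[m]; rewrite inE zE => /eqP nm /mu_inj e; apply: nm.
exists [::]; first by split=> // m; split=> // e; case: nz; exists m.
exists G => //; split=> [|x]; last by rewrite mul1r.
by apply/eqP => /G_zero.
Qed.

Variables (K s' : R) (b : nat -> R).
Hypotheses (entF : entire F) (K0 : 0 < K) (s'0 : 0 < s').
Hypothesis mu_growth : forall n, n.+1%:R <= L * weight (mu n).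
Hypothesis FG_le : forall z, 2 <= weight z -> absc (F z - G z) <= K * E z / weight z.
Hypothesis b_l2 : l2_bounded b.
Hypothesis FG_near : forall n z, 2 <= weight z -> 2 <= weight (mu n) ->
  absc (F z - G z) <= (b n + K * (absc (z - mu n) / weight (mu n))) * E z / weight z.
Hypothesis mu_gap : forall B, exists X,
  B <= X /\ forall n, s' * Num.sqrt X <= `|absc (mu n) - X|.

Variables (ep W0 : R).
Hypotheses (ep0 : 0 < ep) (ep1 : ep <= 1 / 4) (eps : ep <= s / 4) (eps' : ep <= s' / 8).
Hypotheses (W0_ge4 : 4 <= W0) (W0_ge : 8 * K <= W0 * (c * ep)).

Let near_weight n z : absc (z - mu n) <= ep * weight (mu n) ->
  weight z <= 2 * weight (mu n) /\ weight (mu n) <= 2 * weight z.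
Proof.
move=> h; apply: weight_comp; apply: le_trans h _.
by rewrite mulrC ler_pM2l ?weight_gt0// -div1r.
Qed.

(** On the small circles [G] is at least c ep / 2 times [E]; this makes the perturbation at most
    half of that. *)
Let KW z : W0 <= 2 * weight z -> K / weight z <= c * ep / 4.
Proof.
move=> h; rewrite ler_pdivrMr ?weight_gt0//.
have : W0 * (c * ep) <= 2 * weight z * (c * ep) by rewrite ler_pM2r ?mulr_gt0.
by move: W0_ge; lra.
Qed.

(** Near [mu n] the index provided by [G_lb] is either [n] itself, or it belongs to a model zero so
    remote that the minimum is not small. *)
Let far n m z : m != n -> absc (z - mu n) <= ep * weight (mu n) ->
  s / 4 <= absc (z - mu m) / weight z.
Proof.
move=> nm h; have [h1 h2] := near_weight h; rewrite ler_pdivlMr ?weight_gt0//.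
have := @mu_sep n m; rewrite eq_sym nm => /(_ isT).
have := absc_tri (mu n) (mu m) z; rewrite (absc_subC (mu n) z).
have : ep * weight (mu n) <= s / 4 * weight (mu n) by rewrite ler_pM2r ?weight_gt0.
have : s / 4 * weight z <= s / 4 * (2 * weight (mu n)) by rewrite ler_pM2l ?divr_gt0.
have : 0 < s * weight (mu n) by rewrite mulr_gt0 ?weight_gt0.
move: h1 h; lra.
Qed.

(** Rouche on the circle of radius [ep * weight (mu n)] with [mu n] as the only model zero inside:
    the relative distance there is at least ep / 2, since [weight z] is at most twice
    [weight (mu n)]. *)
Let small_zero n : W0 <= weight (mu n) ->
  exists z, F z = 0 /\ absc (z - mu n) < ep * weight (mu n).
Proof.
move=> Wn; have w0 := weight_gt0 (mu n); have [[[W4 e4] es] e1] := (W0_ge4, ep1, eps, ep0).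
have [g eg [Gg gz]] := @G_factor [:: n] isT.
have r0 : 0 < ep * weight (mu n) by rewrite mulr_gt0.
(* On the circle [E_lb] gives E z >= 1 / (2 weight (mu n)), so this margin is at most c ep / 8 times
   [E z]. *)
pose e := c * ep / (16 * weight (mu n)).
have e0 : 0 < e by rewrite divr_gt0// mulr_gt0.
have [|||z zr|z zr|l [f [_ il szl Fl _]]] :=
  @rouche _ (mu n) (ep * weight (mu n)) r0 F F g [::] [:: mu n] e entF eg e0.
- by [].
- by rewrite /= subrr absc0 r0.
- by move=> z; rewrite big_nil mul1r.
- apply/eqP => /gz[m]; rewrite inE => nm zE.
  have := far nm zr; by rewrite zE subrr absc0 mul0r leNgt divr_gt0.
- have zr' : absc (z - mu n) <= ep * weight (mu n) by rewrite zr.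
  have [h1 h2] := near_weight zr'.
  have -> : \prod_(u <- [:: mu n]) (z - u) * g z = G z by rewrite Gg.
  have Ez : (2 * weight (mu n))^-1 <= E z.
    rewrite -[X in X <= _]mul1r ler_pdivrMr ?mulr_gt0//; apply: le_trans (E_lb z) _.
    by rewrite ler_pM2l ?E_gt0.
  have wz : W0 <= 2 * weight z by lra.
  have FG : absc (F z - G z) <= c * ep / 4 * E z.
    apply: le_trans (FG_le _) _; first lra.
    by rewrite mulrAC ler_pM2r ?E_gt0// KW.
  have [m hm] := G_lb z.
  have lb : ep / 2 <= Num.min 1 (absc (z - mu m) / weight z).
    rewrite le_min; apply/andP; split; first lra.
    have [->|nm] := eqVneq m n; last by have := far nm zr'; lra.
    by rewrite zr ler_pdivlMr ?weight_gt0//; nra.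
  have G1 : c * (ep / 2) * E z <= absc (G z).
    by apply: le_trans hm; rewrite ler_pM2r ?E_gt0// ler_pM2l.
  have : e <= c * ep / 8 * E z.
    have -> : e = c * ep / 8 * (2 * weight (mu n))^-1 by rewrite /e; field; rewrite gt_eqF.
    by rewrite ler_pM2l// !mulr_gt0.
  have : 0 < c * ep * E z by rewrite !mulr_gt0 ?E_gt0.
  lra.
case: l szl il Fl => [|z [|//]] //= _ /andP[zi _] Fl.
by exists z; rewrite Fl big_seq1 subrr mul0r.
Qed.

Variables (sg B0 : R).
Hypotheses (sg0 : 0 < sg) (sg1 : sg <= 1) (sgs : sg <= s' / 2).
Hypotheses (B0_ge1 : 1 <= B0) (B0_W0 : W0 ^+ 2 <= B0) (B0_K : 2 * K <= c * sg * Num.sqrt B0).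

Let good X := B0 <= X /\ forall n, s' * Num.sqrt X <= `|absc (mu n) - X|.

(** [mu_growth] bounds the indices of the model zeros in the disc |z| < X, so filtering a finite
    range finds all of them. *)
Let indices X := [seq n <- iota 0 (Num.bound (L * (1 + Num.sqrt X))) | absc (mu n) < X].

Let mem_indices X n : (n \in indices X) = (absc (mu n) < X).
Proof.
rewrite mem_filter mem_iota /= add0n; case: ltP => //= h.
have X0 : 0 <= L * (1 + Num.sqrt X).
  by rewrite mulr_ge0 ?(ltW L0)// addr_ge0// sqrtr_ge0.
rewrite -(ltr_nat R); apply: le_lt_trans (archi_boundP X0).
apply: le_trans (_ : n.+1%:R <= _); first by rewrite ler_nat.
apply: le_trans (mu_growth n) _; rewrite ler_pM2l// /weight lerD2l ler_wsqrtr//.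
exact: ltW.
Qed.

Let uniq_indices X : uniq (indices X).
Proof. by rewrite filter_uniq// iota_uniq. Qed.

Let goodP X : good X -> [/\ 0 < X, 1 <= Num.sqrt X, X = Num.sqrt X ^+ 2,
  W0 <= Num.sqrt X & 2 * K <= c * sg * Num.sqrt X].
Proof.
move=> [BX _]; have X1 : 1 <= X := le_trans B0_ge1 BX.
have X0 : 0 < X := lt_le_trans ltr01 X1.
split=> //.
- by rewrite -sqrtr1 ler_wsqrtr.
- by rewrite sqr_sqrtr// ltW.
- rewrite -(@ler_pXn2r _ 2) ?nnegrE ?sqrtr_ge0 ?sqr_sqrtr ?(ltW X0)//.
    by apply: le_trans BX.
  by apply: le_trans W0_ge4.
- by apply: le_trans B0_K _; rewrite ler_pM2l ?mulr_gt0// ler_wsqrtr.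
Qed.

(** On |z| = X the gap condition gives |G| >= c sg E, and [B0_K] makes the perturbation at most half
    of it. Zeros already known are prescribed as [l] and completed to the full count. *)
Let big_disc X l f : good X -> entire f -> all (fun u => absc u < X) l ->
  (forall z, F z = \prod_(u <- l) (z - u) * f z) ->
  exists l' f', [/\ entire f', size (l ++ l') = size (indices X),
    all (fun u => absc u < X) (l ++ l'),
    forall z, F z = \prod_(u <- l ++ l') (z - u) * f' z &
    forall z, absc z <= X -> f' z != 0].
Proof.
move=> gX ef il Fl; have [X0 Y1 XY WY KY] := goodP gX.
set Y := Num.sqrt X in Y1 XY WY KY.
have [g eg [Gg gz]] := G_factor (uniq_indices X).
have e0 : 0 < c * sg / (2 * (1 + Y)).
  by rewrite divr_gt0 ?mulr_gt0// ltr_pwDl// (le_trans ler01).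
have il' : all (fun u => absc (u - 0) < X) l.
  by under eq_all do rewrite subr0.
have ik : all (fun u => absc (u - 0) < X) (map mu (indices X)).
  by apply/allP => _ /mapP[n nX ->]; rewrite subr0 -mem_indices.
have [z|z|l' [f' [ef' al szl Fl' f'0]]] := rouche X0 ef eg e0 il' ik Fl.
- rewrite subr0 => zX; apply/eqP => /gz[n]; rewrite mem_indices -leNgt => nX zE.
  have := gX.2 n; rewrite -zE (_ : absc z = X) ?subrr ?normr0; last first.
    by apply: le_anti; rewrite zX zE nX.
  by rewrite leNgt mulr_gt0// (lt_le_trans ltr01).
- rewrite subr0 => zX; rewrite -Gg.
  have wz : weight z = 1 + Y by rewrite /weight zX.
  have wz0 := weight_gt0 z.
  have Ez : (1 + Y)^-1 <= E z.
    by rewrite -[X in X <= _]mul1r -wz ler_pdivrMr//; apply: E_lb.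
  have FG : absc (F z - G z) <= c * sg / 2 * E z.
    apply: le_trans (FG_le _) _; first by rewrite wz; lra.
    rewrite mulrAC ler_pM2r ?E_gt0// ler_pdivrMr// wz.
    have : 0 < c * sg by rewrite mulr_gt0.
    by move: KY; nra.
  have [m hm] := G_lb z.
  have lb : sg <= Num.min 1 (absc (z - mu m) / weight z).
    rewrite le_min sg1 /= ler_pdivlMr// wz.
    have h1 := gX.2 m; rewrite -/Y -zX in h1.
    have h2 : `|absc (mu m) - absc z| <= absc (z - mu m).
      by rewrite ler_norml; have := absc_lerB (mu m) z; have := absc_lerB z (mu m);
        rewrite (absc_subC (mu m) z) => a d; apply/andP; split; lra.
    apply: le_trans (le_trans h1 h2).
    have : sg * (1 + Y) <= s' / 2 * (1 + Y) by rewrite ler_pM2r// -wz.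
    have : 0 < s' by []. nra.
  have G1 : c * sg * E z <= absc (G z).
    by apply: le_trans hm; rewrite ler_pM2r ?E_gt0// ler_pM2l.
  have : c * sg / (2 * (1 + Y)) <= c * sg / 2 * E z.
    have -> : c * sg / (2 * (1 + Y)) = c * sg / 2 * (1 + Y)^-1.
      by field; rewrite -wz gt_eqF.
    by rewrite ler_pM2l// !mulr_gt0.
  lra.
exists l', f'; split=> //; first by rewrite szl size_map.
- by under eq_all do rewrite -[X in absc X]subr0.
- by move=> z zX; apply: f'0; rewrite subr0.
Qed.

(** Since ep <= s' / 8, the displacement is smaller than the gap s' sqrt X between [mu n] and the
    circle. Hence a zero near [mu n] lies on the same side of the circle as [mu n], here and in
    [out_disc]. *)
Let in_disc X n z : good X -> absc (mu n) < X ->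
  absc (z - mu n) <= ep * weight (mu n) -> absc z < X.
Proof.
move=> gX nX zn; have [X0 Y1 XY _ _] := goodP gX.
have := gX.2 n; set Y := Num.sqrt X in Y1 XY *; rewrite ltr0_norm ?subr_lt0// => gap.
have wY : weight (mu n) <= 2 * Y.
  have : Num.sqrt (absc (mu n)) <= Y by rewrite ler_wsqrtr// ltW.
  by rewrite /weight; lra.
have h1 : ep * weight (mu n) <= ep * (2 * Y) by rewrite ler_pM2l.
have h2 : ep * (2 * Y) <= s' / 8 * (2 * Y) by rewrite ler_pM2r//; lra.
have h3 : 0 < s' * Y by rewrite mulr_gt0//; lra.
have := abscD (z - mu n) (mu n); rewrite subrK; lra.
Qed.

Let out_disc X n z : good X -> X <= absc (mu n) ->
  absc (z - mu n) <= ep * weight (mu n) -> X < absc z.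
Proof.
move=> gX nX zn; have [X0 Y1 XY _ _] := goodP gX; have [wz _] := near_weight zn.
have [_ wn] := near_weight zn.
have := gX.2 n; set Y := Num.sqrt X in Y1 XY *; rewrite ger0_norm ?subr_ge0// => gap.
rewrite ltNge; apply/negP => zX.
have wY : weight z <= 2 * Y.
  have : Num.sqrt (absc z) <= Y by rewrite ler_wsqrtr.
  by rewrite /weight; lra.
have h1 : ep * weight (mu n) <= ep * (4 * Y) by rewrite ler_pM2l//; lra.
have h2 : ep * (4 * Y) <= s' / 8 * (4 * Y) by rewrite ler_pM2r//; lra.
have h3 : 0 < s' * Y by rewrite mulr_gt0//; lra.
have := abscB z (z - mu n); rewrite opprB addrCA subrr addr0; lra.
Qed.

(** At a zero of [F] the lower bound for [G] is met by |F - G|. The crude estimate [FG_le] yields |z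
    - mu n| <= K / c; inserted into the right-hand side of [FG_near] it leaves [b n] plus a multiple
    of 1 / weight (mu n), which is O(1/n). *)
Let close_zero n z : F z = 0 -> W0 <= weight (mu n) -> absc (z - mu n) <= ep * weight (mu n) ->
  absc (z - mu n) <= c^-1 * (b n + K ^+ 2 * L / c * (n.+1%:R)^-1).
Proof.
move=> Fz Wn zn; have [wz wn] := near_weight zn.
have W4 := W0_ge4; have wz2 : 2 <= weight z by lra.
have wn2 : 2 <= weight (mu n) by lra.
have w0 : 0 < weight z := weight_gt0 z; have wn0 := weight_gt0 (mu n).
have [m] := G_lb z; have E0 := E_gt0 z.
have GF : absc (G z) = absc (F z - G z) by rewrite Fz sub0r abscN.
rewrite GF => hm.
(* A minimum this small is incompatible with [far], so the index from [G_lb] must be [n]. *)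
have mK : Num.min 1 (absc (z - mu m) / weight z) <= ep / 4.
  have := le_trans hm (FG_le wz2); rewrite [X in _ <= X]mulrAC ler_pM2r// => h.
  have := KW (z := z); rewrite (le_trans Wn wn) => /(_ isT) h'.
  have := le_trans h h'; rewrite -mulrA ler_pM2l//.
have [mn|mn] := eqVneq m n; last first.
  have := far mn zn; move: mK; rewrite ge_min => /orP[|] h1 h2.
    by move: ep0 ep1; lra.
  by move: ep0 eps; lra.
subst m; rewrite ge_min in mK; case/orP: mK => mK; first by move: ep0 ep1; lra.
have mE : Num.min 1 (absc (z - mu n) / weight z) = absc (z - mu n) / weight z.
  by rewrite min_r//; apply: le_trans mK _; move: ep0 ep1; lra.
rewrite mE in hm.
have step (x : R) : c * (absc (z - mu n) / weight z) * E z <= x * E z / weight z ->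
    c * absc (z - mu n) <= x.
  have -> : c * (absc (z - mu n) / weight z) * E z = c * absc (z - mu n) * E z / weight z.
    by ring.
  by rewrite ler_pM2r ?invr_gt0// ler_pM2r.
have d1 : absc (z - mu n) <= K / c.
  by rewrite ler_pdivlMr// mulrC; apply: step; apply: le_trans hm (FG_le wz2).
have d2 := step _ (le_trans hm (FG_near wz2 wn2)).
rewrite -(ler_pM2l c0) mulVKf ?gt_eqF//; apply: le_trans d2 _.
rewrite lerD2l.
have -> : K ^+ 2 * L / c * (n.+1%:R)^-1 = K * (K / c * (L / n.+1%:R)) by ring.
rewrite ler_pM2l//; apply: ler_pM; rewrite ?absc_ge0 ?invr_ge0 ?(ltW wn0)//.
by rewrite -[_^-1]mul1r ler_pdivrMr// mulrAC ler_pdivlMr ?ltr0n// mul1r.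
Qed.

Lemma zeros_localized_aux : exists2 lam, zeros_listed F lam &
  l2_bounded (fun n => absc (lam n - mu n)).
Proof.
(* For the finitely many [n] of small weight [zeta n] is a dummy value; [lam] uses [zeta] only
   beyond [X0]. *)
have [zeta hz] : {zeta | forall n, W0 <= weight (mu n) ->
    F (zeta n) = 0 /\ absc (zeta n - mu n) < ep * weight (mu n)}.
  apply: cid; suff /choice[f hf] : forall n, exists z, W0 <= weight (mu n) ->
    F z = 0 /\ absc (z - mu n) < ep * weight (mu n) by exists f.
  move=> n; have [h|h] := leP W0 (weight (mu n)); last by exists 0.
  by have [z hz] := small_zero h; exists z.
have [X0 gX0] := mu_gap B0.
have [l0 [f0 [ef0 szl0 al0 Fl0 f00]]] :=
  @big_disc X0 [::] F gX0 entF isT (fun z => esym (etrans (congr1 (fun v => v * F z)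
    (big_nil _ _ _ _)) (mul1r _))).
rewrite /= in szl0 al0 Fl0.
have [X0p Y1 XY WY _] := goodP gX0.
have outW n : X0 <= absc (mu n) -> W0 <= weight (mu n).
  move=> h; apply: le_trans WY _; rewrite /weight -[X in X <= _]add0r lerD//.
  by rewrite ler_wsqrtr.
set A0 := indices X0.
(* The indices with |mu n| < X0 receive the zeros of that disc in arbitrary order. There are
   finitely many of them, so the pairing does not affect square summability. *)
pose lam n := if absc (mu n) < X0 then nth 0 l0 (index n A0) else zeta n.
have lam_out n : X0 <= absc (mu n) -> [/\ F (lam n) = 0,
    absc (lam n - mu n) <= ep * weight (mu n) & W0 <= weight (mu n)].
  move=> h; rewrite /lam ltNge h /=; have [] := hz n (outW n h).
  by move=> -> /ltW ->; rewrite outW.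
have lamA0 : map lam A0 = l0.
  apply: (@eq_from_nth _ 0); first by rewrite size_map szl0.
  rewrite size_map => i iA; rewrite (nth_map 0%N)//.
  by rewrite /lam -mem_indices mem_nth//= index_uniq// uniq_indices.
have lam_inj n m : X0 <= absc (mu n) -> X0 <= absc (mu m) -> lam n = lam m -> n = m.
  move=> hn hm e; apply/eqP; apply: contraT => nm.
  have [_ a1 _] := lam_out n hn; have [_ a2 _] := lam_out m hm.
  have := mu_sep nm; have := @mu_sep m n; rewrite eq_sym nm => /(_ isT).
  rewrite (absc_subC (mu m)); have := absc_tri (mu n) (mu m) (lam n).
  rewrite (absc_subC (mu n) (lam n)) {2}e.
  have w1 := weight_gt0 (mu n); have w2 := weight_gt0 (mu m).
  have h1 : ep * weight (mu n) <= s / 4 * weight (mu n) by rewrite ler_pM2r.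
  have h2 : ep * weight (mu m) <= s / 4 * weight (mu m) by rewrite ler_pM2r.
  have h3 : 0 < s * weight (mu n) by rewrite mulr_gt0.
  have h4 : 0 < s * weight (mu m) by rewrite mulr_gt0.
  lra.
(* Different far indices carry different zeros, all outside the first disc; so each of them is a
   zero of the current cofactor and can be divided out once more. *)
have lam_factor B : uniq B -> all (fun n => X0 <= absc (mu n)) B ->
    exists2 f, entire f & forall x, F x = \prod_(u <- l0 ++ map lam B) (x - u) * f x.
  elim: B => [_ _|n B IH /= /andP[nB uB] /andP[hn hB]].
    by exists f0 => // x; rewrite cats0.
  have [f ef Ff] := IH uB hB; have [Fn dn Wn] := lam_out n hn.
  have fn : f (lam n) = 0.
    apply/eqP; have /eqP := Fn; rewrite Ff mulf_eq0 => /orP[|//].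
    rewrite prodf_seq_eq0 => /hasP[u ul] /=; rewrite subr_eq0 => /eqP nu; move: ul.
    rewrite -nu mem_cat => /orP[/(allP al0)|/mapP[m mB]].
      by rewrite ltNge (ltW (out_disc gX0 hn dn)).
    by move/(lam_inj _ _ hn (allP hB _ mB)) => e; rewrite e mB in nB.
  have [f1 ef1 f1E] := entire_divdiff (lam n) ef; exists f1 => // x.
  rewrite Ff -[f x]subr0 -fn f1E !big_cat /= big_cons; ring.
exists lam.
  (* The multiplicity at [z] is read off in a disc with [z] in its interior. The listed zeros
     already attain the count of [big_disc] there, so [l'] is empty and the cofactor does not vanish
     at [z]. *)
  move=> z; have [X [BX gapX]] := mu_gap (Num.max X0 (absc z + 1)).
  have [X0X zX] : X0 <= X /\ absc z + 1 <= X by apply/andP; rewrite -ge_max.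
  have gX : good X by split=> //; apply: le_trans X0X; case: gX0.
  pose B := [seq n <- indices X | X0 <= absc (mu n)].
  have uB : uniq B by rewrite filter_uniq// uniq_indices.
  have hB : all (fun n => X0 <= absc (mu n)) B by apply: filter_all.
  have uAB : uniq (A0 ++ B).
    rewrite cat_uniq uniq_indices uB andbT /=; apply/hasPn => n.
    by rewrite mem_filter => /andP[h _]; rewrite mem_indices ltNge h.
  have mAB n : (n \in A0 ++ B) = (absc (mu n) < X).
    rewrite mem_cat [n \in B]mem_filter !mem_indices; case: ltP => //= h.
    by rewrite (lt_le_trans h).
  have szAB : size (indices X) = size (A0 ++ B).
    by apply: perm_size; apply: uniq_perm (uniq_indices X) uAB _ => n; rewrite mAB mem_indices.
  have [f ef Ff] := lam_factor B uB hB.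
  have al : all (fun u => absc u < X) (l0 ++ map lam B).
    rewrite all_cat; apply/andP; split.
      by apply/allP => u /(allP al0) h; apply: lt_le_trans h X0X.
    apply/allP => _ /mapP[n nB ->]; have [_ dn _] := lam_out n (allP hB n nB).
    by apply: in_disc dn => //; move: nB; rewrite mem_filter mem_indices => /andP[].
  have [l' [f' [ef' szl' _ Ff' f'0]]] := big_disc gX ef al Ff.
  have l'0 : l' = [::].
    apply/eqP; rewrite -size_eq0 -(eqn_add2l (size (l0 ++ map lam B))) -size_cat szl' szAB.
    by rewrite !size_cat size_map szl0 addn0.
  rewrite l'0 cats0 -lamA0 -map_cat in Ff'.
  exists [seq n <- A0 ++ B | lam n == z].
    split; first by rewrite filter_uniq.
    move=> n; rewrite mem_filter mAB; split=> [lz|/andP[/eqP]//].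
    rewrite lz eqxx /= ltNge; apply/negP => h.
    have [_ dn _] := lam_out n (le_trans X0X h).
    by have := out_disc gX h dn; rewrite lz; lra.
  exists (fun x => \prod_(u <- [seq u <- map lam (A0 ++ B) | u != z]) (x - u) * f' x).
    exact: entire_prod_mul.
  split.
    rewrite mulf_neq0 ?f'0//; last lra.
    rewrite prodf_seq_neq0; apply/allP => u; rewrite mem_filter /= => /andP[uz _].
    by rewrite subr_eq0 eq_sym.
  move=> x; rewrite Ff' mulrA; congr (_ * _).
  rewrite (bigID (fun u => u == z)) /= big_filter; congr (_ * _).
  rewrite (eq_bigr (fun=> x - z)); last by move=> u /eqP ->.
  rewrite big_const_seq -Monoid.iteropE /= count_map size_filter.
  by congr (_ ^+ _); apply: eq_count.
have [N hN] : exists N, forall n, (N <= n)%N -> X0 <= absc (mu n).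
  exists (Num.bound (L * (1 + Num.sqrt X0))) => n; rewrite leqNgt; apply: contraR.
  by rewrite -ltNge -mem_indices mem_filter mem_iota => /andP[_].
apply: (@l2_bounded_le _ _ (fun n => c^-1 * (b n + K ^+ 2 * L / c * (n.+1%:R)^-1)) N).
  move=> n /hN h; rewrite ger0_norm ?absc_ge0//.
  by have [h1 h2 h3] := lam_out n h; apply: close_zero.
by apply: l2_boundedZ; apply: l2_boundedD => //; apply: l2_boundedZ; exact: l2_bounded_inv.
Qed.

End Localization.
(* [E] is the growth of [G] away from its zeros [mu n]. The number of zeros of
   [F] is controlled on the circles [|z| = X], which stay away from all [mu n],
   and Rouche's theorem on shrinking circles gives the displacements. *)
Lemma zeros_localized (R : realType) (F G : R[i] -> R[i]) (mu : nat -> R[i])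
    (E : R[i] -> R) (s L c K s' : R) (b : nat -> R) :
  entire F -> entire G -> 0 < s -> 0 < L -> 0 < c -> 0 < K -> 0 < s' ->
  (forall n m, n != m -> s * weight (mu n) <= absc (mu n - mu m)) ->
  (forall n, n.+1%:R <= L * weight (mu n)) ->
  (forall B, exists X, B <= X /\ forall n, s' * Num.sqrt X <= `|absc (mu n) - X|) ->
  (forall n, G (mu n) = 0) ->
  (forall z, 1 <= E z * weight z) ->
  (forall z, exists n, c * Num.min 1 (absc (z - mu n) / weight z) * E z <= absc (G z)) ->
  (forall z, 2 <= weight z -> absc (F z - G z) <= K * E z / weight z) ->
  l2_bounded b ->
  (forall n z, 2 <= weight z -> 2 <= weight (mu n) ->
     absc (F z - G z) <= (b n + K * (absc (z - mu n) / weight (mu n))) * E z / weight z) ->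
  exists2 lam, zeros_listed F lam & l2_bounded (fun n => absc (lam n - mu n)).
Proof.
move=> eF eG s0 L0 c0 K0 s'0 sep grow gap Gmu E1 Glb H2 bl2 H3.
pose ep := Num.min (1 / 4) (Num.min (s / 4) (s' / 8)).
have ep0 : 0 < ep by rewrite !lt_min !divr_gt0.
pose W0 := 8 * K / (c * ep) + 4.
pose sg := Num.min 1 (s' / 2).
have sg0 : 0 < sg by rewrite lt_min ltr01 divr_gt0.
pose Q := 2 * K / (c * sg).
pose B0 := Num.max 1 (Num.max (W0 ^+ 2) (Q ^+ 2)).
apply: (@zeros_localized_aux R F G mu E s L c eG s0 L0 c0 sep Gmu E1 Glb K s' b eF K0
  s'0 grow H2 bl2 H3 gap ep W0 ep0 _ _ _ _ _ sg B0) => //.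
- by rewrite ge_min lexx.
- by rewrite !ge_min lexx !orbT.
- by rewrite !ge_min lexx !orbT.
- by rewrite lerDr divr_ge0 ?mulr_ge0 ?ltW.
- rewrite [W0 * _]mulrDl divfK ?gt_eqF ?mulr_gt0// lerDl mulr_ge0//.
  by rewrite mulr_ge0 ?ltW.
- by rewrite ge_min lexx.
- by rewrite !ge_min lexx !orbT.
- by rewrite le_max lexx.
- by rewrite !le_max lexx !orbT.
- have Q0 : 0 <= Q by rewrite divr_ge0 ?mulr_ge0 ?ltW.
  have -> : 2 * K = c * sg * Q by rewrite /Q [RHS]mulrC divfK// gt_eqF// mulr_gt0.
  rewrite ler_pM2l ?mulr_gt0// -{1}(ger0_norm Q0) -sqrtr_sqr ler_wsqrtr//.
  by rewrite !le_max lexx !orbT.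
Qed.

(** * Derivatives of complex functions of a real variable *)

Section ComplexDerivativesOfRealVariable.
Context {R : realType}.
Implicit Types (f g : R -> R[i]) (t : R) (z w d : R[i]).

Definition is_cderive f t d :=
  is_derive t 1 (fun x => complex.Re (f x)) (complex.Re d) /\
  is_derive t 1 (fun x => complex.Im (f x)) (complex.Im d).

Lemma is_cderive_eq f g t d d' : f =1 g -> d = d' -> is_cderive f t d -> is_cderive g t d'.
Proof. by move=> /funext <- <-. Qed.

Lemma is_cderive_cst z t : is_cderive (fun=> z) t 0.
Proof. by split; apply: is_derive_cst. Qed.

Lemma is_cderiveD f g t d d' : is_cderive f t d -> is_cderive g t d' ->
  is_cderive (fun x => f x + g x) t (d + d').
Proof.
move=> [f1 f2] [g1 g2]; split; rewrite ?ReD ?ImD.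
  rewrite (_ : (fun x => _) = (fun x => complex.Re (f x)) \+ (fun x => complex.Re (g x))).
    exact: is_deriveD.
  by apply/funext => x /=; rewrite ReD.
rewrite (_ : (fun x => _) = (fun x => complex.Im (f x)) \+ (fun x => complex.Im (g x))).
  exact: is_deriveD.
by apply/funext => x /=; rewrite ImD.
Qed.

Lemma is_cderiveM f g t d d' : is_cderive f t d -> is_cderive g t d' ->
  is_cderive (fun x => f x * g x) t (d * g t + f t * d').
Proof.
move=> [f1 f2] [g1 g2]; split.
  rewrite (_ : (fun x => _) = (fun x => complex.Re (f x)) * (fun x => complex.Re (g x))
     - (fun x => complex.Im (f x)) * (fun x => complex.Im (g x))).
    apply: is_derive_eq (is_deriveB (is_deriveM f1 g1) (is_deriveM f2 g2)) _.
    by rewrite /GRing.scale /= ReD !ReM; ring.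
  by apply/funext => x /=; rewrite ReM.
rewrite (_ : (fun x => _) = (fun x => complex.Re (f x)) * (fun x => complex.Im (g x))
     + (fun x => complex.Im (f x)) * (fun x => complex.Re (g x))).
  apply: is_derive_eq (is_deriveD (is_deriveM f1 g2) (is_deriveM f2 g1)) _.
  by rewrite /GRing.scale /= ImD !ImM; ring.
by apply/funext => x /=; rewrite ImM.
Qed.

Lemma is_cderiveZ z f t d : is_cderive f t d -> is_cderive (fun x => z * f x) t (z * d).
Proof.
move=> /(is_cderiveM (is_cderive_cst z t)).
by apply: is_cderive_eq => //; rewrite mul0r add0r.
Qed.

Lemma is_derive_mull (k t : R) : is_derive t 1 (fun x => k * x) k.
Proof. by apply: is_derive_eq (is_deriveZ k (is_derive_id t 1)) _; rewrite /GRing.scale /= mulr1. Qed.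

Lemma is_derive_monomial (k : R) n t :
  is_derive t 1 (fun x => k * x ^+ n.+1) (k * (n.+1%:R * t ^+ n)).
Proof.
rewrite (_ : (fun x => _) = k \*: (id ^+ n.+1)).
  apply: is_derive_eq (is_deriveZ k (is_deriveX n.+1 (is_derive_id t 1))) _.
  by rewrite /GRing.scale /= mulr1.
by apply/funext => x; rewrite /= exprfctE.
Qed.

Lemma is_cderive_id z t : is_cderive (fun x => x%:C * z) t z.
Proof.
split.
  rewrite (_ : (fun x => _) = (fun x => complex.Re z * x)).
    exact: is_derive_mull.
  by apply/funext => x; rewrite ReM /= mul0r subr0 mulrC.
rewrite (_ : (fun x => _) = (fun x => complex.Im z * x)).
  exact: is_derive_mull.
by apply/funext => x; rewrite ImM /= mul0r addr0 mulrC.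
Qed.

Lemma is_cderive_mvt f f' (g g' : R -> R) :
  (forall t, is_cderive f t (f' t)) -> (forall t, is_derive t 1 g (g' t)) ->
  (forall t, 0 <= t <= 1 -> absc (f' t) <= g' t) -> absc (f 1 - f 0) <= g 1 - g 0.
Proof.
move=> df dg fg; pose v := f 1 - f 0; pose a := complex.Re v; pose b := complex.Im v.
rewrite -/v; have [->|v0] := eqVneq v 0.
  rewrite absc0.
  have [|t /[!in_itv]/= /andP[t0 t1] ->] := @MVT R g g' 0 1 ltr01.
    by apply: derivable_within_continuous => t _; apply: ex_derive; apply: dg.
  rewrite subr0 mulr1; apply: le_trans (fg t _); first exact: absc_ge0.
  by rewrite !ltW.
(* The mean value theorem fails for complex values; it is applied to |v| g minus the scalar product
   of [v] with [f], a real function whose derivative is nonnegative by Cauchy-Schwarz. *)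
pose h t := absc v * g t - (a * complex.Re (f t) + b * complex.Im (f t)).
pose h' t := absc v * g' t - (a * complex.Re (f' t) + b * complex.Im (f' t)).
have dh t : is_derive t 1 h (h' t).
  have [d1 d2] := df t; have d3 := dg t.
  rewrite (_ : h = (fun x => absc v * g x) - ((fun x => a * complex.Re (f x)) +
     (fun x => b * complex.Im (f x)))); last by [].
  exact: is_deriveB (is_deriveZ _ d3) (is_deriveD (is_deriveZ _ d1) (is_deriveZ _ d2)).
have [|t /[!in_itv]/= /andP[t0 t1]] := @MVT R h h' 0 1 ltr01.
  by apply: derivable_within_continuous => t _; apply: ex_derive; apply: dh.
rewrite subr0 mulr1 => hE.
have h'0 : 0 <= h' t.
  have ft : absc (f' t) <= g' t by apply: fg; rewrite !ltW.
  have : a * complex.Re (f' t) + b * complex.Im (f' t) = complex.Re (v^* * f' t).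
    by rewrite ReM /a /b; case: (v) => ? ? /=; ring.
  rewrite /h' => ->; rewrite subr_ge0; apply: le_trans (ler_norm _) _.
  apply: le_trans (absc_Re _) _; rewrite abscM absc_conj.
  by rewrite ler_wpM2l ?absc_ge0.
have : h 1 - h 0 = absc v * (g 1 - g 0) - absc v ^+ 2.
  rewrite absc_sqr /h.
  have -> : complex.Re v = complex.Re (f 1) - complex.Re (f 0) by rewrite /v ReD ReN.
  have -> : complex.Im v = complex.Im (f 1) - complex.Im (f 0) by rewrite /v ImD ImN.
  by rewrite /a /b /v !ReD !ImD !ReN !ImN; ring.
rewrite hE => e; rewrite e in h'0.
have v1 : 0 < absc v by rewrite absc_gt0.
by rewrite -(ler_pM2l v1); rewrite expr2 in h'0; lra.
Qed.

End ComplexDerivativesOfRealVariable.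

(** * Exponential, sine and cosine *)

Section ComplexExponential.
Context {R : realType}.
Implicit Types (x t : R) (z w r : R[i]).
Local Notation I := (0 +i* 1 : R[i]).

Lemma sqrI : I * I = -1.
Proof. by apply: ReImP; rewrite ?ReM ?ImM ?ReN ?ImN /=; ring. Qed.

Lemma I_neq0 : I != 0.
Proof. by rewrite eq_complex /= oner_eq0 andbF. Qed.

Lemma cexpD z w : cexp (z + w) = cexp z * cexp w.
Proof.
rewrite /cexp ReD ImD expRD.
by apply: ReImP; rewrite !(ReM, ImM) /= ?cosD ?sinD; ring.
Qed.

Lemma cexp0 : cexp 0 = 1 :> R[i].
Proof. by rewrite /cexp /= expR0 cos0 sin0 mul1r. Qed.

Lemma absc_cexp z : absc (cexp z) = expR (complex.Re z).
Proof.
rewrite /cexp abscM absc_real ger0_norm ?expR_ge0//.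
by rewrite /absc /= cos2Dsin2 sqrtr1 mulr1.
Qed.

Lemma is_cderive_cexp w z t :
  is_cderive (fun x => cexp (w + x%:C * z)) t (z * cexp (w + t%:C * z)).
Proof.
set a := complex.Re z; set b := complex.Im z.
have E x : cexp (x%:C * z) = (expR (a * x) * cos (b * x)) +i* (expR (a * x) * sin (b * x)).
  rewrite /cexp ReM ImM /= mul0r mul0r subr0 addr0 ![x * _]mulrC.
  by apply: ReImP; rewrite ?ReM ?ImM /=; ring.
suff H : is_cderive (fun x => cexp (x%:C * z)) t (z * cexp (t%:C * z)).
  have := is_cderiveZ (cexp w) H; apply: is_cderive_eq => [x|]; rewrite cexpD//.
  by ring.
have dl (k : R) := is_derive_mull k t.
have de : is_derive t 1 (fun x => expR (a * x)) (expR (a * t) * a).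
  exact: (@is_derive1_comp _ expR (fun x => a * x)).
have dc : is_derive t 1 (fun x => cos (b * x)) (- sin (b * t) * b).
  exact: (@is_derive1_comp _ cos (fun x => b * x)).
have ds : is_derive t 1 (fun x => sin (b * x)) (cos (b * t) * b).
  exact: (@is_derive1_comp _ sin (fun x => b * x)).
split.
  rewrite (_ : (fun x => _) = (fun x => expR (a * x)) * (fun x => cos (b * x))).
    apply: is_derive_eq (is_deriveM de dc) _.
    by rewrite /GRing.scale /= ReM E -/a -/b /=; ring.
  by apply/funext => x; rewrite E.
rewrite (_ : (fun x => _) = (fun x => expR (a * x)) * (fun x => sin (b * x))).
  apply: is_derive_eq (is_deriveM de ds) _.
  by rewrite /GRing.scale /= ImM E -/a -/b /=; ring.
by apply/funext => x; rewrite E.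
Qed.

Definition exp_sum n z : R[i] := \sum_(k < n) z ^+ k / k`!%:R.

Lemma is_cderive_exp_sum n z t :
  is_cderive (fun x => exp_sum n.+1 (x%:C * z)) t (z * exp_sum n (t%:C * z)).
Proof.
elim: n => [|n IH].
  have := is_cderive_cst (1 : R[i]) t; apply: is_cderive_eq => [x|].
    by rewrite /exp_sum big_ord1 expr0 divr1.
  by rewrite /exp_sum big_ord0 mulr0.
have F0 m : (m`!%:R : R[i]) != 0 by rewrite pnatr_eq0 -lt0n fact_gt0.
have H m : is_cderive (fun x => (x%:C * z) ^+ m.+1) t (m.+1%:R * z * (t%:C * z) ^+ m).
  elim: m => [|m H].
    have := is_cderive_id z t; apply: is_cderive_eq => //.
    by rewrite expr0 mulr1 mul1r.
  have := is_cderiveM (is_cderive_id z t) H; apply: is_cderive_eq => [x|].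
    by rewrite -exprS.
  by rewrite -[m.+2]addn1 natrD !exprS; ring.
have := is_cderiveD IH (is_cderiveZ (n.+1`!%:R)^-1 (H n)).
apply: is_cderive_eq => [x|].
  by rewrite [in RHS]/exp_sum big_ord_recr /= [_ / _]mulrC.
rewrite [in RHS]/exp_sum big_ord_recr /= mulrDr; congr (_ + _).
have m0 : (n.+1%:R : R[i]) != 0 by rewrite pnatr_eq0.
rewrite factS natrM; move: (F0 n) m0; move: (n.+1%:R : R[i]) (n`!%:R : R[i]) => u v v0 u0.
by field; rewrite v0 u0.
Qed.

(** Induction along the segment from 0 to [z]: the derivative of the remainder of order n+1 at tz is
    z times the remainder of order n. The bound [x] of the modulus is kept fixed, so one factor
    [expR x] serves the whole segment. *)
Lemma cexp_taylor n z x : absc z <= x ->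
  absc (cexp z - exp_sum n z) <= expR x * (absc z ^+ n / n`!%:R).
Proof.
elim: n z => [|n IH] z zx.
  rewrite /exp_sum big_ord0 subr0 expr0 divr1 mulr1 absc_cexp ler_expR.
  exact: le_trans (le_trans (ler_norm _) (absc_Re z)) zx.
have F0 : (n`!%:R : R) != 0 by rewrite pnatr_eq0 -lt0n fact_gt0.
have m0 : (n.+1%:R : R) != 0 by rewrite pnatr_eq0.
pose k := expR x * (absc z ^+ n.+1 / n`!%:R).
have := @is_cderive_mvt _ (fun t => cexp (t%:C * z) - exp_sum n.+1 (t%:C * z))
  (fun t => z * (cexp (t%:C * z) - exp_sum n (t%:C * z)))
  (fun t => k / n.+1%:R * t ^+ n.+1) (fun t => k * t ^+ n).
have e1 : (1 : R)%:C * z = z by rewrite mul1r.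
have e0 : (0 : R)%:C * z = 0 by rewrite mul0r.
rewrite e1 e0 cexp0 expr0n /= expr1n mulr0 mulr1 subr0.
have -> : exp_sum n.+1 0 = 1.
  rewrite /exp_sum big_ord_recl expr0 divr1 big1 ?addr0// => i _.
  by rewrite expr0n mul0r.
rewrite subrr subr0.
have kE : k / n.+1%:R = expR x * (absc z ^+ n.+1 / n.+1`!%:R).
  rewrite /k factS natrM; move: F0 m0; move: (n.+1%:R : R) (n`!%:R : R) => u v v0 u0.
  by field; rewrite v0 u0.
rewrite kE; apply=> [t|t|t /andP[t0 t1]].
- have h1 := is_cderive_cexp 0 z t.
  have h2 := is_cderiveZ (-1) (is_cderive_exp_sum n z t).
  have := is_cderiveD h1 h2; apply: is_cderive_eq => [x'|]; rewrite !add0r; ring.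
- by apply: is_derive_eq (is_derive_monomial _ _ _) _; rewrite -kE mulrA divfK.
- have tz : absc (t%:C * z) = t * absc z by rewrite abscM absc_real ger0_norm.
  rewrite abscM; apply: le_trans (_ : absc z * (expR x * (absc (t%:C * z) ^+ n / n`!%:R)) <= _).
    rewrite ler_wpM2l ?absc_ge0// IH// tz; have := absc_ge0 z; nra.
  rewrite tz /k exprMn exprS le_eqVlt; apply/orP; left; apply/eqP; ring.
Qed.

Definition csin z : R[i] := (cexp (I * z) - cexp (- (I * z))) / (2 * I).

Let two0 : (2 : R[i]) != 0.
Proof. by rewrite pnatr_eq0. Qed.

Lemma cexpI z : cexp (I * z) = ccos z + I * csin z.
Proof. by rewrite /ccos /csin; field; rewrite ?two0 I_neq0. Qed.

Lemma cexpIN z : cexp (- (I * z)) = ccos z - I * csin z.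
Proof. by rewrite /ccos /csin; field; rewrite ?two0 I_neq0. Qed.

Lemma ccosN z : ccos (- z) = ccos z.
Proof. by rewrite /ccos mulrN opprK addrC. Qed.

Lemma csinN z : csin (- z) = - csin z.
Proof. by rewrite /csin mulrN opprK -[RHS]mulNr opprB. Qed.

Lemma ccos0 : ccos 0 = 1 :> R[i].
Proof. by rewrite /ccos mulr0 oppr0 cexp0; field. Qed.

Lemma csin0 : csin 0 = 0 :> R[i].
Proof. by rewrite /csin mulr0 oppr0 subrr mul0r. Qed.

Lemma ccosD z w : ccos (z + w) = ccos z * ccos w - csin z * csin w.
Proof.
rewrite {1}/ccos mulrDr opprD !cexpD !cexpI !cexpIN.
have h := sqrI; set i := I in h *.
apply: (mulfI two0); rewrite mulrC divfK//.
transitivity (2 * ccos z * ccos w + 2 * (i * i) * (csin z * csin w)); first by ring.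
by rewrite h; ring.
Qed.

Lemma csinD z w : csin (z + w) = csin z * ccos w + ccos z * csin w.
Proof.
rewrite {1}/csin mulrDr opprD !cexpD !cexpI !cexpIN.
by field; rewrite ?two0 I_neq0.
Qed.

Lemma ccosB z w : ccos (z - w) = ccos z * ccos w + csin z * csin w.
Proof. by rewrite ccosD ccosN csinN mulrN opprK. Qed.

Lemma absc_cexpI z : absc (cexp (I * z)) <= expR `|complex.Im z|.
Proof.
rewrite absc_cexp ler_expR ReM /= mul0r mul1r sub0r.
by rewrite -normrN ler_norm.
Qed.

Lemma absc_cexpIN z : absc (cexp (- (I * z))) <= expR `|complex.Im z|.
Proof. by rewrite -mulrN; have := absc_cexpI (- z); rewrite ImN normrN. Qed.

Lemma absc_ccos_le z : absc (ccos z) <= expR `|complex.Im z|.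
Proof.
rewrite /ccos abscM abscV absc_nat ler_pdivrMr//.
by apply: le_trans (abscD _ _) _; have := absc_cexpI z; have := absc_cexpIN z; lra.
Qed.

Lemma absc_I : absc I = 1.
Proof. by rewrite /absc /= expr0n add0r expr1n sqrtr1. Qed.

Lemma is_cderive_ccos w z t :
  is_cderive (fun x => ccos (w + x%:C * z)) t (- z * csin (w + t%:C * z)).
Proof.
have h1 := is_cderiveZ (2^-1) (is_cderive_cexp (I * w) (I * z) t).
have h2 := is_cderiveZ (2^-1) (is_cderive_cexp (- (I * w)) (- (I * z)) t).
have := is_cderiveD h1 h2; apply: is_cderive_eq => [x|].
  rewrite /ccos -mulrDr mulrC; congr ((cexp _ + cexp _) / _); ring.
have E : I * w + t%:C * (I * z) = I * (w + t%:C * z) by ring.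
have E' : - (I * w) + t%:C * - (I * z) = - (I * (w + t%:C * z)) by ring.
rewrite E E' cexpI cexpIN; set s := csin _; set c := ccos _; set i := I.
transitivity ((i * i) * z * s); first by field.
by rewrite sqrI; ring.
Qed.

Lemma is_cderive_csin w z t :
  is_cderive (fun x => csin (w + x%:C * z)) t (z * ccos (w + t%:C * z)).
Proof.
have h1 := is_cderiveZ ((2 * I)^-1) (is_cderive_cexp (I * w) (I * z) t).
have h2 := is_cderiveZ (- (2 * I)^-1) (is_cderive_cexp (- (I * w)) (- (I * z)) t).
have := is_cderiveD h1 h2; apply: is_cderive_eq => [x|].
  rewrite /csin mulNr -mulrBr mulrC; congr ((cexp _ - cexp _) / _); ring.
have E : I * w + t%:C * (I * z) = I * (w + t%:C * z) by ring.
have E' : - (I * w) + t%:C * - (I * z) = - (I * (w + t%:C * z)) by ring.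
rewrite E E' cexpI cexpIN; set s := csin _; set c := ccos _.
by field; rewrite ?two0 I_neq0.
Qed.

Lemma absc_csin_le_mul z : absc (csin z) <= absc z * expR `|complex.Im z|.
Proof.
have := @is_cderive_mvt _ (fun t => csin (0 + t%:C * z)) (fun t => z * ccos (0 + t%:C * z))
  (fun t => absc z * expR `|complex.Im z| * t) (fun=> absc z * expR `|complex.Im z|).
have e1 : (1 : R)%:C * z = z by rewrite mul1r.
have e0 : (0 : R)%:C * z = 0 by rewrite mul0r.
rewrite e1 e0 !add0r csin0 mulr1 mulr0 !subr0; apply=> [t|t|t /andP[t0 t1]].
- exact: is_cderive_csin.
- exact: is_derive_mull.
- rewrite add0r abscM ler_wpM2l ?absc_ge0//; apply: le_trans (absc_ccos_le _) _.
  rewrite ler_expR ImM /= mul0r addr0 normrM ger0_norm//.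
  by rewrite ler_piMl.
Qed.

End ComplexExponential.

(** * Entire functions given by power series *)

Section EntireSeries.
Context {R : realType}.
Implicit Types (F : R[i] -> R[i]) (a : nat -> R[i]) (M r e : R) (z : R[i]).

Lemma exp_series_cauchy r e : 0 < e -> exists N, forall m n, (N <= n)%N -> (n <= m)%N ->
  \sum_(n <= k < m) r ^+ k / k`!%:R <= e.
Proof.
move=> e0; have e2 : 0 < e / 2 by rewrite divr_gt0.
have /cvgrPdist_le/(_ _ e2)[N _ hN] := @is_cvg_series_exp_coeff R r.
exists N => m n Nn nm; have := hN n Nn; have := hN m (leq_trans Nn nm).
set l := limn _ => /= h1 h2.
have <- : series (exp_coeff r) m - series (exp_coeff r) n = \sum_(n <= k < m) r ^+ k / k`!%:R.
  rewrite /series /= (big_cat_nat (leq0n n) nm) /= [X in X - _]addrC addrK.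
  by apply: eq_bigr => k _; rewrite /exp_coeff.
have := ler_norm (series (exp_coeff r) m - series (exp_coeff r) n).
have := ler_distD l (series (exp_coeff r) m) (series (exp_coeff r) n).
rewrite (distrC _ l); lra.
Qed.

Lemma exp_coeff_small r e : 0 < e -> exists N, forall n, (N <= n)%N ->
  r ^+ n / n`!%:R <= e.
Proof.
move=> e0; have [N hN] := exp_series_cauchy r e0; exists N => n Nn.
by have := hN n.+1 n Nn (leqnSn n); rewrite big_nat1.
Qed.

(** With coefficients at most M / k! the exponential series at [r] is a majorant in every
    [pnorm r]. *)
Lemma entire_of_series F a M : (forall k, absc (a k) <= M / k`!%:R) ->
  (forall z e, 0 < e -> exists N, forall n, (N <= n)%N ->
     absc (F z - \sum_(k < n) a k * z ^+ k) <= e) -> entire F.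
Proof.
move=> aM hF; exists (fun n => \poly_(k < n) a k); split; last first.
  move=> z e /(hF z)[N hN]; exists N => n /hN.
  by rewrite horner_poly.
move=> r e r0 e0.
have M0 : 0 <= M by have := aM 0%N; rewrite divr1; apply: le_trans; exact: absc_ge0.
have eM : 0 < e / (M + 1) by rewrite divr_gt0// ltr_wpDl.
have [N hN] := exp_series_cauchy r eM.
suff H m n : (N <= n)%N -> (n <= m)%N ->
    pnorm r (\poly_(k < m) a k - \poly_(k < n) a k) <= e.
  exists N => m n Nm Nn; have [nm|/ltnW mn] := leqP n m; first exact: H.
  by rewrite pnorm_subC H.
move=> Nn nm.
have sz : (size (\poly_(k < m) a k - \poly_(k < n) a k)%R <= m)%N.
  apply: leq_trans (size_polyD _ _) _; rewrite size_polyN geq_max size_poly /=.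
  exact: leq_trans (size_poly _ _) nm.
rewrite (pnorm_widen r sz).
rewrite -(big_mkord xpredT (fun i => absc (\poly_(k < m) a k - \poly_(k < n) a k)`_i * r ^+ i)).
rewrite (big_cat_nat (leq0n n) nm) /= [X in X + _]big_nat_cond [X in X + _]big1 ?add0r; last first.
  move=> i /andP[/andP[_ i_n] _].
  by rewrite coefB !coef_poly i_n (leq_trans i_n nm) subrr absc0 mul0r.
apply: le_trans (_ : M * (e / (M + 1)) <= _); last first.
  rewrite mulrA ler_pdivrMr ?ltr_wpDl// mulrC ler_pM2l// lerDl//.
apply: le_trans (ler_wpM2l M0 (hN m n Nn nm)); rewrite mulr_sumr big_nat_cond [leRHS]big_nat_cond.
apply: ler_sum => i /andP[/andP[ni im] _].
rewrite coefB !coef_poly im ltnNge ni /= subr0 mulrA mulrAC ler_wpM2r ?exprn_ge0//.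
Qed.

End EntireSeries.

(** * Cosine and sine of the square root of lambda *)

Section CosSinOfSquareRoot.
Context {R : realType}.
Implicit Types (x y t l : R) (z w r : R[i]) (n k : nat).
Local Notation I := (0 +i* 1 : R[i]).

Definition rt z : R[i] := sqrtc z.

Lemma rtK z : rt z ^+ 2 = z.
Proof. exact: sqr_sqrtc. Qed.

Lemma absc_rt z : absc (rt z) = Num.sqrt (absc z).
Proof. by rewrite -{2}(rtK z) abscX sqrtr_sqr ger0_norm ?absc_ge0. Qed.

Lemma weightE z : weight z = 1 + absc (rt z).
Proof. by rewrite /weight absc_rt. Qed.

Lemma rt_eq0 z : (rt z == 0) = (z == 0).
Proof. exact: sqrtc_eq0. Qed.

Lemma rt0 : rt 0 = 0 :> R[i].
Proof. by apply/eqP; rewrite rt_eq0. Qed.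

Lemma sqrt_rt r z : r ^+ 2 = z -> r = rt z \/ r = - rt z.
Proof.
move=> h; have /eqP : r ^+ 2 = rt z ^+ 2 by rewrite rtK.
by rewrite eqf_sqr => /orP[] /eqP; [left|right].
Qed.

(** Even in the root, hence independent of the branch of [rt]; this is what makes it entire in
    lambda. *)
Definition cosl x z : R[i] := ccos (rt z * x%:C).

(* [sin (rt z * x) / rt z], extended by continuity to [z = 0]. *)
Definition sinl x z : R[i] := if z == 0 then x%:C else csin (rt z * x%:C) / rt z.

Lemma cosl_rt r x z : r ^+ 2 = z -> cosl x z = ccos (r * x%:C).
Proof. by move=> /sqrt_rt[] ->; rewrite /cosl ?mulNr ?ccosN. Qed.

Lemma rt_sinl x z : rt z * sinl x z = csin (rt z * x%:C).
Proof.
rewrite /sinl; case: eqP => [->|/eqP z0]; last by rewrite mulrC divfK// rt_eq0.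
by rewrite rt0 !mul0r csin0.
Qed.

Lemma sinl_rt r x z : r ^+ 2 = z -> r * sinl x z = csin (r * x%:C).
Proof. by move=> /sqrt_rt[] ->; rewrite ?mulNr rt_sinl ?csinN. Qed.

Lemma coslN x z : cosl (- x) z = cosl x z.
Proof. by rewrite /cosl rmorphN /= mulrN ccosN. Qed.

Lemma sinlN x z : sinl (- x) z = - sinl x z.
Proof. by rewrite /sinl rmorphN /= mulrN csinN mulNr; case: ifP. Qed.

Lemma cosl0 z : cosl 0 z = 1.
Proof. by rewrite /cosl mulr0 ccos0. Qed.

Lemma sinl0 z : sinl 0 z = 0.
Proof. by rewrite /sinl mulr0 csin0 mul0r; case: ifP. Qed.

Lemma coslD x y z : cosl (x + y) z = cosl x z * cosl y z - z * (sinl x z * sinl y z).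
Proof.
rewrite /cosl rmorphD mulrDr ccosD -!rt_sinl; congr (_ - _).
by transitivity (rt z ^+ 2 * (sinl x z * sinl y z)); [ring | rewrite rtK].
Qed.

Lemma sinlD x y z : sinl (x + y) z = sinl x z * cosl y z + cosl x z * sinl y z.
Proof.
have [->|z0] := eqVneq z 0.
  by rewrite /sinl eqxx /cosl rt0 !mul0r ccos0 mulr1 mul1r rmorphD.
rewrite /sinl (negbTE z0) rmorphD mulrDr csinD /cosl.
by field; rewrite rt_eq0.
Qed.

Lemma cosl2D z x : cosl x z ^+ 2 + z * sinl x z ^+ 2 = 1.
Proof. by rewrite -(cosl0 z) -(subrr x) coslD coslN sinlN; ring. Qed.

Lemma is_cderive_cosl x z t :
  is_cderive (fun s => cosl (x - s) z) t (z * sinl (x - t) z).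
Proof.
have E s : rt z * x%:C + s%:C * - rt z = rt z * (x - s)%:C by rewrite rmorphB /=; ring.
have := is_cderive_ccos (rt z * x%:C) (- rt z) t; apply: is_cderive_eq => [s|].
  by rewrite E.
rewrite E opprK -rt_sinl.
by transitivity (rt z ^+ 2 * sinl (x - t) z); [ring | rewrite rtK].
Qed.

Lemma is_cderive_sinl x z t :
  is_cderive (fun s => sinl (x - s) z) t (- cosl (x - t) z).
Proof.
have E s : rt z * x%:C + s%:C * - rt z = rt z * (x - s)%:C by rewrite rmorphB /=; ring.
have [->|z0] := eqVneq z 0.
  have := is_cderiveD (is_cderive_cst x%:C t) (is_cderive_id (-1) t).
  apply: is_cderive_eq => [s|]; first by rewrite /sinl eqxx rmorphB /= mulrN1.
  by rewrite add0r /cosl rt0 mul0r ccos0.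
have := is_cderiveZ (rt z)^-1 (is_cderive_csin (rt z * x%:C) (- rt z) t).
apply: is_cderive_eq => [s|].
  by rewrite E /sinl (negbTE z0) mulrC.
by rewrite E /cosl mulrA mulrN mulVf ?rt_eq0// mulN1r.
Qed.

Lemma Im_mul_le r x l : `|x| <= l -> `|complex.Im (r * x%:C)| <= l * `|complex.Im r|.
Proof. by move=> xl; rewrite ImM /= mulr0 add0r normrM mulrC ler_wpM2r. Qed.

(** The coefficient of lambda^k in cos (x sqrt lambda). Of the decay 1/(2k)! only 1/k! is retained
    below, the form that [entire_of_series] takes. *)
Definition cosl_coef k x : R[i] := ((-1) ^+ k * x ^+ k.*2 / k.*2`!%:R)%:C.
Definition sinl_coef k x : R[i] := ((-1) ^+ k * x ^+ k.*2.+1 / k.*2.+1`!%:R)%:C.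

Let inv_fact_le (m k : nat) : (k <= m)%N -> (m`!%:R)^-1 <= (k`!%:R)^-1 :> R.
Proof.
move=> km; rewrite lef_pV2 ?posrE ?ltr0n ?fact_gt0// ler_nat.
exact: leq_fact.
Qed.

Lemma absc_cosl_coef k x : `|x| <= 1 -> absc (cosl_coef k x) <= (k`!%:R)^-1.
Proof.
move=> x1; rewrite absc_real normrM normrM normrX normrN1 expr1n mul1r.
rewrite [X in _ * X]ger0_norm ?invr_ge0// -[leRHS]mul1r.
apply: ler_pM; rewrite ?invr_ge0 ?normr_ge0//; last first.
  by apply: inv_fact_le; rewrite -addnn leq_addr.
by rewrite normrX exprn_ile1.
Qed.

Lemma absc_sinl_coef k x : `|x| <= 1 -> absc (sinl_coef k x) <= (k`!%:R)^-1.
Proof.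
move=> x1; rewrite absc_real normrM normrM normrX normrN1 expr1n mul1r.
rewrite [X in _ * X]ger0_norm ?invr_ge0// -[leRHS]mul1r.
apply: ler_pM; rewrite ?invr_ge0 ?normr_ge0//; last first.
  by apply: inv_fact_le; rewrite -addnn -addnS leq_addr.
by rewrite normrX exprn_ile1.
Qed.

Let exp_even_I n w : (I * w) ^+ n.*2 = (-1) ^+ n * w ^+ n.*2.
Proof. by rewrite exprMn -mul2n exprM expr2 sqrI. Qed.

Let exp_even_N n w : (- (I * w)) ^+ n.*2 = (I * w) ^+ n.*2.
Proof. by rewrite -[- _]mulN1r exprMn -mul2n exprM sqrrN !expr1n mul1r. Qed.

Lemma exp_sum_even n w :
  exp_sum n.*2 (I * w) + exp_sum n.*2 (- (I * w)) =
  2 * \sum_(k < n) (-1) ^+ k * w ^+ k.*2 / k.*2`!%:R.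
Proof.
elim: n => [|n IH]; first by rewrite /exp_sum !big_ord0 mulr0 addr0.
rewrite doubleS /exp_sum !big_ord_recr /= -!/(exp_sum _ _) [in RHS]mulrDr -IH.
rewrite [(I * w) ^+ n.*2.+1]exprS [(- (I * w)) ^+ n.*2.+1]exprS exp_even_N exp_even_I.
ring.
Qed.

Lemma exp_sum_odd n w :
  exp_sum n.*2 (I * w) - exp_sum n.*2 (- (I * w)) =
  2 * I * \sum_(k < n) (-1) ^+ k * w ^+ k.*2.+1 / k.*2.+1`!%:R.
Proof.
elim: n => [|n IH]; first by rewrite /exp_sum !big_ord0 mulr0 subr0.
rewrite doubleS /exp_sum !big_ord_recr /= -!/(exp_sum _ _) [in RHS]mulrDr -IH.
rewrite [w ^+ n.*2.+1]exprS [(I * w) ^+ n.*2.+1]exprS [(- (I * w)) ^+ n.*2.+1]exprS exp_even_N exp_even_I.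
ring.
Qed.

End CosSinOfSquareRoot.

Section UniformSeries.
Context {R : realType}.
Implicit Types (x y t e : R) (z w : R[i]) (n k : nat).
Local Notation I := (0 +i* 1 : R[i]).

(** Coefficient bounds and convergence are uniform for x in [-1, 1], so that the series may be
    integrated termwise against [q] and yields an entire function again. *)
Definition unit_series (f : R -> R[i] -> R[i]) (a : nat -> R -> R[i]) :=
  (forall k x, `|x| <= 1 -> absc (a k x) <= (k`!%:R)^-1) /\
  (forall z e, 0 < e -> exists N, forall n x, (N <= n)%N -> `|x| <= 1 ->
     absc (f x z - \sum_(k < n) a k x * z ^+ k) <= e).

Let two0 : (2 : R[i]) != 0.
Proof. by rewrite pnatr_eq0. Qed.

Let exp_bound z x n : `|x| <= 1 ->
  absc (cexp (I * (rt z * x%:C)) - exp_sum n (I * (rt z * x%:C))) <=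
    expR (absc (rt z)) * (absc (rt z) ^+ n / n`!%:R) /\
  absc (cexp (- (I * (rt z * x%:C))) - exp_sum n (- (I * (rt z * x%:C)))) <=
    expR (absc (rt z)) * (absc (rt z) ^+ n / n`!%:R).
Proof.
move=> x1; set w := rt z * _.
have wr : absc (I * w) <= absc (rt z).
  by rewrite abscM absc_I mul1r abscM absc_real ler_piMr ?absc_ge0.
have wr' : absc (- (I * w)) <= absc (rt z) by rewrite abscN.
have h : absc (I * w) ^+ n <= absc (rt z) ^+ n by rewrite lerXn2r ?nnegrE ?absc_ge0.
have h' : absc (- (I * w)) ^+ n <= absc (rt z) ^+ n by rewrite lerXn2r ?nnegrE ?absc_ge0.
by split; (apply: le_trans (cexp_taylor n _) _; first eassumption);
  rewrite ler_wpM2l ?expR_ge0// ler_wpM2r ?invr_ge0.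
Qed.

Lemma cosl_series : unit_series cosl cosl_coef.
Proof.
split=> [k x|z e e0]; first exact: absc_cosl_coef.
have e1 : 0 < e / expR (absc (rt z)) by rewrite divr_gt0 ?expR_gt0.
have [N hN] := exp_coeff_small (absc (rt z)) e1; exists N => n x Nn x1.
have {}hN : expR (absc (rt z)) * (absc (rt z) ^+ n.*2 / n.*2`!%:R) <= e.
  rewrite mulrC -ler_pdivlMr ?expR_gt0//; apply: hN.
  by apply: leq_trans Nn _; rewrite -addnn leq_addr.
set w := rt z * x%:C.
have -> : \sum_(k < n) cosl_coef k x * z ^+ k =
    \sum_(k < n) (-1) ^+ k * w ^+ k.*2 / k.*2`!%:R.
  apply: eq_bigr => k _; rewrite /cosl_coef !rmorphM /= fmorphV rmorph_nat !rmorphXn.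
  rewrite /w exprMn /= rmorphN1 -{1}(rtK z) -exprM mul2n; ring.
have [h1 h2] := exp_bound z n.*2 x1; rewrite -/w in h1 h2.
have -> : cosl x z - \sum_(k < n) (-1) ^+ k * w ^+ k.*2 / k.*2`!%:R =
    2^-1 * ((cexp (I * w) - exp_sum n.*2 (I * w)) +
            (cexp (- (I * w)) - exp_sum n.*2 (- (I * w)))).
  rewrite addrACA -opprD exp_sum_even /cosl /ccos -/w mulrBr mulKf//; congr (_ - _).
  by rewrite mulrC.
rewrite abscM abscV absc_nat.
have := abscD (cexp (I * w) - exp_sum n.*2 (I * w)) (cexp (- (I * w)) - exp_sum n.*2 (- (I * w))).
lra.
Qed.

Lemma sinl_series : unit_series sinl sinl_coef.
Proof.
split=> [k x|z e e0]; first exact: absc_sinl_coef.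
have [->|z0] := eqVneq z 0.
  exists 1%N => -[//|n] x _ _; rewrite big_ord_recl big1 => [|i _]; last first.
    by rewrite expr0n /= mulr0.
  have -> : sinl_coef 0 x = x%:C by rewrite /sinl_coef expr0 expr1 mul1r divr1.
  rewrite /sinl eqxx expr0 mulr1 addr0 subrr absc0.
  exact: ltW.
have r0 : 0 < absc (rt z) by rewrite absc_gt0 rt_eq0.
have e1 : 0 < e * absc (rt z) / expR (absc (rt z)) by rewrite divr_gt0 ?expR_gt0// mulr_gt0.
have [N hN] := exp_coeff_small (absc (rt z)) e1; exists N => n x Nn x1.
have {}hN : expR (absc (rt z)) * (absc (rt z) ^+ n.*2 / n.*2`!%:R) <= e * absc (rt z).
  rewrite mulrC -ler_pdivlMr ?expR_gt0//; apply: hN.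
  by apply: leq_trans Nn _; rewrite -addnn leq_addr.
set w := rt z * x%:C.
have E : rt z * \sum_(k < n) sinl_coef k x * z ^+ k =
    \sum_(k < n) (-1) ^+ k * w ^+ k.*2.+1 / k.*2.+1`!%:R.
  rewrite mulr_sumr; apply: eq_bigr => k _.
  rewrite /sinl_coef !rmorphM /= fmorphV rmorph_nat !rmorphXn.
  rewrite /w exprMn /= rmorphN1 -{2}(rtK z) -exprM mul2n [rt z ^+ _.+1]exprS; ring.
have [h1 h2] := exp_bound z n.*2 x1; rewrite -/w in h1 h2.
rewrite -(ler_pM2r r0) mulrC -abscM mulrBr rt_sinl -/w E.
have -> : csin w - \sum_(k < n) (-1) ^+ k * w ^+ k.*2.+1 / k.*2.+1`!%:R =
    (2 * I)^-1 * ((cexp (I * w) - exp_sum n.*2 (I * w)) -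
            (cexp (- (I * w)) - exp_sum n.*2 (- (I * w)))).
  have ee (p q p' q' : R[i]) : p - p' - (q - q') = p - q - (p' - q') by ring.
  rewrite ee exp_sum_odd /csin mulrBr mulKf ?mulf_neq0 ?I_neq0//.
  by congr (_ - _); rewrite mulrC.
rewrite abscM abscV abscM absc_nat absc_I mulr1.
have := abscB (cexp (I * w) - exp_sum n.*2 (I * w)) (cexp (- (I * w)) - exp_sum n.*2 (- (I * w))).
lra.
Qed.

Lemma entire_unit_series f a x : unit_series f a -> `|x| <= 1 -> entire (f x).
Proof.
move=> [h1 h2] x1; apply: (@entire_of_series _ _ (fun k => a k x) 1) => [k|z e e0].
  by rewrite mul1r h1.
by have [N hN] := h2 z e e0; exists N => n Nn; apply: hN.
Qed.

End UniformSeries.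

(** * Lower bounds for the complex sine *)

Section SineLowerBound.
Context {R : realType}.
Implicit Types (x y t : R) (z w : R[i]).
Local Notation I := (0 +i* 1 : R[i]).

Lemma ccos_real x : ccos x%:C = (cos x)%:C.
Proof.
have two0 : (2 : R[i]) != 0 by rewrite pnatr_eq0.
apply: (mulfI two0); rewrite /ccos mulrC divfK// mulr_natl mulr2n.
rewrite /cexp !(ReM, ImM, ReN, ImN) /= !(mul0r, mulr0, mul1r, subr0, addr0, oppr0).
by rewrite add0r expR0 cosN sinN; apply: ReImP; rewrite !(ReD, ImD, ReM, ImM) /=; ring.
Qed.

Lemma csin_ReIm z : csin z =
  (sin (complex.Re z) * ((expR (complex.Im z) + expR (- complex.Im z)) / 2)) +i*
  (cos (complex.Re z) * ((expR (complex.Im z) - expR (- complex.Im z)) / 2)).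
Proof.
have n0 : 2 * I != 0 by rewrite mulf_neq0 ?I_neq0// pnatr_eq0.
apply: (mulfI n0); rewrite /csin mulrC divfK// -mulrA mulr_natl mulr2n.
rewrite /cexp !(ReM, ImM, ReN, ImN) /= !(mul0r, mulr0, mul1r, sub0r, subr0, addr0, add0r, oppr0, opprK).
by rewrite cosN sinN; apply: ReImP; rewrite !(ReD, ImD, ReM, ImM, ReN, ImN) /=; field.
Qed.

Lemma csin_real x : csin x%:C = (sin x)%:C.
Proof.
rewrite csin_ReIm /= oppr0 expR0; apply: ReImP => /=; first by field.
by rewrite subrr mul0r mulr0.
Qed.

(** With u = x/2 one has sin x = 2 sin u cos u and sin u = u cos t; both cosines are at least cos
    (pi/4), whose square is 1/2. *)
Lemma sin_ge_half x : 0 <= x -> x <= pi / 2 -> x / 2 <= sin x.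
Proof.
move=> x0 xpi; set u := x / 2.
have pi0 := @pi_gt0 R.
have [u0|u0] := leP u 0.
  have -> : x = 0 by rewrite /u in u0; lra.
  by rewrite sin0.
have c4 : cos (pi / 4) ^+ 2 = 1 / 2 :> R.
  have := cos_mulr2n (pi / 4 : R); have -> : (pi / 4) *+ 2 = pi / 2 :> R by field.
  by rewrite cos_pihalf; lra.
have c40 : 0 <= cos (pi / 4 : R) by rewrite cos_ge0_pihalf//; apply/andP; split; lra.
have cosge t : 0 <= t -> t <= pi / 4 -> cos (pi / 4) <= cos t.
  move=> t0 t4; rewrite leNgt; apply/negP; rewrite ltr_cos ?in_itv /=; lra.
have [|t /[!in_itv]/= /andP[t0 tu] E] := @MVT R sin cos 0 u u0.
  by apply: derivable_within_continuous => ? _; exact: derivable_sin.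
rewrite sin0 !subr0 in E.
have -> : x = u *+ 2 by rewrite /u; field.
rewrite sin_mulr2n E.
have h1 : cos (pi / 4) <= cos t by apply: cosge; rewrite /u in tu *; lra.
have h2 : cos (pi / 4) <= cos u by apply: cosge; rewrite /u; lra.
have h3 : 1 / 2 <= cos u * cos t.
  by rewrite -c4 expr2; apply: ler_pM.
have : 1 / 2 * u <= cos u * cos t * u by rewrite ler_pM2r.
by move=> h; rewrite [X in _ <= X]mulr2n; lra.
Qed.

Lemma expR_sub_ge y : 0 <= y -> y <= expR y - expR (- y).
Proof.
move=> y0; have h1 := expR_ge1Dx y.
have : expR (- y) <= 1 by rewrite expR_le1 oppr_le0.
lra.
Qed.

(** The square of |sin z| is sin^2 x + sinh^2 y. For |y| >= 1/2 the hyperbolic sine alone has the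
    growth of the exponential; for smaller |y| the exponential is at most 2, and |sin x| >= |x|/2,
    |sinh y| >= |y|/2 give a bound linear in |z|. *)
Lemma csin_lb_strip z : `|complex.Re z| <= pi / 2 ->
  1 / 4 * Num.min 1 (absc z) * expR `|complex.Im z| <= absc (csin z).
Proof.
set x := complex.Re z; set y := complex.Im z => xpi.
pose sh := (expR y - expR (- y)) / 2.
have ee : expR y * expR (- y) = 1 by rewrite -expRD subrr expR0.
have A : absc (csin z) ^+ 2 = sin x ^+ 2 + sh ^+ 2.
  rewrite csin_ReIm absc_sqr /= -/x -/y /sh.
  have c2 := cos2Dsin2 x.
  transitivity ((cos x ^+ 2 + sin x ^+ 2) * ((expR y - expR (- y)) / 2) ^+ 2 +
     sin x ^+ 2 * (expR y * expR (- y))); first by field.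
  by rewrite c2 ee; ring.
have shE : `|sh| = (expR `|y| - expR (- `|y|)) / 2.
  rewrite /sh normrM [X in _ * X]ger0_norm ?invr_ge0//; congr (_ / 2).
  have [y0|y0] := leP 0 y.
    by rewrite ger0_norm ?(ger0_norm y0)//; apply: le_trans (expR_sub_ge y0).
  have y1 : 0 <= - y by lra.
  have := expR_sub_ge y1; rewrite opprK => h.
  by rewrite distrC (ltr0_norm y0) opprK ger0_norm//; lra.
set e := expR `|y| in shE *; have e1 : 1 + `|y| <= e := expR_ge1Dx _.
have ne : 0 <= `|y| := normr_ge0 y.
have nn : e * expR (- `|y|) = 1 by rewrite -expRD subrr expR0.
have s0 := absc_ge0 (csin z).
have [y2|y2] := leP (1 / 2) `|y|.
  have sle : `|sh| <= absc (csin z).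
    rewrite -(@ler_pXn2r _ 2) ?nnegrE ?absc_ge0// A real_normK ?num_real//.
    by rewrite lerDr sqr_ge0.
  have h1 : expR (- `|y|) <= e / 2 by nra.
  have h2 : Num.min 1 (absc z) <= 1 by rewrite ge_min lexx.
  have h3 : 0 <= Num.min 1 (absc z) by rewrite le_min ler01 absc_ge0.
  nra.
have e2 : e <= 2.
  have := expR_ge1Dx (- `|y|); nra.
have sx : `|x| / 2 <= `|sin x|.
  have [x0|x0] := leP 0 x.
    by rewrite (ger0_norm x0) in xpi *; apply: le_trans (sin_ge_half x0 xpi) (ler_norm _).
  rewrite (ltr0_norm x0) in xpi *; rewrite -normrN -sinN.
  by apply: le_trans (ler_norm _); apply: sin_ge_half => //; lra.
have sy : `|y| / 2 <= `|sh| by rewrite shE; have := expR_sub_ge ne; rewrite -/e; lra.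
have zl : absc z / 2 <= absc (csin z).
  rewrite -(@ler_pXn2r _ 2) ?nnegrE ?divr_ge0 ?absc_ge0// A exprMn absc_sqr -/x -/y.
  rewrite -(real_normK (num_real x)) -(real_normK (num_real y)).
  rewrite -(real_normK (num_real (sin x))) -(real_normK (num_real sh)).
  have := normr_ge0 x; nra.
have h2 : Num.min 1 (absc z) <= absc z by rewrite ge_min lexx orbT.
have h3 : 0 <= Num.min 1 (absc z) by rewrite le_min ler01 absc_ge0.
nra.
Qed.

Lemma csinDpi z : csin (z + (pi : R)%:C) = - csin z.
Proof.
by rewrite csinD ccos_real csin_real cospi sinpi rmorphN1 mulr0 addr0 mulrN1.
Qed.

Lemma absc_csin_shift z (m : int) : absc (csin (z + (pi : R)%:C * m%:~R)) = absc (csin z).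
Proof.
have H (n : nat) w : absc (csin (w + (pi : R)%:C * n%:R)) = absc (csin w).
  elim: n w => [|n IH] w; first by rewrite mulr0 addr0.
  by rewrite -[n.+1]addn1 natrD mulrDr mulr1 addrA csinDpi abscN IH.
case: m => n; first exact: H.
rewrite NegzE mulrNz -pmulrn; have := H n.+1 (z + (pi : R)%:C * - n.+1%:R).
by rewrite -addrA -mulrDr addNr mulr0 addr0.
Qed.

Lemma csin_lb z : exists m : int,
  1 / 4 * Num.min 1 (absc (z - (pi : R)%:C * m%:~R)) * expR `|complex.Im z| <= absc (csin z).
Proof.
have pi0 := @pi_gt0 R.
(* The multiple of pi nearest to the real part; subtracting it leads into the strip. *)
pose m : int := Num.floor (complex.Re z / pi + 1 / 2).
exists m; rewrite -(absc_csin_shift z (- m)) rmorphN /= mulrN.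
have mC : (m%:~R : R[i]) = (m%:~R : R)%:C by rewrite rmorph_int.
have ReE : complex.Re (z - (pi : R)%:C * m%:~R) = complex.Re z - pi * m%:~R.
  by rewrite ReD ReN mC ReM /= mul0r subr0.
have ImE : complex.Im (z - (pi : R)%:C * m%:~R) = complex.Im z.
  by rewrite ImD ImN mC ImM /= mul0r mulr0 addr0 subr0.
rewrite -ImE; apply: csin_lb_strip; rewrite ReE.
have /andP[h1 h2] := @real_floor_itv R (complex.Re z / pi + 1 / 2) (num_real _).
rewrite -/m in h1 h2; rewrite intrD in h2.
have E : complex.Re z = pi * (complex.Re z / pi) by rewrite mulrC divfK// gt_eqF.
have h3 : pi * (m%:~R : R) <= pi * (complex.Re z / pi + 1 / 2) by rewrite ler_pM2l.
have h4 : pi * (complex.Re z / pi + 1 / 2) < pi * ((m%:~R : R) + 1) by rewrite ltr_pM2l.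
rewrite mulrDr -E in h3 h4; rewrite mulrDr in h4.
by rewrite ler_norml; apply/andP; split; lra.
Qed.

End SineLowerBound.
(** * Complex integrals *)

Section ComplexIntegral.
Context {R : realType}.
Local Open Scope classical_set_scope.
Local Notation mu := (@lebesgue_measure R).
Implicit Types (D : set (measurableTypeR R)) (f g k : R -> R[i]) (z : R[i]) (M t u v w : R).

Definition cintegrable D f : Prop :=
  mu.-integrable D (fun t => (complex.Re (f t))%:E) /\
  mu.-integrable D (fun t => (complex.Im (f t))%:E).

Definition cmeasurable D f :=
  measurable_fun D (fun t => complex.Re (f t)) /\
  measurable_fun D (fun t => complex.Im (f t)).

(** Its integral splits into those of the real and imaginary parts. It is at most twice the modulus,
    which is the origin of the factor 2 in [int_nrm1M]. *)
Definition nrm1 z : R := `|complex.Re z| + `|complex.Im z|.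

Definition int_nrm1 D f : R := \int[mu]_(t in D) nrm1 (f t).

Lemma nrm1_ge0 z : 0 <= nrm1 z.
Proof. by rewrite addr_ge0. Qed.

Lemma nrm1_le z : nrm1 z <= 2 * absc z.
Proof. by rewrite /nrm1; have := absc_Re z; have := absc_Im z; lra. Qed.

Lemma nrm1M (z w : R[i]) : nrm1 (z * w) <= nrm1 z * nrm1 w.
Proof.
rewrite /nrm1 ReM ImM.
have := ler_normB (complex.Re z * complex.Re w) (complex.Im z * complex.Im w).
have := ler_normD (complex.Re z * complex.Im w) (complex.Im z * complex.Re w).
rewrite !normrM; lra.
Qed.

Lemma eq_cintegrable D f g : measurable D -> (forall t, D t -> f t = g t) ->
  cintegrable D f -> cintegrable D g.
Proof.
move=> mD fg [h1 h2]; split; [apply: eq_integrable h1|apply: eq_integrable h2] => // t /set_mem /fg ->//.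
Qed.

Lemma eq_cintegral D f g : (forall t, D t -> f t = g t) -> cintegral D f = cintegral D g.
Proof.
move=> fg; rewrite /cintegral; congr (_ +i* _); apply: eq_Rintegral => t /set_mem /fg -> //.
Qed.

Lemma cintegrableS D D' f : measurable D -> measurable D' -> D' `<=` D ->
  cintegrable D f -> cintegrable D' f.
Proof. by move=> mD mD' DD [h1 h2]; split; [apply: integrableS h1|apply: integrableS h2]. Qed.

Lemma cintegrableD D f g : measurable D -> cintegrable D f -> cintegrable D g ->
  cintegrable D (fun t => f t + g t).
Proof.
move=> mD [f1 f2] [g1 g2]; split.
  by apply: eq_integrable (integrableD mD f1 g1) => // t _; rewrite ReD.
by apply: eq_integrable (integrableD mD f2 g2) => // t _; rewrite ImD.
Qed.

Lemma cintegralD D f g : measurable D -> cintegrable D f -> cintegrable D g ->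
  cintegral D (fun t => f t + g t) = cintegral D f + cintegral D g.
Proof.
move=> mD [f1 f2] [g1 g2]; apply: ReImP; rewrite ?ReD ?ImD /=.
  rewrite -RintegralD//; apply: eq_Rintegral => t _; exact: ReD.
rewrite -RintegralD//; apply: eq_Rintegral => t _; exact: ImD.
Qed.

Lemma cmeasurable_cst D z : cmeasurable D (fun=> z).
Proof. by split; exact: measurable_cst. Qed.

Lemma cmeasurableM D f g : cmeasurable D f -> cmeasurable D g ->
  cmeasurable D (fun t => f t * g t).
Proof.
move=> [f1 f2] [g1 g2]; split.
  rewrite (_ : (fun t => _) = (fun t => complex.Re (f t)) \* (fun t => complex.Re (g t))
    \- (fun t => complex.Im (f t)) \* (fun t => complex.Im (g t))).
    by apply: measurable_funB; apply: measurable_funM.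
  by apply/funext => t; rewrite ReM.
rewrite (_ : (fun t => _) = (fun t => complex.Re (f t)) \* (fun t => complex.Im (g t))
    \+ (fun t => complex.Im (f t)) \* (fun t => complex.Re (g t))).
  by apply: measurable_funD; apply: measurable_funM.
by apply/funext => t; rewrite ImM.
Qed.

Lemma cmeasurableD D f g : cmeasurable D f -> cmeasurable D g ->
  cmeasurable D (fun t => f t + g t).
Proof.
move=> [f1 f2] [g1 g2]; split.
  rewrite (_ : (fun t => _) = (fun t => complex.Re (f t)) \+ (fun t => complex.Re (g t))).
    exact: measurable_funD.
  by apply/funext => t; rewrite ReD.
rewrite (_ : (fun t => _) = (fun t => complex.Im (f t)) \+ (fun t => complex.Im (g t))).
  exact: measurable_funD.
by apply/funext => t; rewrite ImD.
Qed.

Lemma cmeasurableS D D' f : measurable D -> D' `<=` D -> cmeasurable D f -> cmeasurable D' f.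
Proof. by move=> mD DD [f1 f2]; split; [apply: measurable_funS f1 | apply: measurable_funS f2]. Qed.

Lemma ccontinuous_measurable D f : measurable D -> ccontinuous f -> cmeasurable D f.
Proof.
move=> mD [f1 f2]; split; apply: measurable_funTS; exact: continuous_measurable_fun.
Qed.

Lemma cintegrable_measurable D f : cintegrable D f -> cmeasurable D f.
Proof. by move=> [/measurable_int f1 /measurable_int f2]; split; apply/measurable_EFinP. Qed.

Let integrable_mul_bounded D (f h : R -> R) M : measurable D ->
  mu.-integrable D (EFin \o f) -> measurable_fun D h -> (forall t, D t -> `|h t| <= M) ->
  mu.-integrable D (fun t => (f t * h t)%:E).
Proof.
move=> mD fi mh hM; have hb : [bounded h x | x in D].
  exists M; split; first exact: num_real.
  by move=> N MN t /hM h1; apply: le_trans h1 (ltW MN).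
by have := integrableMl mD fi mh hb; apply: eq_integrable.
Qed.

Lemma cintegrableM D f k M : measurable D -> cintegrable D f -> cmeasurable D k ->
  (forall t, D t -> absc (k t) <= M) -> cintegrable D (fun t => f t * k t).
Proof.
move=> mD [f1 f2] [k1 k2] kM.
have kR t : D t -> `|complex.Re (k t)| <= M by move=> /kM; apply: le_trans (absc_Re _).
have kI t : D t -> `|complex.Im (k t)| <= M by move=> /kM; apply: le_trans (absc_Im _).
split.
  have := integrableB mD (integrable_mul_bounded mD f1 k1 kR) (integrable_mul_bounded mD f2 k2 kI).
  by apply: eq_integrable => // t _; rewrite ReM EFinB.
have := integrableD mD (integrable_mul_bounded mD f1 k2 kI) (integrable_mul_bounded mD f2 k1 kR).
by apply: eq_integrable => // t _; rewrite ImM EFinD.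
Qed.

Lemma cintegrableZ D z f : measurable D -> cintegrable D f -> cintegrable D (fun t => z * f t).
Proof.
move=> mD fi; have := @cintegrableM D f (fun=> z) (absc z) mD fi (cmeasurable_cst D z).
move=> /(_ (fun _ _ => lexx _)); apply: eq_cintegrable => // t _; exact: mulrC.
Qed.

Lemma cintegralZ D z f : measurable D -> cintegrable D f ->
  cintegral D (fun t => z * f t) = z * cintegral D f.
Proof.
move=> mD [f1 f2].
have i1 c : mu.-integrable D (fun t => (c * complex.Re (f t))%:E).
  by apply: eq_integrable (integrableZl mD c f1) => // t _; rewrite EFinM.
have i2 c : mu.-integrable D (fun t => (c * complex.Im (f t))%:E).
  by apply: eq_integrable (integrableZl mD c f2) => // t _; rewrite EFinM.
apply: ReImP; rewrite ?ReM ?ImM /= -!RintegralZl//.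
  rewrite -(RintegralB mD (i1 _) (i2 _)); apply: eq_Rintegral => t _; exact: ReM.
rewrite -(RintegralD mD (i2 _) (i1 _)); apply: eq_Rintegral => t _; exact: ImM.
Qed.

Lemma cintegrableB D f g : measurable D -> cintegrable D f -> cintegrable D g ->
  cintegrable D (fun t => f t - g t).
Proof.
move=> mD hf hg; have := cintegrableD mD hf (cintegrableZ (-1) mD hg).
by apply: eq_cintegrable => // t _; rewrite mulN1r.
Qed.

Lemma cintegralB D f g : measurable D -> cintegrable D f -> cintegrable D g ->
  cintegral D (fun t => f t - g t) = cintegral D f - cintegral D g.
Proof.
move=> mD hf hg; rewrite -mulN1r -cintegralZ// -cintegralD//; last exact: cintegrableZ.
by apply: eq_cintegral => t _; rewrite mulN1r.
Qed.

Lemma cintegral0 D : cintegral D (fun=> 0) = 0.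
Proof. by rewrite /cintegral /Rintegral !integral0. Qed.

Lemma cintegrable0 D : measurable D -> cintegrable D (fun=> 0).
Proof. by move=> mD; split; exact: integrable0. Qed.

Lemma cintegral_sum D (I : Type) (s : seq I) (F : I -> R -> R[i]) : measurable D ->
  (forall i, cintegrable D (F i)) ->
  cintegrable D (fun t => \sum_(i <- s) F i t) /\
  cintegral D (fun t => \sum_(i <- s) F i t) = \sum_(i <- s) cintegral D (F i).
Proof.
move=> mD hF; elim: s => [|i s [IH1 IH2]].
  split.
    by apply: eq_cintegrable (cintegrable0 mD) => // t _; rewrite big_nil.
  by rewrite big_nil -[RHS](cintegral0 D); apply: eq_cintegral => t _; rewrite big_nil.
split.
  by apply: eq_cintegrable (cintegrableD mD (hF i) IH1) => // t _; rewrite big_cons.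
rewrite big_cons -IH2 -cintegralD//; apply: eq_cintegral => t _; exact: big_cons.
Qed.

Lemma integrable_nrm1 D f : measurable D -> cintegrable D f ->
  mu.-integrable D (fun t => (nrm1 (f t))%:E).
Proof.
move=> mD [f1 f2]; have := integrableD mD (integrable_norm f1) (integrable_norm f2).
by apply: eq_integrable => // t _; rewrite /nrm1 EFinD.
Qed.

Lemma int_nrm1_ge0 D f : 0 <= int_nrm1 D f.
Proof. by apply: Rintegral_ge0 => t _; exact: nrm1_ge0. Qed.

Lemma absc_cintegral_le D f : measurable D -> cintegrable D f ->
  absc (cintegral D f) <= int_nrm1 D f.
Proof.
move=> mD [f1 f2]; apply: le_trans (absc_le_ReIm _) _ => /=.
rewrite /int_nrm1 RintegralD//; try exact: integrable_norm.
by apply: lerD; exact: le_normr_Rintegral.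
Qed.

Lemma int_nrm1M D f k M : measurable D -> cintegrable D f -> cmeasurable D k ->
  (forall t, D t -> absc (k t) <= M) ->
  absc (cintegral D (fun t => f t * k t)) <= 2 * M * int_nrm1 D f.
Proof.
move=> mD fi mk kM; apply: le_trans (absc_cintegral_le mD (cintegrableM mD fi mk kM)) _.
rewrite /int_nrm1 -RintegralZl//; last exact: integrable_nrm1.
apply: le_Rintegral => //.
- exact: integrable_nrm1 (cintegrableM mD fi mk kM).
- have := integrableZl mD (2 * M) (integrable_nrm1 mD fi).
  by apply: eq_integrable => // t _; rewrite -EFinM.
- move=> t /kM h; apply: le_trans (nrm1M _ _) _; rewrite mulrC ler_wpM2r ?nrm1_ge0//.
  by apply: le_trans (nrm1_le _) _; rewrite ler_pM2l.
Qed.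

Lemma cintegral_ae D f g : measurable D -> cintegrable D f -> cintegrable D g ->
  {ae mu, forall t, D t -> f t = g t} -> cintegral D f = cintegral D g.
Proof.
move=> mD [f1 f2] [g1 g2] fg; rewrite /cintegral /Rintegral; congr (fine _ +i* fine _).
  apply: ae_eq_integral => //; [exact: measurable_int f1|exact: measurable_int g1|].
  by move: fg; apply: (@filterS _ _ (ae_filter_ringOfSetsType mu)) => t h Dt /=; rewrite h.
apply: ae_eq_integral => //; [exact: measurable_int f2|exact: measurable_int g2|].
by move: fg; apply: (@filterS _ _ (ae_filter_ringOfSetsType mu)) => t h Dt /=; rewrite h.
Qed.

Lemma cintegral_cat u v w f : u <= v -> v <= w -> cintegrable `]u, w] f ->
  cintegral `]u, w] f = cintegral `]u, v] f + cintegral `]v, w] f.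
Proof.
move=> uv vw [f1 f2].
have h (g : R -> R) : mu.-integrable `]u, w] (EFin \o g) ->
    \int[mu]_(t in `]u, w]) g t = \int[mu]_(t in `]u, v]) g t + \int[mu]_(t in `]v, w]) g t.
  by move=> gi; rewrite -(Rintegral_itvB gi (x := v))// addrC subrK.
by rewrite /cintegral (h _ f1) (h _ f2).
Qed.

Lemma cintegral_itv_cc_oc u v f : cintegrable `]u, v] f ->
  cintegral `[u, v] f = cintegral `]u, v] f.
Proof. by move=> [f1 f2]; rewrite /cintegral !Rintegral_itv_obnd_cbnd. Qed.

Lemma cintegral_itv_oc_oo u v f : cintegrable `]u, v] f ->
  cintegral `]u, v] f = cintegral `]u, v[ f.
Proof.
move=> fi; have [f1 f2] : cintegrable `]u, v[ f.
  by apply: cintegrableS fi => //; exact: subset_itv_oo_oc.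
by rewrite /cintegral -!Rintegral_itv_bndo_bndc.
Qed.

Lemma int_nrm1_cat u v w f : u <= v -> v <= w -> cintegrable `]u, w] f ->
  int_nrm1 `]u, w] f = int_nrm1 `]u, v] f + int_nrm1 `]v, w] f.
Proof.
move=> uv vw fi; rewrite /int_nrm1.
have gi := integrable_nrm1 (measurable_itv _) fi.
by rewrite -(Rintegral_itvB gi (x := v))// addrC subrK.
Qed.

Lemma ccontinuous_bounded u v f : u <= v -> ccontinuous f ->
  exists2 M, 0 < M & forall t, u <= t <= v -> absc (f t) <= M.
Proof.
move=> uv [f1 f2].
have h (g : R -> R) : continuous g -> exists N, forall t, u <= t <= v -> `|g t| <= N.
  move=> cg; have cn : {within `[u, v], continuous (fun t => `|g t|)}.
    by apply: continuous_subspaceT => t; apply: cvg_norm; exact: cg.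
  have [c _ hc] := EVT_max uv cn; exists `|g c| => t tuv.
  by apply: hc; rewrite in_itv.
have [N1 h1] := h _ f1; have [N2 h2] := h _ f2.
exists (1 + `|N1| + `|N2|); first by have := normr_ge0 N1; have := normr_ge0 N2; lra.
move=> t tuv; apply: le_trans (absc_le_ReIm _) _.
by have := h1 t tuv; have := h2 t tuv; have := ler_norm N1; have := ler_norm N2; lra.
Qed.

Lemma cintegrable_cst u v z : cintegrable `]u, v] (fun=> z).
Proof.
have h (k : R) : mu.-integrable `]u, v] (fun=> k%:E).
  apply: (@integrableS _ _ _ mu `[u, v]) => //; first exact: subset_itv_oc_cc.
  apply: continuous_compact_integrable; first exact: segment_compact.
  by apply: continuous_subspaceT => ?; exact: cvg_cst.
by split; exact: h.
Qed.

Lemma int_nrm1_cst1 u v : u <= v -> int_nrm1 `]u, v] (fun=> 1) = v - u.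
Proof.
move=> uv; rewrite /int_nrm1 /nrm1 /= normr1 normr0 addr0 Rintegral_cst// mul1r.
rewrite /= lebesgue_measure_itv /=; case: ifP => //; rewrite lte_fin => /negbT.
by rewrite -leNgt => vu; rewrite (@le_anti _ _ u v) ?uv ?vu// subrr.
Qed.

Lemma cintegral_derive u v f f' : u <= v -> (forall t, is_cderive f t (f' t)) ->
  ccontinuous f' -> cintegral `]u, v] f' = f v - f u.
Proof.
rewrite le_eqVlt => /predU1P[<-|uv] df cf.
  by rewrite subrr /cintegral !set_itvoc0 !Rintegral_set0.
have h (g g' : R -> R) : (forall t, is_derive t 1 g (g' t)) -> continuous g' ->
    \int[mu]_(t in `]u, v]) g' t = g v - g u.
  move=> dg cg; have cg0 : continuous g.
    by move=> t; apply/differentiable_continuous/derivable1_diffP; apply: ex_derive; apply: dg.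
  have gi : mu.-integrable `[u, v] (EFin \o g').
    apply: continuous_compact_integrable; first exact: segment_compact.
    exact: continuous_subspaceT.
  rewrite Rintegral_itv_obnd_cbnd; last first.
    by apply: integrableS gi => //; exact: subset_itv_oc_cc.
  rewrite /Rintegral (@continuous_FTC2 _ g' g)//.
  - exact: continuous_subspaceT.
  - split; last 2 first.
    + by apply: cvg_at_right_filter; exact: cg0.
    + by apply: cvg_at_left_filter; exact: cg0.
    by move=> t _; apply: ex_derive; apply: dg.
  - by move=> t _; rewrite derive1E; apply: derive_val.
have [c1 c2] := cf; apply: ReImP; rewrite ?ReD ?ReN ?ImD ?ImN /=.
  by apply: (h (fun t => complex.Re (f t))) => // t; have [] := df t.
by apply: (h (fun t => complex.Im (f t))) => // t; have [] := df t.
Qed.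

End ComplexIntegral.

(** * Integration by parts for absolutely continuous functions *)

Section IntegrationByParts.
Context {R : realType}.
Local Open Scope classical_set_scope.
Local Notation mu := (@lebesgue_measure R).
Implicit Types (f F G phi : R -> R[i]) (s t u v x : R).

(** Over n equal subintervals the length factor is (v - u)/n throughout and the increments of [A]
    telescope; the total error is O(1/n). *)
Lemma constant_of_small_increments G (A : R -> R) (K : R) u v : 0 <= K -> u <= v ->
  (forall s t, u <= s -> s <= t -> t <= v -> absc (G t - G s) <= K * (t - s) * (A t - A s)) ->
  G v = G u.
Proof.
move=> K0 uv H; apply/subr0_eq/absc_le_eps => e e0.
pose N := Num.bound (`|K * (v - u) * (A v - A u)| / e); pose n := N.+1.
have n0 : 0 < n%:R :> R by rewrite ltr0n.
pose p i := u + (v - u) * (i%:R / n%:R).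
have pS i : (i < n)%N -> [/\ u <= p i, p i <= p i.+1, p i.+1 <= v & p i.+1 - p i = (v - u) / n%:R].
  move=> i_n; have d0 : 0 <= (v - u) / n%:R by rewrite divr_ge0 ?subr_ge0// ltW.
  have pe : p i.+1 - p i = (v - u) / n%:R.
    by rewrite /p -[i.+1]addn1 natrD; field; rewrite gt_eqF.
  split=> //.
  - by rewrite lerDl mulr_ge0 ?subr_ge0// divr_ge0.
  - by rewrite -subr_ge0 pe.
  - rewrite /p -lerBrDl ler_piMr ?subr_ge0// ler_pdivrMr// mul1r ler_nat//.
have main m : (m <= n)%N -> absc (G (p m) - G u) <= K * ((v - u) / n%:R) * (A (p m) - A u).
  elim: m => [_|m IH mn]; first by rewrite /p mul0r mulr0 addr0 !subrr absc0 mulr0.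
  have [h1 h2 h3 h4] := pS m mn; have := IH (ltnW mn); have := H _ _ h1 h2 h3.
  rewrite h4; have := absc_tri (G (p m.+1)) (G u) (G (p m)); lra.
have pn : p n = v by rewrite /p divff ?gt_eqF// mulr1 addrC subrK.
have := main n (leqnn _); rewrite pn => h; apply: le_trans h _.
have -> : K * ((v - u) / n%:R) * (A v - A u) = K * (v - u) * (A v - A u) / n%:R by ring.
apply: le_trans (_ : `|K * (v - u) * (A v - A u)| / n%:R <= _).
  by rewrite ler_pM2r ?invr_gt0// ler_norm.
rewrite ler_pdivrMr// [e * _]mulrC -ler_pdivrMr//.
have h0 : 0 <= `|K * (v - u) * (A v - A u)| / e by rewrite divr_ge0// ltW.
by apply: le_trans (ltW (archi_boundP h0)) _; rewrite ler_nat.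
Qed.

Let m01 : measurable (`[0, 1] : set (measurableTypeR R)).
Proof. exact: measurable_itv. Qed.

Let sub01 u v : 0 <= u -> v <= 1 -> `]u, v] `<=` `[0, 1 : R].
Proof.
by move=> u0 v1 t /=; rewrite !in_itv /= => /andP[h1 h2]; apply/andP; split; lra.
Qed.

Lemma cintegrable_sub u v f : 0 <= u -> v <= 1 -> cintegrable `[0, 1] f -> cintegrable `]u, v] f.
Proof. by move=> u0 v1; apply: cintegrableS => //; exact: sub01. Qed.

Definition primitive_on f F := forall x, 0 <= x <= 1 -> F x = F 0 + cintegral `[0, x] f.

Lemma primitiveB f F u v : cintegrable `[0, 1] f -> primitive_on f F ->
  0 <= u -> u <= v -> v <= 1 -> F v - F u = cintegral `]u, v] f.
Proof.
move=> fi FE u0 uv v1.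
have hv : 0 <= v <= 1 by apply/andP; split; lra.
have hu : 0 <= u <= 1 by apply/andP; split; lra.
rewrite FE// [F u]FE// !cintegral_itv_cc_oc; last 2 first.
- by apply: cintegrable_sub => //; lra.
- by apply: cintegrable_sub => //; lra.
by rewrite (cintegral_cat u0 uv); [ring|apply: cintegrable_sub => //; lra].
Qed.

Lemma primitive_cmeasurable f F : cintegrable `[0, 1] f -> primitive_on f F ->
  cmeasurable `[0, 1] F.
Proof.
move=> [f1 f2] FE.
have h (g : R -> R) c : mu.-integrable `[0, 1] (EFin \o g) ->
    measurable_fun (`[0, 1] : set (measurableTypeR R)) (fun x => c + \int[mu]_(t in `[0, x]) g t).
  move=> gi; apply: measurable_funD; first exact: measurable_cst.
  by apply: subspace_continuous_measurable_fun => //; apply: parameterized_integral_continuous.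
split.
  apply: eq_measurable_fun (h _ (complex.Re (F 0)) f1) => x /set_mem /=.
  by rewrite in_itv /= => x01; rewrite (FE x x01) ReD.
apply: eq_measurable_fun (h _ (complex.Im (F 0)) f2) => x /set_mem /=.
by rewrite in_itv /= => x01; rewrite (FE x x01) ImD.
Qed.

Lemma primitive_bounded f F : cintegrable `[0, 1] f -> primitive_on f F ->
  forall x, 0 <= x <= 1 -> absc (F x) <= absc (F 0) + int_nrm1 `]0, 1] f.
Proof.
move=> fi FE x x01; have /andP[x0 x1] := x01.
rewrite FE//; apply: le_trans (abscD _ _) _; rewrite lerD2l.
rewrite cintegral_itv_cc_oc; last exact: cintegrable_sub.
apply: le_trans (absc_cintegral_le _ _) _ => //; first exact: cintegrable_sub.
rewrite (int_nrm1_cat x0 x1); last exact: cintegrable_sub.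
by rewrite lerDl int_nrm1_ge0.
Qed.

Lemma is_cderive_continuous phi phi' : (forall t, is_cderive phi t (phi' t)) -> ccontinuous phi.
Proof.
move=> d; split=> t; have [d1 d2] := d t.
  by apply/differentiable_continuous/derivable1_diffP; apply: ex_derive; exact: d1.
by apply/differentiable_continuous/derivable1_diffP; apply: ex_derive; exact: d2.
Qed.

(* Over a short interval the two sides differ by at most a constant times the
   length times the variation of [F], and such errors vanish under subdivision. *)
Lemma cintegral_by_parts f F phi phi' u v : cintegrable `[0, 1] f -> primitive_on f F ->
  (forall t, is_cderive phi t (phi' t)) -> ccontinuous phi' ->
  0 <= u -> u <= v -> v <= 1 ->
  cintegrable `]u, v] (fun t => f t * phi t + F t * phi' t) /\
  cintegral `]u, v] (fun t => f t * phi t + F t * phi' t) = F v * phi v - F u * phi u.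
Proof.
move=> fi FE dphi cphi'.
have cphi := is_cderive_continuous dphi.
have [M M0 hM] := ccontinuous_bounded ler01 cphi'.
have [M1 M10 hM1] := ccontinuous_bounded ler01 cphi.
have mF := primitive_cmeasurable fi FE.
have bF := primitive_bounded fi FE.
have m0 s t : measurable (`]s, t] : set (measurableTypeR R)) by exact: measurable_itv.
have in01 s t x : 0 <= s -> t <= 1 -> `]s, t] x -> 0 <= x <= 1.
  by move=> s0 t1 /(sub01 s0 t1) /=; rewrite in_itv.
have mphi s t : cmeasurable `]s, t] phi by exact: ccontinuous_measurable.
have mphi' s t : cmeasurable `]s, t] phi' by exact: ccontinuous_measurable.
have i1 s t : 0 <= s -> t <= 1 -> cintegrable `]s, t] (fun x => f x * phi x).
  move=> s0 t1; apply: (cintegrableM (M := M1)) => //; first exact: cintegrable_sub.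
  by move=> x /(in01 _ _ _ s0 t1); apply: hM1.
have mFs s t : 0 <= s -> t <= 1 -> cmeasurable `]s, t] F.
  by move=> s0 t1; apply: cmeasurableS mF => //; exact: sub01.
have i2 s t z : 0 <= s -> t <= 1 -> cintegrable `]s, t] (fun x => 1 * ((z - F x) * phi' x)).
  move=> s0 t1; apply: (cintegrableM (M := (absc z + (absc (F 0) + int_nrm1 `]0, 1] f)) * M)) => //.
  - exact: cintegrable_cst.
  - apply: cmeasurableM => //; apply: cmeasurableD; first exact: cmeasurable_cst.
    have -> : (fun x => - F x) = (fun x => -1 * F x) by apply/funext => x; rewrite mulN1r.
    by apply: cmeasurableM; [exact: cmeasurable_cst|exact: mFs].
  - move=> x /(in01 _ _ _ s0 t1) x01; rewrite abscM; apply: ler_pM; rewrite ?absc_ge0 ?hM//.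
    by apply: le_trans (abscB _ _) _; rewrite lerD2l bF.
have i3 s t : 0 <= s -> t <= 1 -> cintegrable `]s, t] (fun x => F x * phi' x).
  move=> s0 t1; have := cintegrableZ (-1) (m0 s t) (i2 s t 0 s0 t1).
  by apply: eq_cintegrable => // x _; rewrite sub0r mul1r mulN1r mulNr opprK.
have i4 s t : 0 <= s -> t <= 1 -> cintegrable `]s, t] (fun x => f x * phi x + F x * phi' x).
  by move=> s0 t1; apply: cintegrableD; auto.
pose H s t := cintegral `]s, t] (fun x => f x * phi x + F x * phi' x).
move=> u0 uv v1; split; first exact: i4.
(* The defect of the formula as a function of the upper limit; it has to be constant. *)
pose G x := F x * phi x - H 0 x.
suff E : G v = G u.
  have HH : H 0 v = H 0 u + H u v by apply: cintegral_cat => //; apply: i4.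
  have : F v * phi v - F u * phi u = H 0 v - H 0 u.
    by move: E; rewrite /G => E; rewrite -[F v * _](subrK (H 0 v)) E; ring.
  by rewrite HH => ->; rewrite /H; ring.
(* The 6 is 4 from the increments of [phi], bounded in [B1], plus 2 from those of [F], bounded in
   [B2]. *)
apply: (@constant_of_small_increments G (fun x => int_nrm1 `]0, x] f) (6 * M)) => //.
  by rewrite mulr_ge0// ltW.
move=> s t us st tv; have s0 : 0 <= s by lra.
have t1 : t <= 1 by lra.
have s1 : s <= 1 by lra.
have A_E : int_nrm1 `]0, t] f - int_nrm1 `]0, s] f = int_nrm1 `]s, t] f.
  rewrite (int_nrm1_cat s0 st); last exact: cintegrable_sub.
  by rewrite addrC addKr.
rewrite A_E; set V := int_nrm1 `]s, t] f; have V0 : 0 <= V by exact: int_nrm1_ge0.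
have fst' : cintegrable `]s, t] f by exact: cintegrable_sub.
have phiE x : s <= x -> x <= t -> absc (phi t - phi x) <= 2 * M * (t - s).
  move=> sx xt; rewrite -(cintegral_derive xt dphi cphi').
  have -> : cintegral `]x, t] phi' = cintegral `]x, t] (fun y => 1 * phi' y).
    by apply: eq_cintegral => y _; rewrite mul1r.
  apply: le_trans (@int_nrm1M _ _ _ _ M (m0 x t) (cintegrable_cst _ _ _) (mphi' x t) _) _.
    by move=> y /(in01 _ _ _ (le_trans s0 sx) t1); apply: hM.
  by rewrite int_nrm1_cst1// ler_pM2l ?mulr_gt0//; lra.
have FEx x : s <= x -> x <= t -> absc (F s - F x) <= V.
  move=> sx xt; rewrite absc_subC (primitiveB fi FE s0 sx); last lra.
  apply: le_trans (absc_cintegral_le (m0 s x) _) _; first by apply: cintegrable_sub => //; lra.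
  by rewrite /V (int_nrm1_cat sx xt)// lerDl int_nrm1_ge0.
have itvP x : `]s, t] x -> s <= x /\ x <= t.
  by rewrite /= in_itv /= => /andP[/ltW].
have mphit : cmeasurable `]s, t] (fun x => phi t - phi x).
  apply: cmeasurableD; first exact: cmeasurable_cst.
  have -> : (fun x => - phi x) = (fun x => -1 * phi x) by apply/funext => x; rewrite mulN1r.
  by apply: cmeasurableM; [exact: cmeasurable_cst|exact: mphi].
have B1 : absc (cintegral `]s, t] (fun x => f x * (phi t - phi x))) <= 2 * (2 * M * (t - s)) * V.
  by apply: int_nrm1M => // x /itvP[h1 h2]; apply: phiE.
have B2 : absc (cintegral `]s, t] (fun x => 1 * ((F s - F x) * phi' x))) <= 2 * (V * M) * (t - s).
  rewrite -(int_nrm1_cst1 st); apply: int_nrm1M => //; first exact: cintegrable_cst.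
    apply: cmeasurableM => //; apply: cmeasurableD; first exact: cmeasurable_cst.
    have -> : (fun x => - F x) = (fun x => -1 * F x) by apply/funext => x; rewrite mulN1r.
    by apply: cmeasurableM; [exact: cmeasurable_cst|exact: mFs].
  move=> x xst; have [h1 h2] := itvP x xst; rewrite abscM.
  by apply: ler_pM; rewrite ?absc_ge0 ?FEx// hM// (in01 s t).
have j1 : cintegrable `]s, t] (fun x => f x * (phi t - phi x)).
  by apply: (cintegrableM (M := 2 * M * (t - s))) => // x /itvP[h1 h2]; apply: phiE.
(* The boundary term is split as phi(t) (F(t) - F(s)) + F(s) (phi(t) - phi(s)), so each integrand
   contains an increment over ]s, t] as a small factor. *)
have E : G t - G s = cintegral `]s, t] (fun x => f x * (phi t - phi x)) +
    cintegral `]s, t] (fun x => 1 * ((F s - F x) * phi' x)).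
  have HH : H 0 t = H 0 s + H s t by apply: cintegral_cat => //; apply: i4.
  have -> : G t - G s = phi t * (F t - F s) + F s * (phi t - phi s) - H s t.
    by rewrite /G HH; ring.
  rewrite (primitiveB fi FE s0 st t1) -(cintegral_derive st dphi cphi').
  have ip' : cintegrable `]s, t] phi'.
    have := @cintegrableM _ _ (fun=> 1) phi' M (m0 s t) (cintegrable_cst s t 1) (mphi' s t).
    move=> /(_ _)[x /(in01 _ _ _ s0 t1)|a b]; first exact: hM.
    have : cintegrable `]s, t] (fun t => 1 * phi' t) by split.
    by apply: eq_cintegrable => // x _; rewrite mul1r.
  rewrite -!cintegralZ// -!cintegralD//; try exact: cintegrableZ; try exact: i2.
  rewrite -cintegralB//; last 2 first.
  - by apply: cintegrableD => //; exact: cintegrableZ.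
  - exact: i4.
  by apply: eq_cintegral => x _; ring.
rewrite E; apply: le_trans (abscD _ _) _; lra.
Qed.

End IntegrationByParts.

(** * Square-integrable functions *)

Section SquareIntegrable.
Context {R : realType}.
Local Open Scope classical_set_scope.
Local Notation mu := (@lebesgue_measure R).
Implicit Types (f q : R -> R[i]) (x : R).

Lemma L2_sqr_integrable f : L2_01 f ->
  cmeasurable `]0, 1[ f /\ mu.-integrable `]0, 1[ (fun t => (absc (f t) ^+ 2)%:E).
Proof.
move=> [m1 m2 fin]; have mf : cmeasurable `]0, 1[ f by split; [exact: m1|exact: m2].
split=> //; apply/integrableP; split.
  apply/measurable_EFinP.
  rewrite (_ : (fun t => _) = (fun t => complex.Re (f t) ^+ 2) \+ (fun t => complex.Im (f t) ^+ 2)).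
    by case: mf => f1 f2; apply: measurable_funD; apply: measurable_funX.
  by apply/funext => t /=; rewrite absc_sqr.
rewrite (_ : (fun t => _) = (fun t => (absc (f t) ^+ 2)%:E))//.
by apply/funext => t /=; rewrite ger0_norm ?sqr_ge0.
Qed.

(** On the open interval |f| <= 1 + |f|^2. The endpoints, where the values of a representative are
    arbitrary, form a null set. *)
Lemma L2_cintegrable f : L2_01 f -> cintegrable `[0, 1] f.
Proof.
move=> /L2_sqr_integrable[[m1 m2] fi].
have h (g : R -> R) : measurable_fun (`]0, 1[ : set (measurableTypeR R)) g ->
    (forall t, `|g t| <= absc (f t)) -> mu.-integrable `[0, 1] (fun t => (g t)%:E).
  move=> mg gf.
  have i1 : mu.-integrable `]0, 1[ (fun=> 1%:E).
    apply: (@integrableS _ _ _ mu `[0, 1]) => //; first exact: subset_itv_oo_cc.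
    apply: continuous_compact_integrable; first exact: segment_compact.
    by apply: continuous_subspaceT => ?; exact: cvg_cst.
  have gi : mu.-integrable `]0, 1[ (fun t => (g t)%:E).
    apply: le_integrable (integrableD _ i1 fi) => //; first exact/measurable_EFinP.
    move=> t _; rewrite /= lee_fin [X in _ <= X]ger0_norm; last by rewrite addr_ge0 ?sqr_ge0.
    by have := gf t; have := sqr_ge0 (absc (f t) - 1); nra.
  have mg' : measurable_fun (`[0, 1] : set (measurableTypeR R)) g.
    exact: (measurable_fun_itv_cc (b0 := false) (b1 := true)).
  have mN : measurable ([set 0; 1] : set (measurableTypeR R)) by apply: measurableU; exact: measurable_set1.
  have N0 : mu [set 0; 1] = 0%E.
    rewrite measureU0; [exact: lebesgue_measure_set1|exact: measurable_set1|
      exact: measurable_set1|exact: lebesgue_measure_set1].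
  have mE : measurable_fun (`[0, 1] : set (measurableTypeR R)) (fun t => (g t)%:E).
    exact/measurable_EFinP.
  have [_ NI] := @negligible_integrable _ _ _ mu `[0, 1] [set 0; 1] _ mN (measurable_itv _) mE N0.
  apply: NI.
  rewrite (_ : `[0, 1] `\` _ = `]0, 1[)//; apply/seteqP; split => t /=.
    rewrite !in_itv /= => -[/andP[t0 t1] /not_orP[/eqP n0 /eqP n1]].
    by rewrite !lt_neqAle t0 t1 n1 eq_sym n0.
  rewrite !in_itv /= => /andP[t0 t1]; split; first by rewrite !ltW.
  by case=> e; rewrite e ltxx in t0 t1.
split; apply: h => //.
  by move=> t; exact: absc_Re.
by move=> t; exact: absc_Im.
Qed.

End SquareIntegrable.

(** * The characteristic function *)

Section SolutionFormulas.
Context {R : realType}.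
Local Open Scope classical_set_scope.
Local Notation mu := (@lebesgue_measure R).
Implicit Types (f y q : R -> R[i]) (x t u v a : R) (z : R[i]).

Lemma ccontinuous_coslB x z : ccontinuous (fun t => cosl (x - t) z).
Proof. exact: is_cderive_continuous (is_cderive_cosl x z). Qed.

Lemma ccontinuous_sinlB x z : ccontinuous (fun t => sinl (x - t) z).
Proof. exact: is_cderive_continuous (is_cderive_sinl x z). Qed.

Lemma ccontinuousZ z f : ccontinuous f -> ccontinuous (fun t => z * f t).
Proof. by apply: ccontinuousM; exact: ccontinuous_cst. Qed.

Lemma cintegrable_mul_continuous q k u v : 0 <= u -> u <= v -> v <= 1 ->
  cintegrable `[0, 1] q -> ccontinuous k -> cintegrable `]u, v] (fun t => q t * k t).
Proof.
move=> u0 uv v1 qi ck; have [M M0 hM] := ccontinuous_bounded uv ck.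
apply: (cintegrableM (M := M)) => //.
- exact: cintegrable_sub.
- exact: ccontinuous_measurable.
- by move=> t /=; rewrite in_itv /= => /andP[h1 h2]; apply: hM; rewrite h2 ltW.
Qed.

Variables (q : R -> R[i]) (a : R) (z : R[i]) (y y1 : R -> R[i]).
Hypotheses (qL : L2_01 q) (sol : is_solution q a z y y1).

Let qi : cintegrable `[0, 1] q := L2_cintegrable qL.

(** Lagrange's identity. The hypotheses say psi = - phi' wherever y1 is nonzero and psi' = z phi, so
    in the sum of the two integrations by parts the terms with [y1] cancel and the equation turns y2
    + z y into q y(a). *)
Let key y2 phi phi' psi psi' u v : W22 y y1 y2 ->
  {ae mu, forall t : R, 0 < t < 1 -> - y2 t + q t * y a = z * y t} ->
  (forall t, is_cderive phi t (phi' t)) -> (forall t, is_cderive psi t (psi' t)) ->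
  ccontinuous phi' -> ccontinuous psi' ->
  (forall t, y1 t * phi' t + y1 t * psi t = 0) -> (forall t, psi' t = z * phi t) ->
  0 <= u -> u <= v -> v <= 1 ->
  (y1 v * phi v + y v * psi v) - (y1 u * phi u + y u * psi u) =
  y a * cintegral `]u, v[ (fun t => q t * phi t).
Proof.
move=> [y2L P1 P2] eq dphi dpsi cphi' cpsi' e1 e2 u0 uv v1.
have i2 := L2_cintegrable y2L.
have i1 : cintegrable `[0, 1] y1.
  have b1 := primitive_bounded i2 P1.
  have := @cintegrableM _ `[0, 1] (fun=> 1) y1 _ (measurable_itv _) _ (primitive_cmeasurable i2 P1) b1.
  have : cintegrable `[0, 1] (fun=> 1 : R[i]).
    have h (k : R) : mu.-integrable `[0, 1] (fun=> k%:E).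
      apply: continuous_compact_integrable; first exact: segment_compact.
      by apply: continuous_subspaceT => ?; exact: cvg_cst.
    by split; exact: h.
  move=> /[swap] /[apply]; apply: eq_cintegrable => // t _; exact: mul1r.
have [j1 E1] := cintegral_by_parts i2 P1 dphi cphi' u0 uv v1.
have [j2 E2] := cintegral_by_parts i1 P2 dpsi cpsi' u0 uv v1.
have -> : (y1 v * phi v + y v * psi v) - (y1 u * phi u + y u * psi u) =
  (y1 v * phi v - y1 u * phi u) + (y v * psi v - y u * psi u) by ring.
have cphi := is_cderive_continuous dphi.
have iq : cintegrable `]u, v] (fun t => q t * phi t) by exact: cintegrable_mul_continuous.
(* On the open interval every t satisfies 0 < t < 1, the range in which the equation is assumed
   almost everywhere. *)
rewrite -E1 -E2 -cintegralD// -(cintegral_itv_oc_oo iq) -cintegralZ//.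
rewrite cintegral_itv_oc_oo; last exact: cintegrableD.
rewrite cintegral_itv_oc_oo; last exact: cintegrableZ.
have s : `]u, v[ `<=` `]u, v] by exact: subset_itv_oo_oc.
apply: cintegral_ae => //.
- by apply: (@cintegrableS _ `]u, v]) => //; exact: cintegrableD.
- by apply: (@cintegrableS _ `]u, v]) => //; exact: cintegrableZ.
move: eq; apply: (@filterS _ _ (ae_filter_ringOfSetsType mu)) => t h /=.
rewrite in_itv /= => /andP[ut tv].
have /h E : 0 < t < 1 by apply/andP; split; lra.
have E' : y2 t = q t * y a - z * y t by rewrite -E; ring.
have e1' : y1 t * phi' t = - (y1 t * psi t) by apply/eqP; rewrite -addr_eq0 e1.
by rewrite e1' e2 E'; ring.
Qed.

(** The phase [x] is free: placed at an endpoint it makes the sine there vanish and the cosine equal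
    to 1, which isolates the value of [y]; [solution_cosl] isolates that of [y1] in the same way. *)
Lemma solution_sinl x u v : 0 <= u -> u <= v -> v <= 1 ->
  (y1 v * sinl (x - v) z + y v * cosl (x - v) z) -
  (y1 u * sinl (x - u) z + y u * cosl (x - u) z) =
  y a * cintegral `]u, v[ (fun t => q t * sinl (x - t) z).
Proof.
case: sol => y2 W eq; apply: (key W eq (is_cderive_sinl x z) (is_cderive_cosl x z)).
- have := ccontinuousZ (-1) (ccontinuous_coslB x z).
  by congr ccontinuous; apply/funext => t; rewrite mulN1r.
- exact: ccontinuousZ (ccontinuous_sinlB x z).
- by move=> t; rewrite -mulrDr addNr mulr0.
- by [].
Qed.

Lemma solution_cosl x u v : 0 <= u -> u <= v -> v <= 1 ->
  (y1 v * cosl (x - v) z - z * y v * sinl (x - v) z) -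
  (y1 u * cosl (x - u) z - z * y u * sinl (x - u) z) =
  y a * cintegral `]u, v[ (fun t => q t * cosl (x - t) z).
Proof.
move=> u0 uv v1; case: sol => y2 W eq.
have := @key y2 (fun t => cosl (x - t) z) (fun t => z * sinl (x - t) z)
  (fun t => - z * sinl (x - t) z) (fun t => - z * - cosl (x - t) z) u v W eq.
move=> <- //.
- by ring.
- exact: is_cderive_cosl.
- by move=> t; apply: is_cderiveZ; exact: is_cderive_sinl.
- exact: ccontinuousZ (ccontinuous_sinlB x z).
- have := ccontinuousZ z (ccontinuous_coslB x z).
  by congr ccontinuous; apply/funext => t; rewrite mulrNN.
- by move=> t; ring.
- by move=> t; rewrite mulrNN.
Qed.

End SolutionFormulas.

(** * Bessel's inequality *)

Section Bessel.
Context {R : realType}.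
Local Open Scope classical_set_scope.
Local Notation mu := (@lebesgue_measure R).
Local Notation I := (0 +i* 1 : R[i]).
Implicit Types (t u v : R) (k : int).

Definition fourier k t : R[i] := cexp (t%:C * (I * ((pi : R)%:C * (2 * k%:~R)))).

Lemma fourierD k l t : fourier (k + l) t = fourier k t * fourier l t.
Proof. by rewrite /fourier -cexpD rmorphD /=; congr cexp; ring. Qed.

Lemma fourier0 t : fourier 0 t = 1.
Proof. by rewrite /fourier !mulr0 cexp0. Qed.

Let ReIm_freq k t : complex.Re (t%:C * (I * ((pi : R)%:C * (2 * k%:~R)))) = 0 /\
  complex.Im (t%:C * (I * ((pi : R)%:C * (2 * k%:~R)))) = t * (pi * (2 * k%:~R)).
Proof.
have -> : t%:C * (I * ((pi : R)%:C * (2 * k%:~R))) = (t * (pi * (2 * k%:~R)))%:C * I.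
  by rewrite !rmorphM /= rmorph_nat rmorph_int; ring.
by rewrite ReM ImM /=; split; ring.
Qed.

Lemma fourier_conj k t : conjc (fourier k t) = fourier (- k) t.
Proof.
have [h1 h2] := ReIm_freq k t; have [h3 h4] := ReIm_freq (- k) t.
rewrite /fourier /cexp h1 h2 h3 h4 rmorphN /= !mulrN.
by apply: ReImP; rewrite ?cosN ?sinN !expR0 /=; ring.
Qed.

Lemma absc_fourier k t : absc (fourier k t) = 1.
Proof. by rewrite /fourier absc_cexp (ReIm_freq k t).1 expR0. Qed.

Lemma is_cderive_fourier k t :
  is_cderive (fourier k) t (I * ((pi : R)%:C * (2 * k%:~R)) * fourier k t).
Proof.
have := is_cderive_cexp 0 (I * ((pi : R)%:C * (2 * k%:~R))) t.
by apply: is_cderive_eq => [x|]; rewrite add0r.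
Qed.

Lemma ccontinuous_fourier k : ccontinuous (fourier k).
Proof. exact: is_cderive_continuous (is_cderive_fourier k). Qed.

Lemma fourier_period k : fourier k 1 = 1.
Proof.
have H (n : nat) : fourier n 1 = 1.
  elim: n => [|n IH]; first exact: fourier0.
  rewrite -[n.+1]addn1 PoszD fourierD IH mul1r.
  have [h1 h2] := ReIm_freq 1 1.
  rewrite /fourier /cexp h1 h2 expR0 !mul1r mulr1 mulr_natr cos2pi sin2pi.
  by [].
case: k => n; first exact: H.
by rewrite NegzE -fourier_conj H conjc1.
Qed.

Lemma fourier_orthonormal k : cintegral `]0, 1] (fourier k) = (k == 0)%:R.
Proof.
have [->|k0] := eqVneq k 0.
  have -> : fourier 0 = fun=> 1 by apply/funext => t; exact: fourier0.
  rewrite /cintegral /= !Rintegral_cst//= lebesgue_measure_itv /= lte_fin ltr01 /=.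
  by apply: ReImP => /=; rewrite ?mul1r ?mul0r ?subr0.
set w := I * ((pi : R)%:C * (2 * k%:~R)).
have w0 : w != 0.
  apply: mulf_neq0; first exact: I_neq0.
  apply: mulf_neq0; first by rewrite real_complex_eq0 gt_eqF ?pi_gt0.
  by apply: mulf_neq0; rewrite ?pnatr_eq0 ?intr_eq0.
have := @cintegral_derive R 0 1 (fun t => w^-1 * fourier k t) (fourier k) ler01.
rewrite fourier_period /fourier mul0r cexp0 subrr => -> //.
  move=> t; have := is_cderiveZ w^-1 (is_cderive_fourier k t).
  by apply: is_cderive_eq => //; rewrite mulKf.
exact: ccontinuous_fourier.
Qed.

Variables (u v : R) (h : R -> R[i]) (kap : nat -> int).
Hypotheses (u0 : 0 <= u) (v1 : v <= 1) (hi : cintegrable `]u, v[ h).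
Hypothesis h2 : mu.-integrable `]u, v[ (fun t => (absc (h t) ^+ 2)%:E).
Hypothesis kap_inj : injective kap.
Local Notation D := (`]u, v[ : set (measurableTypeR R)).

Let coef n := cintegral D (fun t => h t * fourier (kap n) t).

Let mD : measurable D. Proof. exact: measurable_itv. Qed.

Let subD : D `<=` `]0, 1].
Proof. by move=> t /=; rewrite !in_itv /= => /andP[a b]; apply/andP; split; have [] := (u0, v1); lra. Qed.

Let iterm n : cintegrable D (fun t => h t * fourier (kap n) t).
Proof.
apply: (cintegrableM (M := 1)) => //; last by move=> t _; rewrite absc_fourier.
exact: ccontinuous_measurable (ccontinuous_fourier _).
Qed.

Let trig N t : R[i] := \sum_(n < N) coef n * fourier (- kap n) t.

Let trig_conj N t : conjc (trig N t) = \sum_(n < N) conjc (coef n) * fourier (kap n) t.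
Proof.
rewrite /trig (rmorph_sum (@conjc R)); apply: eq_bigr => n _.
transitivity (conjc (coef n) * conjc (fourier (- kap n) t)); first exact: rmorphM.
by rewrite fourier_conj opprK.
Qed.

Let i01 k : cintegrable `]0, 1] (fourier k).
Proof.
have := @cintegrableM _ `]0, 1] (fun=> 1) (fourier k) 1 (measurable_itv _) (cintegrable_cst 0 1 1)
  (ccontinuous_measurable (measurable_itv _) (ccontinuous_fourier k)).
have fle t : `]0, 1] t -> absc (fourier k t) <= 1 by rewrite absc_fourier.
by move=> /(_ fle); apply: eq_cintegrable => // t _; rewrite mul1r.
Qed.

Let S N := \sum_(n < N) absc (coef n) ^+ 2.

Let trig2 N : cintegrable `]0, 1] (fun t => trig N t * conjc (trig N t)) /\
  cintegral `]0, 1] (fun t => trig N t * conjc (trig N t)) = (S N)%:C.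
Proof.
have E t : trig N t * conjc (trig N t) = \sum_(n < N) \sum_(m < N)
    (coef n * conjc (coef m)) * fourier (kap m - kap n) t.
  rewrite trig_conj mulr_suml; apply: eq_bigr => n _; rewrite mulr_sumr.
  by apply: eq_bigr => m _; rewrite fourierD; ring.
have m1 : measurable (`]0, 1] : set (measurableTypeR R)) by exact: measurable_itv.
have j n m : cintegrable `]0, 1] (fun t => (coef n * conjc (coef m)) * fourier (kap m - kap n) t).
  exact: cintegrableZ.
have j' n := @cintegral_sum _ `]0, 1] _ (index_enum 'I_N) (fun m : 'I_N => fun t =>
  (coef n * conjc (coef m)) * fourier (kap m - kap n) t) m1 (fun m => j n m).
have [k1 k2] := @cintegral_sum _ `]0, 1] _ (index_enum 'I_N) (fun n : 'I_N => fun t =>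
  \sum_(m < N) (coef n * conjc (coef m)) * fourier (kap m - kap n) t) m1 (fun n => (j' n).1).
split; first by apply: eq_cintegrable k1 => // t _; rewrite E.
transitivity (cintegral `]0, 1] (fun t => \sum_(n < N) \sum_(m < N)
    (coef n * conjc (coef m)) * fourier (kap m - kap n) t)).
  by apply: eq_cintegral => t _; rewrite E.
rewrite k2 rmorph_sum; apply: eq_bigr => n _.
rewrite (j' n).2 (bigD1 n) //= big1 ?addr0 => [|m mn].
  by rewrite cintegralZ// fourier_orthonormal subrr eqxx mulr1 sqr_norm_conj.
rewrite cintegralZ// fourier_orthonormal subr_eq0 (inj_eq kap_inj).
by rewrite (_ : (m == n :> nat) = false) ?mulr0//; apply/negbTE.
Qed.

(** Integrating |h - trig|^2 >= 0 over ]u, v[ gives 0 <= int |h|^2 - 2 S + int |trig|^2.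
    Orthonormality holds over the full period only, but |trig|^2 is nonnegative, so its integral
    over ]u, v[ is at most S. *)
Lemma bessel : l2_bounded (fun n => absc (cintegral `]u, v[ (fun t => h t * fourier (kap n) t))).
Proof.
exists (\int[mu]_(t in D) (absc (h t) ^+ 2)) => N; rewrite -/(S N).
have [t1 t2] := trig2 N.
have s1 : cintegrable D (fun t => \sum_(n < N) conjc (coef n) * (h t * fourier (kap n) t)) /\
   cintegral D (fun t => \sum_(n < N) conjc (coef n) * (h t * fourier (kap n) t)) = (S N)%:C.
  have [a b] := @cintegral_sum _ D _ (index_enum 'I_N) (fun n : 'I_N => fun t =>
    conjc (coef n) * (h t * fourier (kap n) t)) mD (fun n => cintegrableZ _ mD (iterm n)).
  split=> //; rewrite b rmorph_sum; apply: eq_bigr => n _.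
  by rewrite cintegralZ// mulrC sqr_norm_conj.
have E t : absc (h t - trig N t) ^+ 2 = absc (h t) ^+ 2
    - 2 * complex.Re (\sum_(n < N) conjc (coef n) * (h t * fourier (kap n) t))
    + complex.Re (trig N t * conjc (trig N t)).
  have -> : \sum_(n < N) conjc (coef n) * (h t * fourier (kap n) t) = h t * conjc (trig N t).
    by rewrite trig_conj mulr_sumr; apply: eq_bigr => n _; ring.
  rewrite sqr_norm_conj !absc_sqr /= ReD ReN ImD ImN ReM.
  by case: (trig N t) => x y /=; ring.
set tr := fun t => complex.Re (trig N t * conjc (trig N t)).
set cr := fun t => complex.Re (\sum_(n < N) conjc (coef n) * (h t * fourier (kap n) t)).
have icr : mu.-integrable D (fun t => (cr t)%:E) by exact: s1.1.1.
have itr : mu.-integrable D (fun t => (tr t)%:E).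
  by apply: (integrableS _ _ subD) t1.1 => //; exact: measurable_itv.
have i2cr : mu.-integrable D (fun t => (2 * cr t)%:E).
  by apply: eq_integrable (integrableZl mD 2 icr) => // t _; rewrite EFinM.
have idf : mu.-integrable D (fun t => (absc (h t) ^+ 2 - 2 * cr t)%:E).
  by apply: eq_integrable (integrableB mD h2 i2cr) => // t _; rewrite EFinB.
have P0 : 0 <= \int[mu]_(t in D) (absc (h t) ^+ 2 - 2 * cr t + tr t).
  by apply: Rintegral_ge0 => t _; rewrite -E sqr_ge0.
rewrite RintegralD// RintegralB// RintegralZl// in P0.
have crE : \int[mu]_(t in D) cr t = S N by have := congr1 (@complex.Re R) s1.2.
have trE : \int[mu]_(t in D) tr t <= S N.
  have <- : \int[mu]_(t in `]0, 1]) tr t = S N by have := congr1 (@complex.Re R) t2.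
  have tr0 t : 0 <= tr t by rewrite /tr sqr_norm_conj sqr_ge0.
  apply: fine_le.
  - exact: integrable_fin_num itr.
  - exact: integrable_fin_num t1.1.
  - apply: ge0_subset_integral => //; [exact: measurable_int t1.1|].
    by move=> t _; rewrite lee_fin.
by rewrite crE in P0; lra.
Qed.

End Bessel.

(** * Integrals of [q] against cosine and sine *)

Section Pieces.
Context {R : realType}.
Local Open Scope classical_set_scope.
Local Notation mu := (@lebesgue_measure R).
Local Notation I := (0 +i* 1 : R[i]).
Variables (q : R -> R[i]) (qL : L2_01 q).
Implicit Types (u v t x c d l : R) (z r : R[i]) (sg : bool).

Let qi : cintegrable `[0, 1] q := L2_cintegrable qL.

(* The integrals over [(u, v)] of [q t] against [cos (rho (c + t))], resp.
   [sin (rho (c + t)) / rho], with [t] replaced by [- t] when [sg] holds. *)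
Definition cos_piece u v sg c z : R[i] :=
  cintegral `]u, v[ (fun t => q t * cosl ((-1) ^+ sg * t + c) z).
Definition sin_piece u v sg c z : R[i] :=
  cintegral `]u, v[ (fun t => q t * sinl ((-1) ^+ sg * t + c) z).

Lemma ccontinuous_cosl_affine sg c z : ccontinuous (fun t => cosl ((-1) ^+ sg * t + c) z).
Proof.
case: sg; last first.
  have -> : (fun t => cosl ((-1) ^+ false * t + c) z) = (fun t => cosl (- c - t) z).
    by apply/funext => t; rewrite (_ : (-1) ^+ false * t + c = - (- c - t)) ?coslN//; ring.
  exact: ccontinuous_coslB.
have -> : (fun t => cosl ((-1) ^+ true * t + c) z) = (fun t => cosl (c - t) z).
  by apply/funext => t; rewrite (_ : (-1) ^+ true * t + c = c - t)//; ring.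
exact: ccontinuous_coslB.
Qed.

Lemma ccontinuous_sinl_affine sg c z : ccontinuous (fun t => sinl ((-1) ^+ sg * t + c) z).
Proof.
case: sg; last first.
  have -> : (fun t => sinl ((-1) ^+ false * t + c) z) = (fun t => -1 * sinl (- c - t) z).
    apply/funext => t; rewrite (_ : (-1) ^+ false * t + c = - (- c - t)); last by ring.
    by rewrite sinlN mulN1r.
  exact: ccontinuousZ (ccontinuous_sinlB _ _).
have -> : (fun t => sinl ((-1) ^+ true * t + c) z) = (fun t => sinl (c - t) z).
  by apply/funext => t; rewrite (_ : (-1) ^+ true * t + c = c - t)//; ring.
exact: ccontinuous_sinlB.
Qed.

Lemma cintegrable_open u v k : 0 <= u -> v <= 1 -> ccontinuous k ->
  cintegrable `]u, v[ (fun t => q t * k t).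
Proof.
move=> u0 v1 ck; have [vu|uv] := leP v u.
  rewrite set_itv_ge; last by rewrite bnd_simp -leNgt.
  by split; exact: integrable_set0.
apply: (@cintegrableS _ `]u, v]) => //; first exact: subset_itv_oo_oc.
exact: cintegrable_mul_continuous (ltW uv) v1 qi ck.
Qed.

Section FixedInterval.
Variables (u v : R).
Hypotheses (u0 : 0 <= u) (v1 : v <= 1).

Let icos sg c z : cintegrable `]u, v[ (fun t => q t * cosl ((-1) ^+ sg * t + c) z).
Proof. by apply: cintegrable_open => //; exact: ccontinuous_cosl_affine. Qed.

Let isin sg c z : cintegrable `]u, v[ (fun t => q t * sinl ((-1) ^+ sg * t + c) z).
Proof. by apply: cintegrable_open => //; exact: ccontinuous_sinl_affine. Qed.

Lemma sin_pieceD sg c d z : sin_piece u v sg (c + d) z =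
  cosl d z * sin_piece u v sg c z + sinl d z * cos_piece u v sg c z.
Proof.
rewrite /sin_piece /cos_piece -!cintegralZ// -cintegralD//; try exact: cintegrableZ.
by apply: eq_cintegral => t _; rewrite addrA sinlD; ring.
Qed.

Lemma sin_pieceB sg c d z : sin_piece u v sg (c - d) z =
  cosl d z * sin_piece u v sg c z - sinl d z * cos_piece u v sg c z.
Proof. by rewrite sin_pieceD coslN sinlN mulNr. Qed.

Let q_oo : cintegrable `]u, v[ q.
Proof.
have := @cintegrable_open u v (fun=> 1) u0 v1 (ccontinuous_cst 1).
by apply: eq_cintegrable => // t _; rewrite mulr1.
Qed.

Let NQ := int_nrm1 `]u, v[ q.

Let NQ0 : 0 <= NQ := int_nrm1_ge0 _ _.

(** Termwise integration: the coefficients inherit the bound 1/k! up to the factor 2 NQ, and the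
    uniformity in [unit_series] controls the integrated remainder. *)
Lemma entire_piece (f : R -> R[i] -> R[i]) (a : nat -> R -> R[i]) sg c :
  unit_series f a -> (forall t, `]u, v[ t -> `|(-1) ^+ sg * t + c| <= 1) ->
  (forall z, ccontinuous (fun t => f ((-1) ^+ sg * t + c) z)) ->
  (forall k, ccontinuous (fun t => a k ((-1) ^+ sg * t + c))) ->
  entire (fun z => cintegral `]u, v[ (fun t => q t * f ((-1) ^+ sg * t + c) z)).
Proof.
move=> [h1 h2] th1 cf ca.
set th := fun t => (-1) ^+ sg * t + c in th1 cf ca *.
have ia k : cintegrable `]u, v[ (fun t => q t * a k (th t)) by exact: cintegrable_open.
apply: (@entire_of_series _ _ (fun k => cintegral `]u, v[ (fun t => q t * a k (th t))) (2 * NQ)).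
  move=> k; rewrite mulrAC; apply: int_nrm1M => //; first exact: ccontinuous_measurable (ca k).
  by move=> t /th1; exact: h1.
move=> z e e0; have e1 : 0 < e / (2 * NQ + 1) by rewrite divr_gt0//; move: NQ0; lra.
have [N hN] := h2 z _ e1; exists N => n Nn.
have [j1 j2] := @cintegral_sum _ `]u, v[ _ (index_enum 'I_n) (fun k : 'I_n => fun t =>
    z ^+ k * (q t * a k (th t))) (measurable_itv _) (fun k => cintegrableZ _ (measurable_itv _) (ia k)).
have -> : \sum_(k < n) cintegral `]u, v[ (fun t => q t * a k (th t)) * z ^+ k =
  cintegral `]u, v[ (fun t => \sum_(k < n) z ^+ k * (q t * a k (th t))).
  by rewrite j2; apply: eq_bigr => k _; rewrite cintegralZ// mulrC.
have if' : cintegrable `]u, v[ (fun t => q t * f (th t) z) by exact: cintegrable_open.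
rewrite -cintegralB//.
have cS m : ccontinuous (fun t => \sum_(k < m) a k (th t) * z ^+ k).
  elim: m => [|m IH].
    have -> : (fun t => \sum_(k < 0) a k (th t) * z ^+ k) = fun=> 0.
      by apply/funext => t; rewrite big_ord0.
    exact: ccontinuous_cst.
  have -> : (fun t => \sum_(k < m.+1) a k (th t) * z ^+ k) =
    (fun t => \sum_(k < m) a k (th t) * z ^+ k + a m (th t) * z ^+ m).
    by apply/funext => t; rewrite big_ord_recr.
  by apply: ccontinuousD => //; apply: ccontinuousM => //; exact: ccontinuous_cst.
have -> : cintegral `]u, v[ (fun t => q t * f (th t) z - \sum_(k < n) z ^+ k * (q t * a k (th t)))
  = cintegral `]u, v[ (fun t => q t * (f (th t) z + -1 * \sum_(k < n) a k (th t) * z ^+ k)).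
  apply: eq_cintegral => t _; rewrite mulrDr mulN1r mulrN; congr (_ - _).
  by rewrite mulr_sumr; apply: eq_bigr => k _; ring.
apply: le_trans (_ : 2 * (e / (2 * NQ + 1)) * NQ <= _).
  apply: int_nrm1M => //.
    by apply: ccontinuous_measurable => //; apply: ccontinuousD => //; exact: ccontinuousZ.
  by move=> t /th1; rewrite mulN1r; exact: hN.
have -> : 2 * (e / (2 * NQ + 1)) * NQ = e * (2 * NQ) / (2 * NQ + 1) by ring.
rewrite ler_pdivrMr; last by move: NQ0; lra.
by rewrite ler_pM2l//; lra.
Qed.

Let ccontinuous_affine sg c : ccontinuous (fun t => ((-1) ^+ sg * t + c)%:C).
Proof.
split; last by move=> t; exact: cvg_cst.
have -> : (fun t => complex.Re ((-1) ^+ sg * t + c)%:C) = (fun t => (-1) ^+ sg * t + c) by [].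
by move=> t; apply: cvgD; [apply: cvgM; [exact: cvg_cst|exact: cvg_id]|exact: cvg_cst].
Qed.

Let ccontinuous_exp (f : R -> R[i]) n : ccontinuous f -> ccontinuous (fun t => f t ^+ n).
Proof.
move=> cf; elim: n => [|n IH]; first exact: ccontinuous_cst.
have -> : (fun t => f t ^+ n.+1) = (fun t => f t * f t ^+ n).
  by apply/funext => t; rewrite exprS.
exact: ccontinuousM.
Qed.

Lemma entire_sin_piece sg c : (forall t, `]u, v[ t -> `|(-1) ^+ sg * t + c| <= 1) ->
  entire (sin_piece u v sg c).
Proof.
move=> th1; apply: (entire_piece sinl_series th1).
  by move=> z; exact: ccontinuous_sinl_affine.
move=> k; have -> : (fun t => sinl_coef k ((-1) ^+ sg * t + c)) =
  (fun t => ((-1) ^+ k / k.*2.+1`!%:R)%:C * ((-1) ^+ sg * t + c)%:C ^+ k.*2.+1).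
  by apply/funext => t; rewrite /sinl_coef -rmorphXn -rmorphM /=; congr (_ %:C); ring.
exact/ccontinuousZ/ccontinuous_exp/ccontinuous_affine.
Qed.

Lemma entire_cos_piece sg c : (forall t, `]u, v[ t -> `|(-1) ^+ sg * t + c| <= 1) ->
  entire (cos_piece u v sg c).
Proof.
move=> th1; apply: (entire_piece cosl_series th1).
  by move=> z; exact: ccontinuous_cosl_affine.
move=> k; have -> : (fun t => cosl_coef k ((-1) ^+ sg * t + c)) =
  (fun t => ((-1) ^+ k / k.*2`!%:R)%:C * ((-1) ^+ sg * t + c)%:C ^+ k.*2).
  by apply/funext => t; rewrite /cosl_coef -rmorphXn -rmorphM /=; congr (_ %:C); ring.
exact/ccontinuousZ/ccontinuous_exp/ccontinuous_affine.
Qed.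

End FixedInterval.

(** As [q] enters the equation only through y(a) and S(a) = 0, the solution S does not see [q];
    hence the determinant is affine in [q] and contains no product of two integrals. *)
Lemma char_fun_formula a gamma (C C1 S S1 : R[i] -> R -> R[i]) z :
  0 <= a <= 1 -> fundamental_solutions q a C C1 S S1 ->
  char_fun gamma C C1 S S1 z = 1 + gamma ^+ 2 - 2 * gamma * cosl 1 z
   + (sin_piece 0 a false (- a) z - gamma * sin_piece 0 a false (1 - a) z)
   + (gamma ^+ 2 * sin_piece a 1 true a z - gamma * sin_piece a 1 true (1 + a) z).
Proof.
move=> /andP[a0 a1] /(_ z)[sC Ca C1a sS [Sa S1a]].
have zero_ge := lexx (0 : R); have one_ge := lexx (1 : R).
have c0 := cosl2D z a; have c1 := cosl2D z (1 - a).
have P0 : 1 = a + (1 - a) by ring.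
set s0 := sinl a z in c0 *; set k0 := cosl a z in c0 *.
set s1 := sinl (1 - a) z in c1 *; set k1 := cosl (1 - a) z in c1 *.
have E1 : cosl 1 z = k0 * k1 - z * (s0 * s1) by rewrite {1}P0 coslD.
pose A0 := sin_piece 0 a false 0 z; pose B0 := cos_piece 0 a false 0 z.
pose A1 := sin_piece a 1 true 1 z; pose B1 := cos_piece a 1 true 1 z.
have IA0 : cintegral `]0, a[ (fun t => q t * sinl (0 - t) z) = - A0.
  rewrite /A0 /sin_piece -[RHS]mulN1r -cintegralZ//; last first.
    by apply: cintegrable_open => //; exact: ccontinuous_sinl_affine.
  by apply: eq_cintegral => t _; rewrite expr0 mul1r addr0 sub0r sinlN; ring.
have IB0 : cintegral `]0, a[ (fun t => q t * cosl (0 - t) z) = B0.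
  by apply: eq_cintegral => t _; rewrite expr0 mul1r addr0 sub0r coslN.
have IA1 : cintegral `]a, 1[ (fun t => q t * sinl (1 - t) z) = A1.
  by apply: eq_cintegral => t _; rewrite expr1 mulN1r addrC.
have IB1 : cintegral `]a, 1[ (fun t => q t * cosl (1 - t) z) = B1.
  by apply: eq_cintegral => t _; rewrite expr1 mulN1r addrC.
(* Phase 0 on [0, a] and phase 1 on [a, 1] express the boundary values of a solution by its data at
   [a]. *)
have vals (y y1 : R -> R[i]) : is_solution q a z y y1 ->
    [/\ y 0 = - y1 a * s0 + y a * k0 + y a * A0,
        y1 0 = y1 a * k0 + z * y a * s0 - y a * B0,
        y 1 = y1 a * s1 + y a * k1 + y a * A1 &
        y1 1 = y1 a * k1 - z * y a * s1 + y a * B1].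
  move=> sy.
  have := solution_sinl qL sy 0 zero_ge a0 a1; have := solution_cosl qL sy 0 zero_ge a0 a1.
  have := solution_sinl qL sy 1 a0 a1 one_ge; have := solution_cosl qL sy 1 a0 a1 one_ge.
  rewrite IA0 IB0 IA1 IB1 !subrr !sub0r sinlN coslN sinl0 cosl0 -/s0 -/k0 -/s1 -/k1.
  move=> e1 e2 e3 e4; split.
  - transitivity (y1 a * - s0 + y a * k0 - (y1 a * - s0 + y a * k0 - (y1 0 * 0 + y 0 * 1))).
      by ring.
    by rewrite e4; ring.
  - transitivity (y1 a * k0 - z * y a * - s0 -
      (y1 a * k0 - z * y a * - s0 - (y1 0 * 1 - z * y 0 * 0))); first by ring.
    by rewrite e3; ring.
  - transitivity (y1 1 * 0 + y 1 * 1 - (y1 a * s1 + y a * k1) + (y1 a * s1 + y a * k1)).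
      by ring.
    by rewrite e2; ring.
  - transitivity (y1 1 * 1 - z * y 1 * 0 - (y1 a * k1 - z * y a * s1) +
      (y1 a * k1 - z * y a * s1)); first by ring.
    by rewrite e1; ring.
have [c01 c02 c03 c04] := vals _ _ sC; have [s01 s02 s03 s04] := vals _ _ sS.
rewrite Ca C1a in c01 c02 c03 c04; rewrite Sa S1a in s01 s02 s03 s04.
have F1 : sin_piece 0 a false (- a) z = k0 * A0 - s0 * B0.
  by have := sin_pieceB zero_ge a1 false 0 a z; rewrite sub0r.
have F2 : sin_piece 0 a false (1 - a) z = k1 * A0 + s1 * B0.
  by have := sin_pieceD zero_ge a1 false 0 (1 - a) z; rewrite add0r.
have F3 : sin_piece a 1 true a z = k1 * A1 - s1 * B1.
  have e : 1 - (1 - a) = a by ring.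
  by have := sin_pieceB a0 one_ge true 1 (1 - a) z; rewrite e.
have F4 : sin_piece a 1 true (1 + a) z = k0 * A1 + s0 * B1.
  exact: (sin_pieceD a0 one_ge true 1 a z).
clearbody A0 B0 A1 B1 s0 k0 s1 k1.
rewrite /char_fun c01 c02 c03 c04 s01 s02 s03 s04 F1 F2 F3 F4 E1.
(* With the constant term written through both Pythagorean identities the claim is a polynomial
   identity. *)
have -> : 1 + gamma ^+ 2 = (k0 ^+ 2 + z * s0 ^+ 2) + gamma ^+ 2 * (k1 ^+ 2 + z * s1 ^+ 2).
  by rewrite c0 c1 mulr1.
ring.
Qed.

End Pieces.

(** * Factorization for gamma = 1 and gamma = -1 *)

Section SpecialGamma.
Context {R : realType}.
Variables (q : R -> R[i]) (qL : L2_01 q) (a : R) (C C1 S S1 : R[i] -> R -> R[i]).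
Hypotheses (a01 : 0 <= a <= 1) (fund : fundamental_solutions q a C C1 S S1).
Implicit Types z : R[i].

Let a0 : 0 <= a. Proof. by case/andP: a01. Qed.
Let a1 : a <= 1. Proof. by case/andP: a01. Qed.

(** The phases in [char_fun_formula] differ by 1 in each pair. Centred at their midpoint they are
    shifts by 1/2 in both directions: for gamma = 1 their difference keeps only the half-angle sine,
    for gamma = -1 their sum keeps only the half-angle cosine, and this is the common factor. *)
Let sin_pieces z : let s := sinl (1 / 2) z in let k := cosl (1 / 2) z in
  let X := sin_piece q 0 a false (1 / 2 - a) z in let Y := cos_piece q 0 a false (1 / 2 - a) z in
  let V := sin_piece q a 1 true (a + 1 / 2) z in let W := cos_piece q a 1 true (a + 1 / 2) z in
  [/\ k ^+ 2 + z * s ^+ 2 = 1, cosl 1 z = k ^+ 2 - z * s ^+ 2,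
     sin_piece q 0 a false (- a) z = k * X - s * Y,
     sin_piece q 0 a false (1 - a) z = k * X + s * Y &
     sin_piece q a 1 true a z = k * V - s * W /\ sin_piece q a 1 true (1 + a) z = k * V + s * W].
Proof.
move=> s k X Y V W.
have h1 : 1 = 1 / 2 + 1 / 2 :> R by field.
have h2 : - a = 1 / 2 - a - 1 / 2 by ring.
have h3 : 1 - a = 1 / 2 - a + 1 / 2 by field.
have h4 : a = a + 1 / 2 - 1 / 2 by ring.
have h5 : 1 + a = a + 1 / 2 + 1 / 2 by field.
split.
- exact: cosl2D.
- by transitivity (cosl (1 / 2 + 1 / 2) z); [rewrite -h1 | rewrite coslD /s /k; ring].
- by rewrite h2; exact: sin_pieceB.
- by rewrite h3; exact: sin_pieceD.
- split; last by rewrite h5; exact: sin_pieceD.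
  rewrite [in X in sin_piece q a 1 true X z]h4.
  exact: (@sin_pieceB _ _ qL a 1 a0 (lexx _) true (a + 1 / 2) (1 / 2) z).
Qed.

Lemma char_fun_periodic z : char_fun 1 C C1 S S1 z = 2 * sinl (1 / 2) z *
  (2 * (z * sinl (1 / 2) z) +
   (-1 * cos_piece q 0 a false (1 / 2 - a) z + -1 * cos_piece q a 1 true (a + 1 / 2) z)).
Proof.
rewrite (char_fun_formula qL 1 z a01 fund).
have [] := sin_pieces z.
move: (sinl (1 / 2) z) (cosl (1 / 2) z) (sin_piece q 0 a false (1 / 2 - a) z)
  (cos_piece q 0 a false (1 / 2 - a) z) (sin_piece q a 1 true (a + 1 / 2) z)
  (cos_piece q a 1 true (a + 1 / 2) z) => s k X Y V W ks -> -> -> [-> ->].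
by have -> : k ^+ 2 = 1 - z * s ^+ 2 by [rewrite -ks addrK]; ring.
Qed.

Lemma char_fun_antiperiodic z : char_fun (-1) C C1 S S1 z = 2 * cosl (1 / 2) z *
  (2 * cosl (1 / 2) z +
   (sin_piece q 0 a false (1 / 2 - a) z + sin_piece q a 1 true (a + 1 / 2) z)).
Proof.
rewrite (char_fun_formula qL (-1) z a01 fund).
have [] := sin_pieces z.
move: (sinl (1 / 2) z) (cosl (1 / 2) z) (sin_piece q 0 a false (1 / 2 - a) z)
  (cos_piece q 0 a false (1 / 2 - a) z) (sin_piece q a 1 true (a + 1 / 2) z)
  (cos_piece q a 1 true (a + 1 / 2) z) => s k X Y V W ks -> -> -> [-> ->].
by have -> : z * s ^+ 2 = 1 - k ^+ 2 by [rewrite -ks addrC addKr]; ring.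
Qed.

End SpecialGamma.

(** * Perturbation estimates *)

Section Perturbations.
Context {R : realType}.
Local Open Scope classical_set_scope.
Local Notation lmu := (@lebesgue_measure R).
Local Notation I := (0 +i* 1 : R[i]).
Implicit Types (H : R[i] -> R[i]) (E : R[i] -> R) (mu : nat -> R[i]) (z r : R[i]).

(** The two estimates required by the localization: a global one, and one that at [mu n] itself
    reduces to the square summable [b n] and otherwise grows linearly with the distance. Both
    survive linear combinations, so the pieces can be treated separately. *)
Definition perturbation E mu H := exists K b, [/\ 0 < K, l2_bounded b, forall n, 0 <= b n,
  forall z, 2 <= weight z -> absc (H z) <= K * E z / weight z &
  forall n z, 2 <= weight z -> 2 <= weight (mu n) ->
    absc (H z) <= (b n + K * (absc (z - mu n) / weight (mu n))) * E z / weight z].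

Lemma perturbationD E mu H1 H2 : perturbation E mu H1 -> perturbation E mu H2 ->
  perturbation E mu (fun z => H1 z + H2 z).
Proof.
move=> [K [b [K0 lb b0 h1 h2]]] [L [d [L0 ld d0 k1 k2]]].
exists (K + L), (fun n => b n + d n); split.
- exact: addr_gt0.
- exact: l2_boundedD.
- by move=> n; rewrite addr_ge0.
- move=> z wz; apply: le_trans (abscD _ _) _.
  by apply: le_trans (lerD (h1 z wz) (k1 z wz)) _; rewrite -!mulrDl.
- move=> n z wz wn; apply: le_trans (abscD _ _) _.
  apply: le_trans (lerD (h2 n z wz wn) (k2 n z wz wn)) _; rewrite le_eqVlt.
  by apply/orP; left; apply/eqP; ring.
Qed.

Lemma perturbationZ E mu H c : (forall z, 0 <= E z) -> perturbation E mu H ->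
  perturbation E mu (fun z => c * H z).
Proof.
move=> E0 [K [b [K0 lb b0 h1 h2]]].
have c0 := absc_ge0 c; have c1 : absc c <= absc c + 1 by lra.
have p0 z : 0 <= E z / weight z by rewrite divr_ge0// ltW// weight_gt0.
exists ((absc c + 1) * K), (fun n => (absc c + 1) * b n); split.
- by rewrite mulr_gt0//; lra.
- exact: l2_boundedZ.
- by move=> n; rewrite mulr_ge0//; lra.
- move=> z wz; rewrite abscM -!mulrA ler_pM ?absc_ge0// ?mulrA ?h1//.
- move=> n z wz wn; rewrite abscM.
  apply: le_trans (_ : (absc c + 1) * ((b n + K * (absc (z - mu n) / weight (mu n))) * E z / weight z) <= _).
    by apply: ler_pM; rewrite ?absc_ge0 ?h2.
  by rewrite le_eqVlt; apply/orP; left; apply/eqP; ring.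
Qed.

Variables (q : R -> R[i]) (qL : L2_01 q) (u v : R) (sg : bool) (c l : R).
Hypotheses (u0 : 0 <= u) (v1 : v <= 1) (l0 : 0 <= l) (l1 : l <= 1).
Hypothesis thl : forall t, `]u, v[ t -> `|(-1) ^+ sg * t + c| <= l.
Variables (alpha : R[i]) (kap : nat -> int).
Hypothesis kap_inj : injective kap.

Definition freq n : R[i] := (pi : R)%:C * (2 * (kap n)%:~R + alpha).
Definition freq2 n : R[i] := freq n ^+ 2.

Let th t := (-1) ^+ sg * t + c.
Let NQ := int_nrm1 `]u, v[ q.
Let A := pi * `|complex.Im alpha|.

Let Im_freq n : `|complex.Im (freq n)| = A.
Proof.
rewrite /freq ImM /= mul0r addr0 normrM gtr0_norm ?pi_gt0//.
have -> : 2 * (kap n)%:~R = (2 * (kap n)%:~R)%:C :> R[i] by rewrite rmorphM /= rmorph_nat rmorph_int.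
by rewrite ImD /= add0r.
Qed.

Let mD : measurable (`]u, v[ : set (measurableTypeR R)).
Proof. exact: measurable_itv. Qed.

Let q_oo : cintegrable `]u, v[ q.
Proof.
have := @cintegrable_open R q qL u v (fun=> 1) u0 v1 (ccontinuous_cst 1).
by apply: eq_cintegrable => // t _; rewrite mulr1.
Qed.

Let NQ0 : 0 <= NQ := int_nrm1_ge0 _ _.

Let osc (e : bool) r := cintegral `]u, v[ (fun t => q t * cexp ((-1) ^+ e * (I * (r * (th t)%:C)))).

(** The part of the oscillation that stems from [alpha] and does not depend on [n]. Absorbed into
    the L2 function, it leaves a pure Fourier mode. *)
Let coef_mult (e : bool) t := cexp (0 + t%:C * ((-1) ^+ e * (I * ((-1) ^+ sg * ((pi : R)%:C * alpha))))).

(** Up to a phase factor these are Fourier coefficients of [q * coef_mult] at the integers [kap' n].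
    The phase factor is bounded, since |Im (freq n)| does not depend on [n]. *)
Let osc_l2 e : l2_bounded (fun n => absc (osc e (freq n))).
Proof.
pose kap' n := (-1) ^+ e * ((-1) ^+ sg * kap n).
have kap'_inj : injective kap'.
  by move=> n m; rewrite /kap' => /(can_inj (signrMK _))/(can_inj (signrMK _))/kap_inj.
have cm : ccontinuous (coef_mult e) by exact: is_cderive_continuous (is_cderive_cexp _ _).
have hi : cintegrable `]u, v[ (fun t => q t * coef_mult e t) by exact: cintegrable_open.
have h2 : lmu.-integrable `]u, v[ (fun t => (absc (q t * coef_mult e t) ^+ 2)%:E).
  have [M M0 hM] := ccontinuous_bounded ler01 cm.
  have [mq iq] := L2_sqr_integrable qL.
  have s01 : (`]u, v[ : set R) `<=` (`]0, 1[ : set R).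
    by move=> t /=; rewrite !in_itv /= => /andP[a1 a2]; apply/andP; split; move: u0 v1; lra.
  have iq' : lmu.-integrable `]u, v[ (fun t => (absc (q t) ^+ 2)%:E).
    by apply: (@integrableS _ _ _ lmu `]0, 1[%classic `]u, v[%classic) iq => //; exact: measurable_itv.
  apply: le_integrable (integrableZl mD (M ^+ 2) iq') => //.
    apply/measurable_EFinP.
    rewrite (_ : (fun t => _) = (fun t => complex.Re (q t * coef_mult e t) ^+ 2) \+
      (fun t => complex.Im (q t * coef_mult e t) ^+ 2)).
      by have [f1 f2] := cintegrable_measurable hi; apply: measurable_funD; apply: measurable_funX.
    by apply/funext => t /=; rewrite absc_sqr.
  move=> t ut; rewrite -EFinM /= lee_fin (ger0_norm (sqr_ge0 _)) ger0_norm; last first.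
    by apply: mulr_ge0; exact: sqr_ge0.
  rewrite abscM exprMn mulrC ler_wpM2r ?sqr_ge0// lerXn2r ?nnegrE ?absc_ge0 ?(ltW M0)//.
  by apply: hM; have := s01 t ut; rewrite /= in_itv /= => /andP[a1 a2]; rewrite !ltW.
have B := bessel u0 v1 hi h2 kap'_inj.
have E n : osc e (freq n) = cexp ((-1) ^+ e * (I * (freq n * c%:C))) *
    cintegral `]u, v[ (fun t => q t * coef_mult e t * fourier (kap' n) t).
  rewrite -cintegralZ//; last first.
    apply: (cintegrableM (M := 1)) => //; last by move=> t _; rewrite absc_fourier.
    exact: ccontinuous_measurable (ccontinuous_fourier _).
  apply: eq_cintegral => t _.
  transitivity (q t * (cexp ((-1) ^+ e * (I * (freq n * c%:C))) *
    coef_mult e t * fourier (kap' n) t)); last by ring.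
  congr (_ * _).
  rewrite /coef_mult /fourier -!cexpD; congr cexp.
  rewrite /th /kap' /freq !rmorphM !rmorphD !rmorphM !rmorph_sign /=.
  ring.
pose m := expR (A * `|c|).
apply: (@l2_bounded_le _ _ (fun n => m * absc (cintegral `]u, v[
  (fun t => q t * coef_mult e t * fourier (kap' n) t))) 0); last exact: l2_boundedZ B.
move=> n _; rewrite ger0_norm ?absc_ge0// E abscM ler_wpM2r ?absc_ge0//.
have -> : (-1) ^+ e * (I * (freq n * c%:C)) = I * ((-1) ^+ e * freq n * c%:C) by ring.
apply: le_trans (absc_cexpI _) _; rewrite ler_expR ImM /= mulr0 add0r normrM.
rewrite ler_wpM2r// -(Im_freq n) -signr_odd; case: (odd e); rewrite ?expr1 ?expr0 ?mulN1r ?mul1r//.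
by rewrite ImN normrN.
Qed.

Let wave (e : bool) r t := cexp ((-1) ^+ e * (I * (r * (th t)%:C))).

Let ccontinuous_wave e r : ccontinuous (wave e r).
Proof.
have -> : wave e r = (fun t =>
    cexp ((-1) ^+ e * (I * (r * c%:C)) + t%:C * ((-1) ^+ e * (I * (r * (-1) ^+ sg))))).
  apply/funext => t; rewrite /wave /th; congr cexp.
  by rewrite rmorphD rmorphM rmorph_sign /=; ring.
exact: is_cderive_continuous (is_cderive_cexp _ _).
Qed.

Let waveE e r t : wave e r t = cexp (I * ((-1) ^+ e * r * (th t)%:C)).
Proof. by rewrite /wave; congr cexp; ring. Qed.

Let Im_phase (e : bool) r t : (`]u, v[%classic : set R) t ->
  `|complex.Im ((-1) ^+ e * r * (th t)%:C)| <= l * `|complex.Im r|.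
Proof.
move=> /thl ut; apply: le_trans (Im_mul_le _ ut) _.
by case: e; rewrite ?expr1 ?expr0 ?mulN1r ?mul1r// ImN normrN.
Qed.

Let wave_le e r t : (`]u, v[%classic : set R) t -> absc (wave e r t) <= expR (l * `|complex.Im r|).
Proof.
by move=> ut; rewrite waveE; apply: le_trans (absc_cexpI _) _; rewrite ler_expR Im_phase.
Qed.

(** The difference of e^(iw) and e^(iw') is 2i e^(i(w+w')/2) sin((w-w')/2); the sine supplies the
    factor |r - r'|, and the two halved imaginary parts add up to the exponent. *)
Let wave_near e r r' t : (`]u, v[%classic : set R) t -> absc (wave e r t - wave e r' t) <=
  absc (r - r') * expR (l * (`|complex.Im r| + `|complex.Im r'|)).
Proof.
move=> ut; rewrite !waveE.
have p1 := Im_phase e r ut; have p2 := Im_phase e r' ut.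
have ha : absc (((-1) ^+ e * r * (th t)%:C) - ((-1) ^+ e * r' * (th t)%:C)) <= absc (r - r').
  rewrite -mulrBl -mulrBr !abscM absc_real.
  have -> : absc ((-1) ^+ e : R[i]) = 1 by case: (e); rewrite ?expr1 ?expr0 ?abscN; exact: (absc_nat 1).
  by rewrite mul1r ler_piMr ?absc_ge0//; apply: le_trans (thl ut) l1.
move: ((-1) ^+ e * r * (th t)%:C) ((-1) ^+ e * r' * (th t)%:C) p1 p2 ha => w w' p1 p2 ha.
have -> : cexp (I * w) - cexp (I * w') = 2 * (cexp (I * ((w + w') / 2)) * (I * csin ((w - w') / 2))).
  have -> : I * csin ((w - w') / 2) = (cexp (I * ((w - w') / 2)) - cexp (- (I * ((w - w') / 2)))) / 2.
    by rewrite /csin; field; rewrite I_neq0.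
  rewrite -[cexp (I * w)](_ : cexp (I * ((w + w') / 2)) * cexp (I * ((w - w') / 2)) = _).
    rewrite -[cexp (I * w')](_ : cexp (I * ((w + w') / 2)) * cexp (- (I * ((w - w') / 2))) = _).
      by field.
    by rewrite -cexpD; congr cexp; field.
  by rewrite -cexpD; congr cexp; field.
have Im_half z : complex.Im (z / 2) = complex.Im z / 2.
  by rewrite -(rmorph_nat (real_complex R) 2) -fmorphV ImM /= mulr0 add0r.
have i1 : `|complex.Im ((w + w') / 2)| <= (`|complex.Im w| + `|complex.Im w'|) / 2.
  by rewrite Im_half ImD normrM (@ger0_norm R 2^-1)// ler_wpM2r// ler_normD.
have i2 : `|complex.Im ((w - w') / 2)| <= (`|complex.Im w| + `|complex.Im w'|) / 2.
  by rewrite Im_half ImD ImN normrM (@ger0_norm R 2^-1)// ler_wpM2r// ler_normB.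
have h1 := absc_cexpI ((w + w') / 2); have h2 := absc_csin_le_mul ((w - w') / 2).
have h3 : 2 * absc ((w - w') / 2) <= absc (r - r').
  by rewrite abscM abscV absc_nat mulrC divfK.
have -> : absc (2 * (cexp (I * ((w + w') / 2)) * (I * csin ((w - w') / 2)))) =
    absc (cexp (I * ((w + w') / 2))) * (2 * absc (csin ((w - w') / 2))).
  by rewrite !abscM absc_I absc_nat; ring.
apply: le_trans (ler_pM (absc_ge0 _) _ h1 (lexx _)) _; first by rewrite mulr_ge0 ?absc_ge0.
have h4 : 2 * absc (csin ((w - w') / 2)) <= absc (r - r') * expR `|complex.Im ((w - w') / 2)|.
  apply: le_trans (_ : 2 * (absc ((w - w') / 2) * expR `|complex.Im ((w - w') / 2)|) <= _).
    by rewrite ler_pM2l.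
  by rewrite mulrA ler_wpM2r ?expR_ge0.
apply: le_trans (ler_pM (expR_ge0 _) _ (lexx _) h4) _; first by rewrite mulr_ge0 ?absc_ge0.
rewrite mulrCA -expRD ler_wpM2l ?absc_ge0// ler_expR mulrDr.
by apply: le_trans (lerD i1 i2) _; move: p1 p2; lra.
Qed.

Let osc_le e r : absc (osc e r) <= 2 * NQ * expR (l * `|complex.Im r|).
Proof.
rewrite mulrAC; apply: int_nrm1M => //; first exact: ccontinuous_measurable (ccontinuous_wave e r).
by move=> t; exact: wave_le.
Qed.

Let osc_near e r r' : absc (osc e r - osc e r') <=
  2 * NQ * (absc (r - r') * expR (l * (`|complex.Im r| + `|complex.Im r'|))).
Proof.
have iw s : cintegrable `]u, v[ (fun t => q t * wave e s t) by exact: cintegrable_open.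
have -> : osc e r - osc e r' = cintegral `]u, v[ (fun t => q t * (wave e r t - wave e r' t)).
  rewrite -(cintegralB mD (iw r) (iw r')).
  by apply: eq_cintegral => t _; rewrite mulrBr.
rewrite mulrAC; apply: int_nrm1M => //; last by move=> t; exact: wave_near.
have -> : (fun t => wave e r t - wave e r' t) = (fun t => wave e r t + (-1) * wave e r' t).
  by apply/funext => t; rewrite mulN1r.
by apply/ccontinuous_measurable/ccontinuousD => //; exact: ccontinuousZ.
Qed.

(** The first summand is the Lipschitz constant at a model frequency, whose imaginary part
    contributes [expR (l * A)]; the second bounds the modulus; the 1 makes it positive. *)
Let K := 2 * NQ * expR (l * A) + 2 * NQ + 1.
Let b n := absc (osc false (freq n)) + absc (osc true (freq n)).

Let K0 : 0 < K.
Proof.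
have : 0 <= 2 * NQ by rewrite mulr_ge0// NQ0.
have : 0 <= 2 * NQ * expR (l * A) by rewrite mulr_ge0 ?expR_ge0// mulr_ge0// NQ0.
by rewrite /K; lra.
Qed.

Let b0 n : 0 <= b n. Proof. by rewrite addr_ge0 ?absc_ge0. Qed.

Let l2b : l2_bounded b. Proof. by apply: l2_boundedD; exact: osc_l2. Qed.

Let osc_est1 e r : absc (osc e r) <= K * expR (l * `|complex.Im r|).
Proof.
apply: le_trans (osc_le e r) _; rewrite ler_wpM2r ?expR_ge0// /K.
have : 0 <= 2 * NQ * expR (l * A) by rewrite mulr_ge0 ?expR_ge0// mulr_ge0// NQ0.
by lra.
Qed.

Let osc_est2 e n r : absc (osc e r) <= (b n + K * absc (r - freq n)) * expR (l * `|complex.Im r|).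
Proof.
have e1 : 1 <= expR (l * `|complex.Im r|) by rewrite -expR0 ler_expR mulr_ge0.
have bn : absc (osc e (freq n)) <= b n.
  by rewrite /b; case: (e); [rewrite lerDr | rewrite lerDl]; exact: absc_ge0.
have {}bn : absc (osc e (freq n)) <= b n * expR (l * `|complex.Im r|) by rewrite (le_trans bn)// ler_peMr.
have h := osc_near e r (freq n); rewrite Im_freq mulrDr expRD in h.
have h' : 2 * NQ * (absc (r - freq n) * (expR (l * `|complex.Im r|) * expR (l * A))) <=
    K * absc (r - freq n) * expR (l * `|complex.Im r|).
  have -> : 2 * NQ * (absc (r - freq n) * (expR (l * `|complex.Im r|) * expR (l * A))) =
    2 * NQ * expR (l * A) * absc (r - freq n) * expR (l * `|complex.Im r|) by ring.
  rewrite !ler_wpM2r ?expR_ge0 ?absc_ge0// /K.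
  by rewrite -addrA lerDl addr_ge0// mulr_ge0// NQ0.
have := absc_tri (osc e r) 0 (osc e (freq n)); rewrite !subr0 => /le_trans; apply.
by rewrite addrC mulrDl; apply: lerD bn (le_trans h h').
Qed.

(** Of the two roots of [z] take the one closer to f = freq n. Then |r + f| >= |f| >= weight / 2,
    and z - f^2 = (r - f)(r + f) turns a distance in lambda into one in rho. *)
Let near_root n z : 2 <= weight (freq2 n) -> exists r,
  [/\ r ^+ 2 = z, `|complex.Im r| = `|complex.Im (rt z)|, weight z = 1 + absc r &
   absc (r - freq n) <= 2 * (absc (z - freq2 n) / weight (freq2 n))].
Proof.
move=> wn.
have [r [r2 rI rN rn]] : exists r, [/\ r ^+ 2 = z, `|complex.Im r| = `|complex.Im (rt z)|,
    absc r = absc (rt z) & absc (r - freq n) <= absc (r + freq n)].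
  have [h|h] := leP (absc (rt z - freq n)) (absc (rt z + freq n)).
    by exists (rt z); rewrite rtK.
  exists (- rt z); rewrite sqrrN rtK ImN normrN abscN; split=> //.
  have -> : - rt z + freq n = - (rt z - freq n) by ring.
  by rewrite -opprD !abscN ltW.
exists r; split=> //; first by rewrite weightE rN.
have f2 : weight (freq2 n) = 1 + absc (freq n) by rewrite /weight abscX sqrtr_sqr ger0_norm ?absc_ge0.
have fn : weight (freq2 n) <= 2 * absc (freq n) by move: wn; rewrite f2; lra.
have w0 : 0 < weight (freq2 n) := weight_gt0 _.
have big : absc (freq n) <= absc (r + freq n).
  have := abscB (r + freq n) (r - freq n).
  have -> : r + freq n - (r - freq n) = 2 * freq n by ring.
  by rewrite abscM absc_nat; lra.
rewrite mulrA ler_pdivlMr// -r2 (_ : r ^+ 2 - freq2 n = (r - freq n) * (r + freq n));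
  last by rewrite /freq2; ring.
rewrite abscM mulrCA ler_wpM2l ?absc_ge0//; lra.
Qed.

Let cos_pieceE r z : r ^+ 2 = z -> cos_piece q u v sg c z = (osc false r + osc true r) / 2.
Proof.
move=> rz; have iw e s : cintegrable `]u, v[ (fun t => q t * wave e s t) by exact: cintegrable_open.
rewrite -(cintegralD mD (iw false r) (iw true r)) [RHS]mulrC.
rewrite -(cintegralZ _ mD (cintegrableD mD (iw false r) (iw true r))).
apply: eq_cintegral => t _.
by rewrite (cosl_rt _ rz) /ccos /wave expr0 expr1 mul1r mulN1r; field.
Qed.

Let sin_pieceE r z : r ^+ 2 = z -> r * sin_piece q u v sg c z = (osc false r - osc true r) / (2 * I).
Proof.
move=> rz; have iw e s : cintegrable `]u, v[ (fun t => q t * wave e s t) by exact: cintegrable_open.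
rewrite -(cintegralB mD (iw false r) (iw true r)) [RHS]mulrC.
rewrite -(cintegralZ _ mD (cintegrableB mD (iw false r) (iw true r))).
have iS : cintegrable `]u, v[ (fun t => q t * sinl ((-1) ^+ sg * t + c) z).
  by apply: cintegrable_open => //; exact: ccontinuous_sinl_affine.
rewrite -(cintegralZ _ mD iS).
apply: eq_cintegral => t _.
rewrite mulrCA (sinl_rt _ rz) /csin /wave expr0 expr1 mul1r mulN1r.
by field; rewrite I_neq0.
Qed.

Let cos_le r z : r ^+ 2 = z -> absc (cos_piece q u v sg c z) <=
  Num.max (absc (osc false r)) (absc (osc true r)).
Proof.
move=> rz; rewrite (cos_pieceE rz) abscM abscV absc_nat ler_pdivrMr//.
apply: le_trans (abscD _ _) _; rewrite mulr_natr mulr2n.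
by apply: lerD; rewrite le_max lexx ?orbT.
Qed.

Let sin_le r z : r ^+ 2 = z -> absc r * absc (sin_piece q u v sg c z) <=
  Num.max (absc (osc false r)) (absc (osc true r)).
Proof.
move=> rz; rewrite -abscM (sin_pieceE rz) abscM abscV abscM absc_nat absc_I mulr1 ler_pdivrMr//.
apply: le_trans (abscB _ _) _; rewrite mulr_natr mulr2n.
by apply: lerD; rewrite le_max lexx ?orbT.
Qed.

(** Without division by rho there is no decay; the extra factor [weight] in the growth compensates
    the denominator in [perturbation]. *)
Lemma perturbation_cos_piece :
  perturbation (fun z => expR (l * `|complex.Im (rt z)|) * weight z) freq2 (cos_piece q u v sg c).
Proof.
have KK := K0.
exists (2 * K), b; split=> //.
- by rewrite mulr_gt0.
- move=> z _; rewrite mulrA mulfK ?gt_eqF ?weight_gt0//.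
  apply: le_trans (cos_le (rtK z)) _; rewrite ge_max; apply/andP; split;
    apply: le_trans (osc_est1 _ _) _; rewrite ler_wpM2r ?expR_ge0//; move: KK; lra.
- move=> n z wz wn; rewrite mulrA mulfK ?gt_eqF ?weight_gt0//.
  have [r [rz rI _ rn]] := near_root z wn.
  have h e : absc (osc e r) <= (b n + 2 * K * (absc (z - freq2 n) / weight (freq2 n))) *
      expR (l * `|complex.Im (rt z)|).
    apply: le_trans (osc_est2 e n r) _; rewrite rI ler_wpM2r ?expR_ge0// lerD2l.
    by rewrite (mulrC 2) -mulrA ler_pM2l.
  by apply: le_trans (cos_le rz) _; rewrite ge_max !h.
Qed.

(** Here the decay comes from the division by rho, because |rho| >= weight / 2 as soon as the weight
    is at least 2. *)
Lemma perturbation_sin_piece :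
  perturbation (fun z => expR (l * `|complex.Im (rt z)|)) freq2 (sin_piece q u v sg c).
Proof.
have KK := K0.
have key r z B : r ^+ 2 = z -> weight z = 1 + absc r -> 2 <= weight z ->
    (forall e, absc (osc e r) <= B) -> absc (sin_piece q u v sg c z) <= 2 * B / weight z.
  move=> rz wr wz h; rewrite ler_pdivlMr ?weight_gt0//.
  have h1 : absc r * absc (sin_piece q u v sg c z) <= B by apply: le_trans (sin_le rz) _; rewrite ge_max !h.
  apply: le_trans (_ : absc (sin_piece q u v sg c z) * (2 * absc r) <= _).
    by rewrite ler_wpM2l ?absc_ge0//; move: wz; rewrite wr; lra.
  by rewrite mulrCA ler_pM2l// mulrC.
exists (4 * K), (fun n => 2 * b n); split=> //.
- by rewrite mulr_gt0.
- exact: l2_boundedZ.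
- by move=> n; rewrite mulr_ge0.
- move=> z wz; apply: le_trans (key _ _ _ (rtK z) (weightE z) wz (fun e => osc_est1 e _)) _.
  rewrite ler_wpM2r ?invr_ge0 ?(ltW (weight_gt0 _))// mulrA ler_wpM2r ?expR_ge0//; move: KK; lra.
- move=> n z wz wn; have [r [rz rI wr rn]] := near_root z wn.
  have h e : absc (osc e r) <= (b n + 2 * K * (absc (z - freq2 n) / weight (freq2 n))) *
      expR (l * `|complex.Im (rt z)|).
    apply: le_trans (osc_est2 e n r) _; rewrite rI ler_wpM2r ?expR_ge0// lerD2l.
    by rewrite (mulrC 2) -mulrA ler_pM2l.
  apply: le_trans (key _ _ _ rz wr wz h) _.
  by rewrite le_eqVlt; apply/orP; left; apply/eqP; ring.
Qed.

End Perturbations.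
(** * The model zeros *)

Section Frequencies.
Context {R : realType}.
Variables (alpha : R[i]) (kap : nat -> int) (d0 : R).
Hypotheses (d0_gt0 : 0 < d0) (kap_inj : injective kap).
Hypothesis kap_sum : forall n m, n != m -> d0 <= absc ((kap n + kap m)%:~R + alpha).
Hypothesis kap_grow : forall n, n%:R <= 2 * `|(kap n)%:~R| :> R.
Hypothesis Re_alpha : 0 <= complex.Re alpha <= 1.

Local Notation mu := (freq2 alpha kap).

Let pi1 : (1 : R) <= pi. Proof. by have := @pi_ge2 R; lra. Qed.

Let intC (m : int) : m%:~R = (m%:~R : R)%:C :> R[i].
Proof. by rewrite rmorph_int. Qed.

Lemma weight_freq2 n : weight (mu n) = 1 + pi * absc (2 * (kap n)%:~R + alpha).
Proof.
rewrite /weight /freq2 abscX sqrtr_sqr ger0_norm ?absc_ge0// /freq abscM absc_real.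
by rewrite ger0_norm// pi_ge0.
Qed.

(** The difference of two model zeros is 4 pi^2 p r, with p the difference of the integers and r
    their sum plus alpha, while the weight is governed by p + r. As |p| >= 1 and |r| >= d0, the
    product dominates the sum. *)
Lemma freq2_separated : exists2 s : R, 0 < s &
  forall n m, n != m -> s * weight (mu n) <= absc (mu n - mu m).
Proof.
have p1 := pi1; have d1 : 0 < d0^-1 by rewrite invr_gt0 d0_gt0.
pose M : R := d0^-1 + pi * d0^-1 + pi.
have M0 : 0 < M by have := mulr_gt0 (pi_gt0 R) d1; rewrite /M; lra.
exists (4 * pi ^+ 2 / M); first by rewrite divr_gt0// mulr_gt0// exprn_gt0 ?pi_gt0.
move=> n m nm; have h := kap_sum nm.
have k1 : 1 <= absc ((kap n - kap m)%:~R : R[i]).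
  rewrite intC absc_real -intr_norm ler1z -gtz0_ge1 normr_gt0 subr_eq0.
  by apply: contra nm => /eqP /kap_inj ->.
rewrite weight_freq2.
have -> : absc (mu n - mu m) = 4 * pi ^+ 2 *
    (absc ((kap n - kap m)%:~R : R[i]) * absc ((kap n + kap m)%:~R + alpha)).
  have -> : 4 * pi ^+ 2 = absc (4 * (pi : R)%:C ^+ 2).
    by rewrite abscM abscX absc_real absc_nat ger0_norm ?pi_ge0.
  rewrite -!abscM; congr absc; rewrite /freq2 /freq !(rmorphD, rmorphN) /=.
  by ring.
have e : 2 * (kap n)%:~R + alpha = (kap n - kap m)%:~R + ((kap n + kap m)%:~R + alpha).
  by rewrite !rmorphD rmorphN /=; ring.
have h2 : absc (2 * (kap n)%:~R + alpha) <=
    absc ((kap n - kap m)%:~R : R[i]) + absc ((kap n + kap m)%:~R + alpha).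
  by rewrite e abscD.
move: h h2 k1.
move: (absc (2 * _ + _)) (absc ((kap n - kap m)%:~R : R[i])) (absc ((kap n + kap m)%:~R + alpha)).
move=> f p r r0 fpr p1'.
have rd : 1 <= r / d0 by rewrite ler_pdivlMr ?mul1r.
have r_ge0 : 0 <= r by exact: le_trans (ltW d0_gt0) r0.
have prd : 1 <= p * (r / d0) by apply: mulr_ege1.
have pp : p <= p * (r / d0) by rewrite ler_peMr//; lra.
have rr : r <= p * r by rewrite ler_peMl.
rewrite -mulrA ler_pM2l; last by rewrite mulr_gt0// exprn_gt0 ?pi_gt0.
rewrite mulrC ler_pdivrMr//.
have -> : p * r * M = p * (r / d0) + pi * (p * (r / d0) + p * r) by rewrite /M; ring.
by apply: lerD => //; rewrite ler_wpM2l ?pi_ge0//; lra.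
Qed.

Lemma freq2_growth : exists2 L : R, 0 < L & forall n, n.+1%:R <= L * weight (mu n).
Proof.
have p1 := pi1; have a0 := absc_ge0 alpha.
exists (absc alpha + 1); first by lra.
move=> n; rewrite weight_freq2 -addn1 natrD.
have h : n%:R <= absc (2 * (kap n)%:~R + alpha) + absc alpha.
  apply: le_trans (kap_grow n) _.
  have := abscB (2 * (kap n)%:~R + alpha) alpha; rewrite addrK abscM absc_nat intC absc_real.
  by [].
have := absc_ge0 (2 * (kap n)%:~R + alpha).
move: h; move: (absc (_ * _ + _)) => f h f0.
have h2 : f <= pi * f by rewrite ler_peMl.
have h3 : 0 <= absc alpha * (pi * f) by rewrite !mulr_ge0// pi_ge0.
by rewrite mulrDl mul1r mulrDr; lra.
Qed.

Let odd_ge1 (x : int) : 1 <= `|2 * x%:~R + 1| :> R.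
Proof.
rewrite ler_normr; case: x => n; rewrite ?NegzE ?intrN -pmulrn;
  have := ler0n R n; last rewrite -addn1 natrD; lra.
Qed.

Lemma freq2_gap : exists2 s : R, 0 < s & forall B, exists X, B <= X /\
  forall n, s * Num.sqrt X <= `|absc (mu n) - X|.
Proof.
have p0 : 0 < (pi : R) := pi_gt0 R; have p1 := pi1.
pose b := complex.Re alpha; pose A := complex.Im alpha.
(* [j] is the integer 0 or 1 nearest to Re alpha, and [c] has the other parity. *)
have [j [c [jc bj]]] : exists j c : R, (j = 0 /\ c = 1 \/ j = 1 /\ c = 0) /\ `|b - j| <= 1 / 2.
  move: Re_alpha; rewrite -/b => /andP[b0 b1]; have [h|h] := leP b (1 / 2).
    by exists 0, 1; split; [left | rewrite ler_norml; lra].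
  by exists 1, 0; split; [right | rewrite ler_norml; lra].
exists (pi / 4); first by rewrite divr_gt0.
(* The summand 4 A^2 makes A^2 <= M / 4, so the imaginary part of alpha consumes at most half of the
   gap M / 2. *)
move=> B; pose N := Num.bound (`|B| + 4 * A ^+ 2).
have hN : `|B| + 4 * A ^+ 2 < N%:R.
  by apply: archi_boundP; apply: addr_ge0 => //; apply: mulr_ge0 => //; exact: sqr_ge0.
pose M : R := 2 * N.+1%:R + c.
have M1 : 1 <= M by rewrite /M -[N.+1]addn1 natrD; have := ler0n R N; case: jc => [[_ ->]|[_ ->]]; lra.
have MN : N%:R <= M by rewrite /M -[N.+1]addn1 natrD; have := ler0n R N; case: jc => [[_ ->]|[_ ->]]; lra.
have A0 := sqr_ge0 A; have B0 := normr_ge0 B; have BB := ler_norm B.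
exists ((pi * M) ^+ 2); split.
  have h1 : M <= M * M by rewrite ler_peMl//; lra.
  have h2 : M * M <= (pi * M) ^+ 2.
    by rewrite expr2 ler_pM//; first [lra | rewrite ler_peMl//; lra].
  lra.
move=> n; set k : R := (kap n)%:~R.
rewrite sqrtr_sqr ger0_norm; last by rewrite mulr_ge0//; lra.
have -> : absc (mu n) = pi ^+ 2 * ((2 * k + b) ^+ 2 + A ^+ 2).
  rewrite /freq2 /freq !(abscX, abscM) absc_real exprMn ger0_norm ?(ltW p0)//; congr (_ * _).
  by rewrite absc_sqr ReD ImD ReM ImM intC /=; rewrite !(mulr0, mul0r, subr0, add0r).
have NE : (N.+1%:Z)%:~R = N.+1%:R :> R by rewrite pmulrn.
have m1 : 1 <= `|2 * k + j - M|.
  case: jc => [[-> cE]|[-> cE]].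
    have -> : 2 * k + 0 - M = 2 * (kap n - N.+1%:Z - 1)%:~R + 1.
      by rewrite !(intrD, intrN) NE -/k /M cE; ring.
    exact: odd_ge1.
  have -> : 2 * k + 1 - M = 2 * (kap n - N.+1%:Z)%:~R + 1.
    by rewrite !(intrD, intrN) NE -/k /M cE; ring.
  exact: odd_ge1.
(* As for the other sign, 2k + j + M is an odd integer by the choice of parities. *)
have m2 : 1 <= `|2 * k + j + M|.
  have -> : 2 * k + j + M = 2 * (kap n + N.+1%:Z)%:~R + 1.
    rewrite intrD NE -/k /M; case: jc => [[-> ->]|[-> ->]]; ring.
  exact: odd_ge1.
set x := 2 * k + b.
have x1 : 1 / 2 <= `|x - M|.
  have := ler_normB (x - M) (b - j); rewrite (_ : x - M - (b - j) = 2 * k + j - M);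
    last by rewrite /x; ring.
  by move: bj m1; lra.
have x2 : 1 / 2 <= `|x + M|.
  have := ler_normB (x + M) (b - j); rewrite (_ : x + M - (b - j) = 2 * k + j + M);
    last by rewrite /x; ring.
  by move: bj m2; lra.
(* The two factors |x - M| and |x + M| sum to at least 2M, so one of them is at least M; the other
   is at least 1/2. *)
have big : M / 2 <= `|x ^+ 2 - M ^+ 2|.
  rewrite (_ : x ^+ 2 - M ^+ 2 = (x - M) * (x + M)); last by ring.
  have := ler_normB (x + M) (x - M).
  rewrite normrM (_ : x + M - (x - M) = 2 * M); last by ring.
  rewrite (@ger0_norm _ (2 * M)); last by lra.
  move: x1 x2; move: (`|x - M|) (`|x + M|) => u v u2 v2 uv.
  by have [h|h] := leP M v; nra.
have -> : pi ^+ 2 * (x ^+ 2 + A ^+ 2) - (pi * M) ^+ 2 = pi ^+ 2 * (x ^+ 2 - M ^+ 2 + A ^+ 2) by ring.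
rewrite normrM (@ger0_norm _ (pi ^+ 2)) ?sqr_ge0//.
have h : M / 4 <= `|x ^+ 2 - M ^+ 2 + A ^+ 2|.
  have := ler_normB (x ^+ 2 - M ^+ 2 + A ^+ 2) (A ^+ 2); rewrite addrK (ger0_norm A0); lra.
apply: le_trans (_ : pi ^+ 2 * (M / 4) <= _); last by rewrite ler_pM2l// exprn_gt0.
have -> : pi / 4 * (pi * M) = pi ^+ 2 * (M / 4) by field.
by [].
Qed.

Lemma zeros_near_freq2 (F G : R[i] -> R[i]) (E : R[i] -> R) (c : R) :
  entire F -> entire G -> 0 < c -> (forall n, G (mu n) = 0) ->
  (forall z, 1 <= E z * weight z) ->
  (forall z, exists n, c * Num.min 1 (absc (z - mu n) / weight z) * E z <= absc (G z)) ->
  perturbation E mu (fun z => F z - G z) ->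
  exists2 lam, zeros_listed F lam & l2_bounded (fun n => absc (lam n - mu n)).
Proof.
move=> eF eG c0 Gmu E1 Glb [K [b [K0 lb b0 H2 H3]]].
have [s s0 sep] := freq2_separated; have [L L0 grow] := freq2_growth.
have [s' s'0 gap] := freq2_gap.
exact: (zeros_localized eF eG s0 L0 c0 K0 s'0 sep grow gap Gmu E1 Glb H2 lb H3).
Qed.

Lemma zeros_listed_freq2 (G : R[i] -> R[i]) (E : R[i] -> R) (c : R) :
  entire G -> 0 < c -> (forall n, G (mu n) = 0) -> (forall z, 1 <= E z * weight z) ->
  (forall z, exists n, c * Num.min 1 (absc (z - mu n) / weight z) * E z <= absc (G z)) ->
  zeros_listed G mu.
Proof.
move=> eG c0 Gmu E1 Glb; have [s s0 sep] := freq2_separated.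
exact: (zeros_listed_simple eG s0 c0 sep Gmu E1 Glb).
Qed.

End Frequencies.

(** * Lower bounds for the model functions *)

Section LowerBounds.
Context {R : realType}.
Implicit Types (r z alpha : R[i]) (kap : nat -> int).

Lemma weight_sqr r : weight (r ^+ 2) = 1 + absc r.
Proof. by rewrite /weight abscX sqrtr_sqr ger0_norm ?absc_ge0. Qed.

(** Transfers distances from rho to lambda: if |r - f| < 1, then |r + f| <= 2|r| + |r - f| <= 2 (1 +
    |r|). *)
Lemma dist_freq2_le r alpha kap n :
  Num.min 1 (absc (r ^+ 2 - freq2 alpha kap n) / weight (r ^+ 2)) <=
  2 * Num.min 1 (absc (r - freq alpha kap n)).
Proof.
rewrite weight_sqr /freq2; move: (freq alpha kap n) => f.
have r0 := absc_ge0 r.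
have [h|h] := leP 1 (absc (r - f)); first by rewrite mulr1 ge_min; apply/orP; left; lra.
rewrite ge_min; apply/orP; right; rewrite ler_pdivrMr; last by lra.
rewrite (_ : r ^+ 2 - f ^+ 2 = (r - f) * (r + f)); last by ring.
have h2 : absc (r + f) <= 2 * absc r + absc (r - f).
  have -> : r + f = 2 * r - (r - f) by ring.
  by apply: le_trans (abscB _ _) _; rewrite abscM absc_nat.
rewrite abscM [2 * _]mulrC -mulrA ler_wpM2l ?absc_ge0//; lra.
Qed.

Let two0 : (2 : R[i]) != 0. Proof. by rewrite pnatr_eq0. Qed.

Let absc_half r : absc (r / 2) = absc r / 2.
Proof. by rewrite abscM abscV absc_nat. Qed.

Let Im_half r : `|complex.Im (r / 2)| = 1 / 2 * `|complex.Im r|.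
Proof.
rewrite -(rmorph_nat (real_complex R) 2) -fmorphV ImM /= mulr0 add0r normrM mulrC ger0_norm//.
by rewrite mul1r.
Qed.

Lemma csin_half_lb r : exists m : int,
  1 / 8 * Num.min 1 (absc (r - (pi : R)%:C * (2 * m%:~R))) *
    expR (1 / 2 * `|complex.Im r|) <= absc (csin (r / 2)).
Proof.
have [m hm] := csin_lb (r / 2); exists m; apply: le_trans hm.
rewrite Im_half ler_wpM2r ?expR_ge0//.
have -> : r / 2 - (pi : R)%:C * m%:~R = (r - (pi : R)%:C * (2 * m%:~R)) / 2 by field.
rewrite absc_half; have := absc_ge0 (r - (pi : R)%:C * (2 * m%:~R)).
move: (absc (r - _)) => d d0; rewrite /Num.min; case: ifP; case: ifP; lra.
Qed.

End LowerBounds.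

Section ModelFunctions.
Context {R : realType}.
Implicit Types (r z alpha : R[i]).
Local Notation piC := ((pi : R)%:C).

Let two0 : (2 : R[i]) != 0. Proof. by rewrite pnatr_eq0. Qed.

Let halfC : (1 / 2 : R)%:C = 1 / 2 :> R[i].
Proof. by rewrite !mul1r fmorphV rmorph_nat. Qed.

Lemma csin_pi_int (m : int) : csin (piC * m%:~R) = 0 :> R[i].
Proof.
by apply/eqP; rewrite -absc_eq0 -(add0r (piC * _)) absc_csin_shift csin0 absc_eq0.
Qed.

Lemma ccos_csin z : ccos z = csin (z + piC / 2) :> R[i].
Proof.
rewrite csinD -(rmorph_nat (real_complex R) 2) -fmorphV -rmorphM /=.
by rewrite ccos_real csin_real cos_pihalf sin_pihalf mulr0 mulr1 add0r.
Qed.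

Lemma ccos_diff z w : ccos z - ccos w = 2 * (csin ((w + z) / 2) * csin ((w - z) / 2)) :> R[i].
Proof.
have E u v : 2 * (csin u * csin v) = ccos (u - v) - ccos (u + v) :> R[i].
  by rewrite ccosB ccosD; ring.
by rewrite E; congr (ccos _ - ccos _); field.
Qed.

Lemma rt_sinl_half r z : r ^+ 2 = z -> r * sinl (1 / 2) z = csin (r / 2).
Proof. by move=> rz; rewrite (sinl_rt _ rz) halfC mul1r. Qed.

Lemma cosl_half r z : r ^+ 2 = z -> cosl (1 / 2) z = csin ((r + piC) / 2).
Proof. by move=> rz; rewrite (cosl_rt _ rz) halfC mul1r ccos_csin -mulrDl. Qed.

Lemma cosl_half_freq n : cosl (1 / 2) (freq2 1 Posz n) = 0 :> R[i].
Proof.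
rewrite (cosl_half (erefl (freq 1 Posz n ^+ 2))) /freq.
rewrite (_ : _ / 2 = piC * (n%:Z + 1)%:~R) ?csin_pi_int//.
by rewrite intrD; field.
Qed.

Lemma sinl_half_freq n : freq2 0 Posz n * sinl (1 / 2) (freq2 0 Posz n) = 0 :> R[i].
Proof.
rewrite {1}/freq2 expr2 -mulrA (rt_sinl_half (erefl (freq 0 Posz n ^+ 2))) /freq.
rewrite (_ : _ / 2 = piC * (n%:Z)%:~R) ?csin_pi_int ?mulr0//.
by field.
Qed.

Lemma sinl_half_freqS n : sinl (1 / 2) (freq2 0 (fun n => Posz n.+1) n) = 0 :> R[i].
Proof.
have := sinl_half_freq n.+1; rewrite (_ : freq2 0 Posz n.+1 = freq2 0 (fun n => Posz n.+1) n)//.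
move/eqP; rewrite mulf_eq0 => /orP[|/eqP//].
rewrite /freq2 /freq sqrf_eq0 addr0 !mulf_eq0 (negPf two0) intr_eq0 real_complex_eq0.
by rewrite gt_eqF ?pi_gt0.
Qed.

Lemma ccos_cosl_freq alpha kap n : ccos (piC * alpha) - cosl 1 (freq2 alpha kap n) = 0 :> R[i].
Proof.
rewrite (cosl_rt _ (erefl (freq alpha kap n ^+ 2))) mulr1 ccos_diff /freq.
rewrite (_ : (_ - _) / 2 = piC * (kap n)%:~R) ?csin_pi_int ?mulr0//.
by field.
Qed.

Let expR_half_le (x y z : R) : z <= x + y -> expR z <= expR x * expR y.
Proof. by rewrite -expRD ler_expR. Qed.

(** The difference of cosines is a product of two sines. Their distances d1, d2 to the nearest zeros
    satisfy d1 + d2 >= 2 d0, so only the smaller one matters and the larger costs the constant d0.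
    The growth rates |Im (r + A)| / 2 and |Im (r - A)| / 2 add up to at least |Im r|. *)
Lemma ccos_cosl_lb alpha (kap : nat -> int) d0 : 0 < d0 -> d0 <= 1 ->
  (forall m : int, d0 <= absc (m%:~R + alpha)) -> (forall m, exists n, kap n = m) ->
  forall z, exists n, d0 / 64 * Num.min 1 (absc (z - freq2 alpha kap n) / weight z) *
    expR (1 * `|complex.Im (rt z)|) <= absc (ccos (piC * alpha) - cosl 1 z).
Proof.
move=> d00 d01 hd hk z; set r := rt z; set A := piC * alpha.
have [m1 h1] := csin_half_lb (r - A); have [m2 h2] := csin_half_lb (r + A).
(* The zeros of the factor with r + A are model frequencies as seen from the root - r, hence the
   index of - m2. *)
have [n1 k1] := hk m1; have [n2 k2] := hk (- m2).
pose d1 := absc (r - freq alpha kap n1); pose d2 := absc (- r - freq alpha kap n2).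
have e1 : absc (r - A - piC * (2 * m1%:~R)) = d1.
  by rewrite /d1 /freq k1; congr absc; rewrite /A; ring.
have e2 : absc (r + A - piC * (2 * m2%:~R)) = d2.
  by rewrite /d2 /freq k2 -abscN intrN; congr absc; rewrite /A; ring.
rewrite e1 in h1; rewrite e2 in h2.
have d12 : 2 * d0 <= d1 + d2.
  apply: le_trans (abscD _ _).
  rewrite (_ : _ + _ = - (piC * (2 * ((m1 - m2)%:~R + alpha)))); last first.
    by rewrite /freq k1 k2 intrD intrN; ring.
  rewrite abscN !abscM absc_real absc_nat ger0_norm ?pi_ge0//.
  have := hd (m1 - m2); have := @pi_ge2 R; move: (absc (_ + alpha)) (pi) => x p p2 xd.
  nra.
have Z1 := dist_freq2_le r alpha kap n1; have Z2 := dist_freq2_le (- r) alpha kap n2.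
rewrite sqrrN in Z2; rewrite -/d1 in Z1; rewrite -/d2 in Z2.
rewrite [r ^+ 2]rtK in Z1 Z2.
rewrite (cosl_rt _ (rtK z)) mulr1 -/r ccos_diff abscM absc_nat (abscM (csin _)).
have eE : expR (1 * `|complex.Im r|) <=
    expR (1 / 2 * `|complex.Im (r + A)|) * expR (1 / 2 * `|complex.Im (r - A)|).
  apply: expR_half_le.
  have := ler_normD (complex.Im (r + A)) (complex.Im (r - A)).
  rewrite -ImD (_ : r + A + (r - A) = 2 * r); last by ring.
  rewrite -(rmorph_nat (real_complex R) 2) ImM /= mul0r addr0 normrM ger0_norm//; lra.
have [p1 p2] : 0 <= d1 /\ 0 <= d2 by rewrite /d1 /d2 !absc_ge0.
have m1_ge0 : 0 <= Num.min 1 d1 by rewrite le_min ler01.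
have m2_ge0 : 0 <= Num.min 1 d2 by rewrite le_min ler01.
have s12 : 1 / 64 * (Num.min 1 d1 * Num.min 1 d2) * expR (1 * `|complex.Im r|) <=
    absc (csin ((r + A) / 2)) * absc (csin ((r - A) / 2)).
  have a1 : 0 <= 1 / 8 * Num.min 1 d1 * expR (1 / 2 * `|complex.Im (r - A)|).
    by rewrite !mulr_ge0 ?expR_ge0.
  have a2 : 0 <= 1 / 8 * Num.min 1 d2 * expR (1 / 2 * `|complex.Im (r + A)|).
    by rewrite !mulr_ge0 ?expR_ge0.
  apply: le_trans (ler_pM a2 a1 h2 h1).
  rewrite (_ : 1 / 8 * _ * _ * _ = 1 / 64 * (Num.min 1 d1 * Num.min 1 d2) *
    (expR (1 / 2 * `|complex.Im (r + A)|) * expR (1 / 2 * `|complex.Im (r - A)|))); last by field.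
  by rewrite ler_wpM2l// !mulr_ge0.
have E0 := expR_ge0 (1 * `|complex.Im r|).
move: s12 E0; move: (expR (1 * _)) (absc (csin ((r + A) / 2)) * absc (csin ((r - A) / 2))) => E cc s12 E0.
have q0 n : 0 <= Num.min 1 (absc (z - freq2 alpha kap n) / weight z).
  by rewrite le_min ler01 divr_ge0 ?absc_ge0// ltW// weight_gt0.
have [n hn] : exists n, Num.min 1 (absc (z - freq2 alpha kap n) / weight z) * d0 <=
    2 * (Num.min 1 d1 * Num.min 1 d2).
  have [h|h] := leP d1 d2.
    exists n1; rewrite mulrA; apply: ler_pM => //.
    - exact: ltW.
    - by rewrite le_min d01; lra.
  exists n2; rewrite [Num.min 1 d1 * _]mulrC mulrA; apply: ler_pM => //.
  - exact: ltW.
  - by rewrite le_min d01; lra.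
exists n; apply: le_trans (_ : 2 * (1 / 64 * (Num.min 1 d1 * Num.min 1 d2) * E) <= _);
  last by rewrite ler_pM2l.
rewrite (_ : d0 / 64 * Num.min 1 _ * E =
  1 / 64 * E * (Num.min 1 (absc (z - freq2 alpha kap n) / weight z) * d0)); last by ring.
rewrite (_ : 2 * (1 / 64 * _ * E) = 1 / 64 * E * (2 * (Num.min 1 d1 * Num.min 1 d2))); last by ring.
by rewrite ler_wpM2l// mulr_ge0.
Qed.

End ModelFunctions.

Section HalfModelFunctions.
Context {R : realType}.
Implicit Types (r z : R[i]).
Local Notation piC := ((pi : R)%:C).
Local Notation hexp z := (expR (1 / 2 * `|complex.Im (rt z)|)).

Let pi2 : (2 : R) <= pi := @pi_ge2 R.

(** A negative [m] is traded for the other root of [z], so that natural indices suffice; [odd_index]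
    uses the same reflection. *)
Let even_index z (m : int) : exists r, r ^+ 2 = z /\
  absc (r - freq 0 Posz `|m|%N) = absc (rt z - piC * (2 * m%:~R)).
Proof.
rewrite /freq addr0; case: m => n; first by exists (rt z); rewrite rtK.
exists (- rt z); rewrite sqrrN rtK; split=> //.
by rewrite -abscN NegzE abszN intrN /=; congr absc; ring.
Qed.

Let odd_index z (m : int) : exists r n, r ^+ 2 = z /\
  absc (r - freq 1 Posz n) = absc (rt z + piC - piC * (2 * m%:~R)).
Proof.
rewrite /freq; case: m => n; last first.
  exists (- rt z), n.+1; rewrite sqrrN rtK; split=> //.
  by rewrite -abscN NegzE intrN; congr absc; ring.
case: n => [|n].
  exists (- rt z), 0%N; rewrite sqrrN rtK; split=> //.
  by rewrite -abscN; congr absc; ring.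
exists (rt z), n; rewrite rtK; split=> //; congr absc.
by rewrite -[n.+1]addn1 PoszD intrD; ring.
Qed.

(** For m != 0 the point 2 pi m has modulus at least 4 and so distance at least 3 from the unit
    disc. Thus on the unit disc 0 may take the place of the index supplied by [csin_half_lb]. *)
Let zero_index z m : absc (rt z) <= 1 -> absc (rt z) <= Num.min 1 (absc (rt z - piC * (2 * m%:~R))).
Proof.
move=> r1; rewrite le_min r1 /=; have [->|m0] := eqVneq m 0; first by rewrite !mulr0 subr0.
have m1 : 1 <= absc (m%:~R : R[i]).
  rewrite -(rmorph_int (real_complex R)) absc_real -intr_norm ler1z -gtz0_ge1 normr_gt0.
  exact: m0.
have := abscB (rt z - piC * (2 * m%:~R)) (rt z); rewrite addrAC subrr add0r abscN !abscM absc_nat absc_real.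
rewrite ger0_norm ?pi_ge0//.
move: (absc (m%:~R)) (absc (rt z - _)) m1 => x y x1.
have : 4 <= pi * (2 * x) by have := pi2; nra.
by move: r1; lra.
Qed.

Lemma cosl_half_lb z : exists n,
  1 / 16 * Num.min 1 (absc (z - freq2 1 Posz n) / weight z) * hexp z <= absc (cosl (1 / 2) z).
Proof.
have [m hm] := csin_half_lb (rt z + piC).
have [r [n [rz rn]]] := odd_index z m; exists n.
rewrite (cosl_half (rtK z)); apply: le_trans hm.
have -> : complex.Im (rt z + piC) = complex.Im (rt z) by rewrite ImD /= addr0.
rewrite ler_wpM2r ?expR_ge0// -rn.
by have := dist_freq2_le r 1 Posz n; rewrite rz; lra.
Qed.

(** The function is rho sin (rho/2). For |rho| > 1 the factor rho supplies the extra weight; for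
    |rho| <= 1 both factors are small, and their product is of order |rho|^2 = |z|, the distance to
    the model zero 0. *)
Lemma rt_sinl_half_lb z : exists n,
  1 / 32 * Num.min 1 (absc (z - freq2 0 Posz n) / weight z) * (hexp z * weight z) <=
  absc (z * sinl (1 / 2) z).
Proof.
have [m hm] := csin_half_lb (rt z).
have -> : absc (z * sinl (1 / 2) z) = absc (rt z) * absc (csin (rt z / 2)).
  by rewrite -abscM -(rt_sinl_half (rtK z)) mulrA -expr2 rtK.
have r0 := absc_ge0 (rt z); have E0 := expR_ge0 (1 / 2 * `|complex.Im (rt z)|).
have [r1|r1] := leP (absc (rt z)) 1.
  exists 0%N; rewrite /freq2 /freq mulr0 addr0 mulr0 expr0n subr0.
  apply: le_trans (_ : absc (rt z) * (1 / 8 * absc (rt z) * hexp z) <= _); last first.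
    rewrite ler_wpM2l//; apply: le_trans hm; rewrite ler_wpM2r// ler_wpM2l//.
    exact: zero_index.
  have -> : absc (rt z) * (1 / 8 * absc (rt z) * hexp z) = 1 / 8 * absc (rt z) ^+ 2 * hexp z by ring.
  rewrite (mulrC (hexp z)) mulrA ler_wpM2r//.
  have -> : absc (rt z) ^+ 2 = absc z by rewrite -abscX rtK.
  have : Num.min 1 (absc z / weight z) * weight z <= absc z.
    apply: le_trans (_ : absc z / weight z * weight z <= _).
      by rewrite ler_wpM2r ?(ltW (weight_gt0 _))// ge_min lexx orbT.
    by rewrite divfK// gt_eqF// weight_gt0.
  by have := absc_ge0 z; rewrite -mulrA; lra.
have [r [rz rn]] := even_index z m; exists `|m|%N.
apply: le_trans (_ : absc (rt z) * (1 / 8 * Num.min 1 (absc (r - freq 0 Posz `|m|%N)) * hexp z) <= _).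
  rewrite (_ : absc (rt z) * _ = 1 / 8 * Num.min 1 (absc (r - freq 0 Posz `|m|%N)) * absc (rt z) * hexp z);
    last by ring.
  rewrite (mulrC (hexp z)) mulrA ler_wpM2r//.
  have := dist_freq2_le r 0 Posz `|m|%N; rewrite rz => h.
  apply: le_trans (_ : 1 / 32 * (2 * Num.min 1 (absc (r - freq 0 Posz `|m|%N))) * weight z <= _).
    by rewrite ler_wpM2r ?(ltW (weight_gt0 _))// ler_wpM2l.
  have d0 : 0 <= Num.min 1 (absc (r - freq 0 Posz `|m|%N)) by rewrite le_min ler01 absc_ge0.
  by rewrite weightE; nra.
by rewrite ler_wpM2l// rn.
Qed.

(** Division by rho removes the zero 0, hence the index shift. On |rho| <= 1 the function is bounded
    below; for |rho| > 1 the nearest point may still be m = 0, but then the minimum is 1 and any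
    index serves. *)
Lemma sinl_half_lb z : exists n,
  1 / 16 * Num.min 1 (absc (z - freq2 0 (fun n => Posz n.+1) n) / weight z) * (hexp z / weight z) <=
  absc (sinl (1 / 2) z).
Proof.
have [m hm] := csin_half_lb (rt z).
have r0 := absc_ge0 (rt z); have E0 := expR_ge0 (1 / 2 * `|complex.Im (rt z)|).
have w1 := weight_ge1 z; have w0 := weight_gt0 z.
have S0 := absc_ge0 (sinl (1 / 2) z).
have rs : absc (rt z) * absc (sinl (1 / 2) z) = absc (csin (rt z / 2)).
  by rewrite -abscM (rt_sinl_half (rtK z)).
suff [n hn] : exists n, 1 / 16 * Num.min 1 (absc (z - freq2 0 (fun n => Posz n.+1) n) / weight z) *
    hexp z <= absc (sinl (1 / 2) z) * weight z.
  by exists n; rewrite mulrA ler_pdivrMr.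
have [r1|r1] := leP (absc (rt z)) 1.
  exists 0%N; apply: le_trans (_ : 1 / 16 * hexp z <= _).
    by rewrite ler_wpM2r// ler_piMr// ge_min lexx.
  apply: le_trans (_ : absc (sinl (1 / 2) z) * 1 <= _); last by rewrite ler_wpM2l.
  rewrite mulr1; have [z0|z0] := eqVneq z 0.
    rewrite /sinl z0 eqxx absc_real rt0 /= normr0 mulr0 expR0 ger0_norm//; lra.
  have rz0 : 0 < absc (rt z) by rewrite absc_gt0 rt_eq0.
  rewrite -(ler_pM2l rz0) rs; apply: le_trans hm.
  rewrite mulrA ler_wpM2r//; have := zero_index m r1; lra.
have ww : weight z <= 2 * absc (rt z) by rewrite weightE; lra.
have rsw : absc (csin (rt z / 2)) <= absc (sinl (1 / 2) z) * weight z.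
  by rewrite -rs mulrC ler_wpM2l// weightE; lra.
case: m hm => m hm; last first.
  have [r [rz rn]] := even_index z (Negz m); exists m.
  apply: le_trans rsw; apply: le_trans hm; rewrite ler_wpM2r// -rn.
  have := dist_freq2_le r 0 Posz `|Negz m|%N; rewrite rz.
  by rewrite (_ : freq2 0 Posz `|Negz m|%N = freq2 0 (fun n => Posz n.+1) m)//; lra.
case: m hm => [|m] hm; last first.
  have [r [rz rn]] := even_index z (Posz m.+1); exists m.
  apply: le_trans rsw; apply: le_trans hm; rewrite ler_wpM2r// -rn.
  have := dist_freq2_le r 0 Posz `|Posz m.+1|%N; rewrite rz.
  by rewrite (_ : freq2 0 Posz `|Posz m.+1|%N = freq2 0 (fun n => Posz n.+1) m)//; lra.
exists 0%N; apply: le_trans rsw; apply: le_trans hm; rewrite ler_wpM2r//.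
rewrite !mulr0 subr0 (min_idPl (ltW r1)).
have : Num.min 1 (absc (z - freq2 0 (fun n => Posz n.+1) 0%N) / weight z) <= 1 by rewrite ge_min lexx.
lra.
Qed.

End HalfModelFunctions.

(** * The exponent alpha *)

Section Exponent.
Context {R : realType}.
Local Notation piC := ((pi : R)%:C).
Implicit Types gamma alpha beta : R[i].

Lemma csin_eq0_int (z : R[i]) : csin z = 0 -> exists m : int, z = piC * m%:~R.
Proof.
move=> sz; have [m hm] := csin_lb z; exists m; apply/eqP.
rewrite -subr_eq0 -absc_eq0; rewrite sz absc0 in hm.
have e0 := expR_gt0 `|complex.Im z|.
have := absc_ge0 (z - piC * m%:~R); rewrite le_eqVlt => /orP[|d0]; first by rewrite eq_sym.
have : 0 < Num.min 1 (absc (z - piC * m%:~R)) by rewrite lt_min ltr01.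
by move=> h; move: hm; rewrite leNgt !mulr_gt0.
Qed.

Lemma ccos_pi_inj alpha beta : ccos (piC * alpha) = ccos (piC * beta) ->
  exists m : int, alpha = beta + 2 * m%:~R \/ alpha = - beta + 2 * m%:~R.
Proof.
have p0 : piC != 0 by rewrite real_complex_eq0 gt_eqF ?pi_gt0.
have two0 : (2 : R[i]) != 0 by rewrite pnatr_eq0.
move=> /eqP; rewrite eq_sym -subr_eq0 ccos_diff mulf_eq0 (negPf two0) /= mulf_eq0.
case/orP=> /eqP /csin_eq0_int [m hm]; exists m; [right|left]; apply: (mulfI p0).
  rewrite (_ : piC * (- beta + _) = 2 * (piC * m%:~R) - piC * beta); last by ring.
  by rewrite -hm; field.
rewrite (_ : piC * (beta + _) = 2 * (piC * m%:~R) + piC * beta); last by ring.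
by rewrite -hm; field.
Qed.

Lemma ccos_pi0 : ccos (piC * 0) = 1.
Proof. by rewrite mulr0 ccos0. Qed.

Lemma ccos_pi1 : ccos (piC * 1) = -1.
Proof. by rewrite mulr1 ccos_real cospi rmorphN1. Qed.

Lemma is_alpha_Re gamma alpha : is_alpha gamma alpha -> 0 <= complex.Re alpha <= 1.
Proof. by move=> [[[//]|[/andP[h1 h2] _]] _]; rewrite !ltW. Qed.

Let Re_int (m : int) beta : complex.Re (beta + 2 * m%:~R) = complex.Re beta + 2 * m%:~R.
Proof.
rewrite ReD -(rmorph_int (real_complex R)) -(rmorph_nat (real_complex R) 2) -rmorphM /=.
by [].
Qed.

Lemma is_alpha1 alpha : is_alpha 1 alpha -> alpha = 0.
Proof.
move=> ha; have := is_alpha_Re ha; case: ha => _.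
rewrite expr1n mulr1 divff ?pnatr_eq0// -ccos_pi0 => /ccos_pi_inj [m].
rewrite oppr0 => H; have {H} -> : alpha = 0 + 2 * m%:~R by case: H.
rewrite Re_int /= add0r => /andP[h1 h2].
have {}h1 : (0 <= m)%R by move: h1; rewrite pmulr_rge0// ler0z.
have {}h2 : (m < 1)%R by rewrite -(@ltrz1 R); lra.
by have -> : m = 0 by [move: h1 h2; case: m => [[|n]|n]]; rewrite mulr0 addr0.
Qed.

Lemma is_alphaN1 alpha : is_alpha (-1) alpha -> alpha = 1.
Proof.
move=> ha; have := is_alpha_Re ha; case: ha => _.
rewrite sqrrN expr1n mulrN1 invrN mulrN divff ?pnatr_eq0// -ccos_pi1 => /ccos_pi_inj [m H].
have [k {H} ->] : exists k : int, alpha = 1 + 2 * k%:~R.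
  by case: H => ->; [exists m | exists (m - 1); rewrite intrD; ring].
rewrite Re_int /= => /andP[h1 h2].
have {}h1 : (- 1 < k)%R by rewrite -(@ltr_int R); lra.
have {}h2 : (k < 1)%R by rewrite -(@ltrz1 R); lra.
by have -> : k = 0 by [move: h1 h2; case: k => [[|n]|[|n]]]; rewrite mulr0 addr0.
Qed.

(** If alpha were 0 or 1, then (gamma - 1)^2 or (gamma + 1)^2 would vanish. As Re alpha lies in
    [0, 1], all other integers are at distance at least 1. *)
Lemma is_alpha_distance gamma alpha : gamma != 0 -> gamma != 1 -> gamma != -1 ->
  is_alpha gamma alpha -> exists2 d : R, 0 < d <= 1 & forall m : int, d <= absc (m%:~R + alpha).
Proof.
move=> g0 g1 gN1 ha; have /andP[r0 r1] := is_alpha_Re ha; have [_ hc] := ha.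
have g2 : 2 * gamma != 0 by rewrite mulf_neq0// pnatr_eq0.
have a0 : alpha != 0.
  apply: contra g1 => /eqP a0; move: hc; rewrite a0 ccos_pi0 => /esym /(canRL (divfK g2)) h.
  have : (gamma - 1) ^+ 2 = 0 by rewrite -(subrr (1 + gamma ^+ 2)) {2}h; ring.
  by move/eqP; rewrite sqrf_eq0 subr_eq0.
have a1 : alpha - 1 != 0.
  apply: contra gN1; rewrite subr_eq0 => /eqP a1; move: hc;
    rewrite a1 ccos_pi1 => /esym /(canRL (divfK g2)) h.
  have : (gamma + 1) ^+ 2 = 0 by rewrite -(subrr (1 + gamma ^+ 2)) {2}h; ring.
  by move/eqP; rewrite sqrf_eq0 addr_eq0.
exists (Num.min 1 (Num.min (absc alpha) (absc (alpha - 1)))).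
  by rewrite ge_min lexx !lt_min ltr01 !absc_gt0 a0 a1.
move=> m; have := absc_Re (m%:~R + alpha).
have -> : complex.Re (m%:~R + alpha) = m%:~R + complex.Re alpha
  by rewrite ReD -(rmorph_int (real_complex R)).
case: m => [[|n]|[|n]] h.
- by rewrite add0r !ge_min lexx orbT.
- rewrite ge_min; apply/orP; left; apply: le_trans h; rewrite -pmulrn -addn1 natrD.
  by have := ler0n R n; rewrite ler_normr; lra.
- by rewrite !ge_min NegzE (_ : (- (Posz 1))%:~R + alpha = alpha - 1) ?lexx ?orbT// intrN addrC.
- rewrite ge_min; apply/orP; left; apply: le_trans h; rewrite NegzE intrN -pmulrn -[n.+2]addn2 natrD.
  by have := ler0n R n; rewrite ler_normr; lra.
Qed.

End Exponent.

(* [zigzag] runs through [0, -1, 1, -2, 2, ..], so that [freq2 alpha zigzag]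
   lists the numbers [(2k + alpha)^2 pi^2] and [(2k - alpha)^2 pi^2]. *)
Definition zigzag n : int := if odd n then Negz n./2 else Posz n./2.

Lemma zigzag_even n : zigzag n.*2 = n.
Proof. by rewrite /zigzag odd_double doubleK. Qed.

Lemma zigzag_odd n : zigzag n.*2.+1 = Negz n.
Proof. by rewrite /zigzag /= odd_double /= uphalf_double. Qed.

Lemma zigzag_inj : injective zigzag.
Proof.
move=> n m; rewrite /zigzag; case: ifPn => on; case: ifPn => om // [e];
  by rewrite -(odd_double_half n) -(odd_double_half m) e ?on ?om ?(negPf on) ?(negPf om).
Qed.

Lemma zigzag_surj m : exists n, zigzag n = m.
Proof. by case: m => n; [exists n.*2; exact: zigzag_even | exists n.*2.+1; exact: zigzag_odd]. Qed.

Lemma zigzag_grow (R : realType) n : n%:R <= 2 * `|(zigzag n)%:~R| :> R.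
Proof.
have nE : n%:R = (odd n)%:R + n./2%:R * 2 :> R by rewrite -natrM -natrD muln2 odd_double_half.
rewrite nE /zigzag; have := ler0n R n./2; case: (odd n) => h.
  rewrite NegzE intrN normrN -pmulrn ger0_norm ?ler0n// -[n./2.+1]addn1 natrD /=; lra.
by rewrite -pmulrn ger0_norm //=; lra.
Qed.
(** * The spectrum *)

Section Spectrum.
Context {R : realType}.
Variables (q : R -> R[i]) (qL : L2_01 q) (a : R) (C C1 S S1 : R[i] -> R -> R[i]).
Hypotheses (a01 : 0 <= a <= 1) (fund : fundamental_solutions q a C C1 S S1).
Local Notation piC := ((pi : R)%:C).
Local Notation near_freq2 lam alpha kap :=
  (l2_bounded (fun n => absc (lam n - freq2 alpha kap n))).

Let a0 : 0 <= a. Proof. by case/andP: a01. Qed.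
Let a1 : a <= 1. Proof. by case/andP: a01. Qed.
Let le01 : (0 : R) <= 1 := ler01.
Let le00 : (0 : R) <= 0 := lexx 0.
Let le11 : (1 : R) <= 1 := lexx 1.
Let h0 : (0 : R) <= 1 / 2. Proof. by lra. Qed.
Let h1 : (1 / 2 : R) <= 1. Proof. by lra. Qed.

Let entire_cosl_half : entire (@cosl R (1 / 2)).
Proof. by apply: (entire_unit_series (@cosl_series R)); rewrite ger0_norm; lra. Qed.

Let entire_sinl_half : entire (@sinl R (1 / 2)).
Proof. by apply: (entire_unit_series (@sinl_series R)); rewrite ger0_norm; lra. Qed.

Let nat_sum (al : R) (n m : nat) : 0 <= al -> n != m -> 1 <= absc ((Posz n + Posz m)%:~R + al%:C).
Proof.
move=> al0 nm; rewrite -PoszD -(rmorph_int (real_complex R)) -rmorphD absc_real -pmulrn.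
have h : (1 : R) <= (n + m)%:R by rewrite ler1n addn_gt0; case: n nm; case: m.
by apply: le_trans (ler_norm _); lra.
Qed.

Let pos_inj : injective Posz. Proof. by move=> n m []. Qed.

Let pos_grow n : n%:R <= 2 * `|(Posz n)%:~R| :> R.
Proof. by rewrite -pmulrn ger0_norm//; have := ler0n R n; lra. Qed.

Let half_left t : (`]0, a[%classic : set R) t -> `|(-1) ^+ false * t + (1 / 2 - a)| <= 1 / 2.
Proof. by rewrite /= in_itv /= expr0 mul1r ler_norml; move: a01; lra. Qed.

Let half_right t : (`]a, 1[%classic : set R) t -> `|(-1) ^+ true * t + (a + 1 / 2)| <= 1 / 2.
Proof. by rewrite /= in_itv /= expr1 mulN1r ler_norml; move: a01; lra. Qed.

Let half_one (D : set R) sg c : (forall t, D t -> `|(-1) ^+ sg * t + c| <= 1 / 2) ->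
  forall t, D t -> `|(-1) ^+ sg * t + c| <= 1.
Proof. by move=> h t /h /le_trans; apply. Qed.

Let hexp_ge1 (l : R) z : 0 <= l -> 1 <= expR (l * `|complex.Im (rt z)|).
Proof. by move=> l0; rewrite -expR0 ler_expR mulr_ge0. Qed.

Let ReC0 : 0 <= complex.Re (0 : R[i]) <= 1. Proof. by rewrite /= lexx ler01. Qed.
Let ReC1 : 0 <= complex.Re (1 : R[i]) <= 1. Proof. by rewrite /= lexx ler01. Qed.

Let sum0 (n m : nat) : n != m -> 1 <= absc ((Posz n + Posz m)%:~R + 0 : R[i]).
Proof. exact: nat_sum. Qed.

Let sum1 (n m : nat) : n != m -> 1 <= absc ((Posz n + Posz m)%:~R + 1 : R[i]).
Proof. exact: nat_sum. Qed.

(** The zero 0 of the model belongs to the perturbed factor z sinl, so that factor is compared with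
    all [freq2 0 Posz n], while the exact factor [sinl (1 / 2)] contributes those with index at
    least 1. *)
Lemma periodic_spectrum : exists2 lam,
  zeros_listed (char_fun 1 C C1 S S1) (interleave lam (freq2 0 (fun n => Posz n.+1))) &
  near_freq2 lam 0 Posz.
Proof.
pose E z : R := expR (1 / 2 * `|complex.Im (rt z)|) * weight z.
pose H z := -1 * cos_piece q 0 a false (1 / 2 - a) z + -1 * cos_piece q a 1 true (a + 1 / 2) z.
pose G (z : R[i]) := 2 * (z * sinl (1 / 2) z).
have eG : entire G by apply: entireZ; apply: entireM => //; exact: entire_id.
have eH : entire H.
  by apply: entireD; apply: entireZ; apply: entire_cos_piece => //; apply: half_one.
have E1 z : 1 <= E z * weight z.
  by rewrite -mulrA !mulr_ege1 ?weight_ge1// hexp_ge1.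
have G0 n : G (freq2 0 Posz n) = 0 by rewrite /G sinl_half_freq mulr0.
have Glb z : exists n, 1 / 32 * Num.min 1 (absc (z - freq2 0 Posz n) / weight z) * E z <= absc (G z).
  have [n hn] := rt_sinl_half_lb z; exists n; apply: le_trans hn _.
  by rewrite /G (abscM 2) absc_nat ler_peMl ?absc_ge0//; lra.
have E0 z : 0 <= E z by rewrite mulr_ge0 ?expR_ge0// ltW// weight_gt0.
have pH : perturbation E (freq2 0 Posz) H.
  apply: perturbationD; apply: perturbationZ => //.
    exact: (perturbation_cos_piece qL le00 a1 h0 h1 half_left _ pos_inj).
  exact: (perturbation_cos_piece qL a0 le11 h0 h1 half_right _ pos_inj).
have pGH : perturbation E (freq2 0 Posz) (fun z => G z + H z - G z).
  by rewrite (_ : (fun z => _) = H)//; apply/funext => z; rewrite addrC addKr.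
have c32 : 0 < 1 / 32 :> R by [].
have [lam hl1 hl2] := zeros_near_freq2 ltr01 pos_inj sum0 pos_grow ReC0
  (entireD eG eH) eG c32 G0 E1 Glb pGH.
exists lam => //.
have Sinj : injective (fun n => Posz n.+1) by move=> n m [].
have Ssum n m : n != m -> 1 <= absc ((Posz n.+1 + Posz m.+1)%:~R + 0 : R[i]).
  by move=> nm; apply: sum0; rewrite eqSS.
(* Relative to the exponential sin (rho/2) / rho loses one factor rho, hence the division by the
   weight. *)
pose E' z : R := expR (1 / 2 * `|complex.Im (rt z)|) / weight z.
have eS : entire (fun z => 2 * sinl (1 / 2) z : R[i]) by exact: entireZ.
have S0 n : 2 * sinl (1 / 2) (freq2 0 (fun n => Posz n.+1) n) = 0 :> R[i].
  by rewrite sinl_half_freqS mulr0.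
have E'1 z : 1 <= E' z * weight z.
  by rewrite divfK ?gt_eqF ?weight_gt0// hexp_ge1.
have Slb z : exists n, 1 / 16 * Num.min 1 (absc (z - freq2 0 (fun n => Posz n.+1) n) / weight z) * E' z <=
    absc (2 * sinl (1 / 2) z).
  have [n hn] := sinl_half_lb z; exists n; apply: le_trans hn _.
  by rewrite (abscM 2) absc_nat ler_peMl ?absc_ge0//; lra.
have c0 : 0 < 1 / 16 :> R by [].
have hS := zeros_listed_freq2 ltr01 Sinj Ssum eS c0 S0 E'1 Slb.
have -> : char_fun 1 C C1 S S1 = (fun z => (G z + H z) * (2 * sinl (1 / 2) z)).
  by apply/funext => z; rewrite (char_fun_periodic qL a01 fund) mulrC.
exact: zeros_listedM.
Qed.

(** The unperturbed factor is here the model [G] itself, so a single lower bound serves both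
    factors. *)
Lemma antiperiodic_spectrum : exists2 lam,
  zeros_listed (char_fun (-1) C C1 S S1) (interleave lam (freq2 1 Posz)) &
  near_freq2 lam 1 Posz.
Proof.
pose E z : R := expR (1 / 2 * `|complex.Im (rt z)|).
pose H z := sin_piece q 0 a false (1 / 2 - a) z + sin_piece q a 1 true (a + 1 / 2) z.
pose G (z : R[i]) := 2 * cosl (1 / 2) z.
have eG : entire G by exact: entireZ.
have eH : entire H by apply: entireD; apply: entire_sin_piece => //; apply: half_one.
have E1 z : 1 <= E z * weight z by rewrite mulr_ege1 ?weight_ge1// hexp_ge1.
have G0 n : G (freq2 1 Posz n) = 0 by rewrite /G cosl_half_freq mulr0.
have Glb z : exists n, 1 / 16 * Num.min 1 (absc (z - freq2 1 Posz n) / weight z) * E z <= absc (G z).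
  have [n hn] := cosl_half_lb z; exists n; apply: le_trans hn _.
  by rewrite /G (abscM 2) absc_nat ler_peMl ?absc_ge0//; lra.
have pH : perturbation E (freq2 1 Posz) H.
  apply: perturbationD.
    exact: (perturbation_sin_piece qL le00 a1 h0 h1 half_left _ pos_inj).
  exact: (perturbation_sin_piece qL a0 le11 h0 h1 half_right _ pos_inj).
have pGH : perturbation E (freq2 1 Posz) (fun z => G z + H z - G z).
  by rewrite (_ : (fun z => _) = H)//; apply/funext => z; rewrite addrC addKr.
have c0 : 0 < 1 / 16 :> R by [].
have [lam hl1 hl2] := zeros_near_freq2 ltr01 pos_inj sum1 pos_grow ReC1
  (entireD eG eH) eG c0 G0 E1 Glb pGH.
exists lam => //.
have hG := zeros_listed_freq2 ltr01 pos_inj sum1 eG c0 G0 E1 Glb.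
have -> : char_fun (-1) C C1 S S1 = (fun z => (G z + H z) * G z).
  by apply/funext => z; rewrite (char_fun_antiperiodic qL a01 fund) mulrC.
exact: zeros_listedM.
Qed.

(** Away from gamma = 1 and gamma = -1 the distance of alpha to the integers is positive; this
    separates the model zeros, and no factorization is required. The defining equation of alpha
    identifies 1 + gamma^2 with 2 gamma cos (pi alpha). *)
Lemma generic_spectrum gamma alpha : gamma != 0 -> gamma != 1 -> gamma != -1 ->
  is_alpha gamma alpha -> exists2 lam,
  zeros_listed (char_fun gamma C C1 S S1) lam & near_freq2 lam alpha zigzag.
Proof.
move=> g0 g1 gN1 ha; have [d /andP[d0 d1] hd] := is_alpha_distance g0 g1 gN1 ha.
have ReA := is_alpha_Re ha; have [_ hc] := ha.
have two0 : (2 : R[i]) != 0 by rewrite pnatr_eq0.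
have g2 : 2 * gamma != 0 by rewrite mulf_neq0.
pose E z : R := expR (1 * `|complex.Im (rt z)|).
pose H z := (sin_piece q 0 a false (- a) z + (- gamma) * sin_piece q 0 a false (1 - a) z) +
  (gamma ^+ 2 * sin_piece q a 1 true a z + (- gamma) * sin_piece q a 1 true (1 + a) z).
pose G z := (2 * gamma) * (ccos (piC * alpha) - cosl 1 z).
have e1 t : (`]0, a[%classic : set R) t -> `|(-1) ^+ false * t + - a| <= 1.
  by rewrite /= in_itv /= expr0 mul1r ler_norml; move: a01; lra.
have e2 t : (`]0, a[%classic : set R) t -> `|(-1) ^+ false * t + (1 - a)| <= 1.
  by rewrite /= in_itv /= expr0 mul1r ler_norml; move: a01; lra.
have e3 t : (`]a, 1[%classic : set R) t -> `|(-1) ^+ true * t + a| <= 1.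
  by rewrite /= in_itv /= expr1 mulN1r ler_norml; move: a01; lra.
have e4 t : (`]a, 1[%classic : set R) t -> `|(-1) ^+ true * t + (1 + a)| <= 1.
  by rewrite /= in_itv /= expr1 mulN1r ler_norml; move: a01; lra.
have eG : entire G.
  apply: entireZ; apply: entireB; first exact: entire_cst.
  by apply: (entire_unit_series (@cosl_series R)); rewrite ger0_norm.
have eH : entire H.
  apply: entireD; apply: entireD; try apply: entireZ; exact: entire_sin_piece.
have E1 z : 1 <= E z * weight z by rewrite mulr_ege1 ?weight_ge1// hexp_ge1.
have G0 n : G (freq2 alpha zigzag n) = 0 by rewrite /G ccos_cosl_freq mulr0.
have gpos : 0 < absc (2 * gamma) by rewrite absc_gt0.
have c0 : 0 < absc (2 * gamma) * (d / 64) by rewrite mulr_gt0// divr_gt0.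
have Glb z : exists n, absc (2 * gamma) * (d / 64) *
    Num.min 1 (absc (z - freq2 alpha zigzag n) / weight z) * E z <= absc (G z).
  have [n hn] := ccos_cosl_lb d0 d1 hd zigzag_surj z; exists n.
  by rewrite /G (abscM (2 * gamma)) -2!(mulrA (absc (2 * gamma))) ler_pM2l.
have E0 z : 0 <= E z by exact: expR_ge0.
have pH : perturbation E (freq2 alpha zigzag) H.
  apply: perturbationD; apply: perturbationD; try apply: perturbationZ => //.
  - exact: (perturbation_sin_piece qL le00 a1 ler01 le11 e1 _ zigzag_inj).
  - exact: (perturbation_sin_piece qL le00 a1 ler01 le11 e2 _ zigzag_inj).
  - exact: (perturbation_sin_piece qL a0 le11 ler01 le11 e3 _ zigzag_inj).
  - exact: (perturbation_sin_piece qL a0 le11 ler01 le11 e4 _ zigzag_inj).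
have pGH : perturbation E (freq2 alpha zigzag) (fun z => G z + H z - G z).
  by rewrite (_ : (fun z => _) = H)//; apply/funext => z; rewrite addrC addKr.
have hsum n m : n != m -> d <= absc ((zigzag n + zigzag m)%:~R + alpha) by move=> _; exact: hd.
have -> : char_fun gamma C C1 S S1 = (fun z => G z + H z).
  apply/funext => z; rewrite (char_fun_formula qL gamma z a01 fund) /G /H hc.
  have e : 2 * gamma * ((1 + gamma ^+ 2) / (2 * gamma)) = 1 + gamma ^+ 2 by rewrite mulrC divfK.
  rewrite mulrBr e; clear.
  move: (sin_piece _ _ _ _ (- a) z) (sin_piece _ _ _ _ (1 - a) z) (sin_piece _ _ _ _ a z)
    (sin_piece _ _ _ _ (1 + a) z) (cosl 1 z) => s1 s2 s3 s4 k.
  by ring.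
exact: (zeros_near_freq2 d0 zigzag_inj hsum (zigzag_grow R) ReA (entireD eG eH) eG c0 G0 E1 Glb pGH).
Qed.

End Spectrum.

Lemma l2_bounded_evens {R : realType} (u : nat -> R) :
  l2_bounded u -> l2_bounded (fun n => if odd n then 0 else u n./2).
Proof.
move=> [M hM]; exists M => n; apply: le_trans (hM (uphalf n)).
(* Among the indices below n exactly [uphalf n] are even. *)
suff -> : \sum_(i < n) (if odd i then 0 else u i./2) ^+ 2 = \sum_(i < uphalf n) u i ^+ 2 by [].
elim: n => [|n IH]; first by rewrite !big_ord0.
rewrite big_ord_recr IH /= uphalfE /= [in RHS](_ : n./2.+1 = uphalf n + ~~ odd n)%N; last first.
  by rewrite uphalf_half; case: (odd n); rewrite ?addn0 ?add0n ?addn1.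
rewrite uphalf_half; case: (odd n); rewrite ?expr0n ?addr0 ?addn0//=.
by rewrite add0n addn1 big_ord_recr.
Qed.
Lemma freq2_zigzag_even {R : realType} (alpha : R[i]) k :
  freq2 alpha zigzag (2 * k)%N = ((2 * k)%:R + alpha) ^+ 2 * (pi : R)%:C ^+ 2.
Proof. by rewrite /freq2 /freq mul2n zigzag_even -mul2n natrM; ring. Qed.

Lemma freq2_zigzag_odd {R : realType} (alpha : R[i]) k : (1 <= k)%N ->
  freq2 alpha zigzag (2 * k - 1)%N = ((2 * k)%:R - alpha) ^+ 2 * (pi : R)%:C ^+ 2.
Proof.
case: k => // k _; rewrite (_ : (2 * k.+1 - 1)%N = k.*2.+1); last by rewrite mul2n doubleS subn1.
by rewrite /freq2 /freq zigzag_odd NegzE intrN natrM /=; ring.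
Qed.

(* For [gamma = 1] and [gamma = -1] the zeros of the unperturbed factor of the
   characteristic function are exactly the odd-indexed model values. *)
Lemma interleave_near {R : realType} (alpha : R[i]) (lam lam' : nat -> R[i]) :
  l2_bounded (fun n => absc (lam n - freq2 alpha Posz n)) ->
  (forall n, lam' n = freq2 alpha zigzag n.*2.+1) ->
  l2_bounded (fun n => absc (interleave lam lam' n - freq2 alpha zigzag n)).
Proof.
move=> hl hl'; apply: (l2_bounded_le (N := 0)) (l2_bounded_evens hl) => n _.
have -> : freq2 alpha zigzag n =
    if odd n then freq2 alpha zigzag n./2.*2.+1 else freq2 alpha Posz n./2.
  by rewrite -{1}(odd_double_half n); case: (odd n) => //=; rewrite /freq2 /freq add0n zigzag_even.
rewrite ger0_norm ?absc_ge0// /interleave; case: (odd n) => //.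
by rewrite hl' subrr absc0.
Qed.

Theorem theorem1 (R : realType) (q : R -> R[i]) (a : R) (gamma alpha : R[i])
    (C C1 S S1 : R[i] -> R -> R[i]) :
  L2_01 q -> 0 <= a <= 1 -> gamma != 0 -> is_alpha gamma alpha ->
  fundamental_solutions q a C C1 S S1 ->
  exists lam kappa : nat -> R[i],
    [/\ enumerates_zeros (char_fun gamma C C1 S S1) lam,
        forall k : nat,
          lam (2 * k)%N =
            ((2 * k)%:R + alpha) ^+ 2 * (pi : R)%:C ^+ 2 + kappa (2 * k)%N,
        forall k : nat, (1 <= k)%N ->
          lam (2 * k - 1)%N =
            ((2 * k)%:R - alpha) ^+ 2 * (pi : R)%:C ^+ 2 + kappa (2 * k - 1)%N,
        in_l2 kappa &
        gamma = 1 \/ gamma = -1 ->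
          forall k : nat, (1 <= k)%N -> kappa (2 * k - 1)%N = 0].
Proof.
move=> qL a01 g0 ha fund.
(* Along [zigzag] the even positions carry 2k + alpha and the odd ones - 2k + alpha, whose square is
   that of 2k - alpha; so [kappa] is the difference to [freq2 alpha zigzag] at every index. *)
suff [lam [zl near exact_odd]] : exists lam,
    [/\ zeros_listed (char_fun gamma C C1 S S1) lam,
        l2_bounded (fun n => absc (lam n - freq2 alpha zigzag n)) &
        gamma = 1 \/ gamma = -1 -> forall n, lam n.*2.+1 = freq2 alpha zigzag n.*2.+1].
  exists lam, (fun n => lam n - freq2 alpha zigzag n); split.
  - exact: zeros_listed_enumerates.
  - by move=> k; rewrite -freq2_zigzag_even addrC subrK.
  - by move=> k k1; rewrite -freq2_zigzag_odd// addrC subrK.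
  - exact: l2_bounded_in_l2.
  - move=> g [//|k] _; rewrite (_ : (2 * k.+1 - 1)%N = k.*2.+1); last by rewrite mul2n doubleS subn1.
    by rewrite exact_odd// subrr.
have [g1|g1] := eqVneq gamma 1.
  move: ha; rewrite g1 => /is_alpha1 ->.
  have [lam zl near] := periodic_spectrum qL a01 fund.
  have odd_eq n : freq2 0 (fun n => Posz n.+1) n = freq2 0 zigzag n.*2.+1 :> R[i].
    by rewrite /freq2 /freq zigzag_odd NegzE intrN; ring.
  exists (interleave lam (freq2 0 (fun n => Posz n.+1))); split=> //.
    exact: interleave_near.
  by move=> _ n; rewrite /interleave /= odd_double /= uphalf_double.
have [gN1|gN1] := eqVneq gamma (-1).
  move: ha; rewrite gN1 => /is_alphaN1 ->.
  have [lam zl near] := antiperiodic_spectrum qL a01 fund.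
  (* The frequencies 2n + 1 and 2 (- (n + 1)) + 1 are opposite and have the same square. *)
  have odd_eq n : freq2 1 Posz n = freq2 1 zigzag n.*2.+1 :> R[i].
    by rewrite /freq2 /freq zigzag_odd NegzE intrN -[n.+1]addn1 PoszD intrD; ring.
  exists (interleave lam (freq2 1 Posz)); split=> //.
    exact: interleave_near.
  by move=> _ n; rewrite /interleave /= odd_double /= uphalf_double.
have [lam zl near] := generic_spectrum qL a01 fund g0 g1 gN1 ha.
exists lam; split=> //; case=> g; first by rewrite g eqxx in g1.
by rewrite g eqxx in gN1.
Qed.
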